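(* Let $r_{\mathrm{out}},r_{\mathrm{in}},d_{\mathrm{out}},d_{\mathrm{in}},q_{\mathrm{out}},q_{\mathrm{in}},q^*:\mathbb{N}\to\mathbb{N}$ and $\varepsilon_{\mathrm{out}},\varepsilon_{\mathrm{in}},\rho_{\mathrm{out}},\delta_{\mathrm{in}}:\mathbb{N}\to[0,1]$ be such that: (1) the language $\mathcal{L}$ has a robust boolean non-adaptive perfect zero-knowledge PCP $(\mathcal{P}_{\mathrm{out}},\mathcal{V}_{\mathrm{out}})$ with randomness complexity $r_{\mathrm{out}}$, query complexity $q_{\mathrm{out}}$, decision complexity $d_{\mathrm{out}}$, robust-soundness error $1-\varepsilon_{\mathrm{out}}$, robustness parameter $\rho_{\mathrm{out}}$ and zero-knowledge query bound $q^*$; (2) $\textsc{Circuit Value}$ has a boolean PCP of proximity $(\mathcal{P}_{\mathrm{in}},\mathcal{V}_{\mathrm{in}})$, where $\mathcal{P}_{\mathrm{in}}$ is deterministic and efficient, with randomness complexity $r_{\mathrm{in}}$, query complexity $q_{\mathrm{in}}$, decision complexity $d_{\mathrm{in}}$, proximity parameter $\delta_{\mathrm{in}}$ and soundness error $1-\varepsilon_{\mathrm{in}}$; (3) $\delta_{\mathrm{in}}(d_{\mathrm{out}}(n))\le\rho_{\mathrm{out}}(n)$ for every $n$. Then $\mathcal{L}$ has a perfect zero-knowledge PCP with randomness complexity $r_{\mathrm{out}}(n)+r_{\mathrm{in}}(d_{\mathrm{out}}(n))$, query complexity $q_{\mathrm{in}}(d_{\mathrm{out}}(n))$, decision complexity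 $d_{\mathrm{in}}(d_{\mathrm{out}}(n))$, soundness error $1-\varepsilon_{\mathrm{out}}(n)\cdot\varepsilon_{\mathrm{in}}(d_{\mathrm{out}}(n))$, and query bound $q^*/q_{\mathrm{out}}$.
   Context: PCPs: A PCP for a relation $\mathcal{R}$ (language $\mathcal{L}=\{x:\exists w,(x,w)\in\mathcal{R}\}$) has a randomized prover $\mathcal{P}$ and probabilistic polynomial-time verifier $\mathcal{V}$ with oracle access to a proof $\pi$; completeness: $\Pr_{\pi\leftarrow\mathcal{P}(x,w)}[\mathcal{V}^\pi(x)=1]=1$ for $(x,w)\in\mathcal{R}$; soundness error $s$: $\Pr[\mathcal{V}^{\pi^*}(x)=1]\le s$ for $x\notin\mathcal{L}$ and every $\pi^*$. Non-adaptive verifier: $\mathcal{V}^\pi(x;\mu)=D(x,\pi|_{Q(x;\mu)};\mu)$, with $Q$ the query algorithm and $D$ the decision algorithm; decision complexity $d$ means $D(x,\cdot;\mu)$ is computed by a circuit of size $d$; $\mathrm{Acc}(\mathcal{V}(x;\mu))$ is the set of query-answer tuples $a$ with $D(x,a;\mu)=1$. Robust-soundness error $s$ with robustness parameter $\rho$: for all $x\notin\mathcal{L}$ and $\pi^*$, $\Pr_\mu[\Delta(\pi^*|_{Q(x;\mu)},\mathrm{Acc}(\mathcal{V}(x;\mu)))\le\rho]\le s$ ($\Delta$ = relative Hamming distance). Boolean means alphabet $\{0,1\}$. PCP of proximity (PCPP) for a pair language $\mathcal{L}'$ (set of pairs $(x,y)$; $\mathcal{L}'[x]=\{y:(x,y)\in\mathcal{L}'\}$)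 with proximity parameter $\delta$: verifier gets explicit input $x$ and oracle access to both $y$ and a proof $\pi$; completeness: if $(x,y)\in\mathcal{L}'$ then $\Pr_{\pi\leftarrow\mathcal{P}(x,y)}[\mathcal{V}^{(y,\pi)}(x)=1]=1$; soundness error $s$: if $y$ is $\delta$-far (relative Hamming distance at least $\delta$) from $\mathcal{L}'[x]$ then $\Pr[\mathcal{V}^{(y,\pi^* )}(x)=1]\le s$ for all $\pi^*$. $\textsc{Circuit Value}$ is the pair language of pairs $(C,y)$ with $C$ a boolean circuit and $y$ an assignment with $C(y)=1$; complexities of its PCPP are functions of the circuit size. Perfect zero knowledge with query bound $q^*$: for every adaptive (possibly malicious) verifier $\mathcal{V}^*$ making at most $q^*$ queries there is a probabilistic polynomial-time simulator whose output on $x$ is identically distributed to $\mathcal{V}^*$'s view (its random coins and all query answers) with oracle $\pi\leftarrow\mathcal{P}(x,w)$, for all $(x,w)\in\mathcal{R}$. *)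

(* Defs.v *)
From HB Require Import structures.
From mathcomp Require Import all_boot all_order all_algebra.
From mathcomp Require Import boolp classical_sets reals constructive_ereal ereal.

Set Implicit Arguments.
Unset Strict Implicit.
Unset Printing Implicit Defensive.

Import Order.TTheory GRing.Theory Num.Theory.

Local Open Scope ring_scope.

(* The machine model is a WHILE language over binary trees with coin tosses
   and oracle queries.  Every evaluation is charged the size of all the trees
   it produces, so that running times agree, up to a polynomial, with those of
   probabilistic oracle Turing machines. *)

Inductive data := Nil | Cons of data & data.

Fixpoint data_eqb (d e : data) : bool :=
  match d, e with
  | Nil, Nil => true
  | Cons a b, Cons a' b' => data_eqb a a' && data_eqb b b'
  | _, _ => false
  end.

Lemma data_eqP : Equality.axiom data_eqb.
Proof.
elim=> [|a IHa b IHb] [|a' b'] /=; try by constructor.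
by apply: (iffP andP) => [[/IHa -> /IHb ->]|[/IHa ? /IHb ?]].
Qed.

HB.instance Definition _ := hasDecEq.Build data data_eqP.

Fixpoint dsize (d : data) : nat :=
  if d is Cons a b then (dsize a + dsize b).+1 else 1%N.

Definition enc_bool (b : bool) : data := if b then Cons Nil Nil else Nil.

Fixpoint enc_seq (s : seq data) : data :=
  if s is d :: s' then Cons d (enc_seq s') else Nil.

Definition enc_bits (s : seq bool) : data := enc_seq (map enc_bool s).

Fixpoint bits_of_data (d : data) : seq bool :=
  if d is Cons a b then (a != Nil) :: bits_of_data b else [::].

(* Bijective base-2 numeration, least significant digit first: the bit b stands
   for the digit b.+1, so that every bit string names exactly one number. *)
Fixpoint num_of_bits (s : seq bool) : nat :=
  if s is b :: s' then (b + (num_of_bits s').*2).+1 else 0%N.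

Fixpoint bits_of_num_rec (fuel n : nat) : seq bool :=
  if fuel is fuel'.+1 then
    if n is m.+1 then odd m :: bits_of_num_rec fuel' m./2 else [::]
  else [::].

Definition bits_of_num (n : nat) : seq bool := bits_of_num_rec n n.

Lemma bits_of_numK : cancel bits_of_num num_of_bits.
Proof.
suff recK f n : (n <= f)%N -> num_of_bits (bits_of_num_rec f n) = n.
  by move=> n; apply: recK.
elim: f n => [|f IHf] [|m] //= le_mf.
have le_hm : (m./2 <= m)%N.
  by rewrite -{2}(odd_double_half m) -addnn addnA leq_addl.
by rewrite (IHf _ (leq_trans le_hm (le_mf : (m <= f)%N))) odd_double_half.
Qed.

Definition enc_num (n : nat) : data := enc_bits (bits_of_num n).

Inductive expr :=
  | Evar of nat
  | Enil
  | Econs of expr & expr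
  | Ehd of expr
  | Etl of expr
  | Eeq of expr & expr.

Inductive cmd :=
  | Skip
  | Assign of nat & expr
  | Seq of cmd & cmd
  | If of expr & cmd & cmd
  | While of expr & cmd
  | Toss of nat
  | Query of nat & expr.

Definition memory := nat -> data.

Definition upd (m : memory) (i : nat) (d : data) : memory :=
  fun j => if j == i then d else m j.

Fixpoint eval (m : memory) (e : expr) : data :=
  match e with
  | Evar i => m i
  | Enil => Nil
  | Econs e1 e2 => Cons (eval m e1) (eval m e2)
  | Ehd e1 => if eval m e1 is Cons a _ then a else Nil
  | Etl e1 => if eval m e1 is Cons _ b then b else Nil
  | Eeq e1 e2 => enc_bool (eval m e1 == eval m e2)
  end.

Fixpoint ecost (m : memory) (e : expr) : nat :=
  dsize (eval m e) +
  match e with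
  | Evar _ | Enil => 0
  | Ehd e1 | Etl e1 => ecost m e1
  | Econs e1 e2 | Eeq e1 e2 => ecost m e1 + ecost m e2
  end.

(* [exec O c m cs ans t m']: with oracle [O] and started in memory [m], the
   program [c] terminates in memory [m'] after [t] steps, having tossed the
   coins [cs] and received the oracle answers [ans] (both in order). *)
Inductive exec (O : nat -> seq bool) :
    cmd -> memory -> seq bool -> seq (seq bool) -> nat -> memory -> Prop :=
  | exec_skip m : exec O Skip m [::] [::] 1 m
  | exec_assign m i e :
      exec O (Assign i e) m [::] [::] (ecost m e).+1 (upd m i (eval m e))
  | exec_seq c1 c2 m m1 m2 cs1 cs2 a1 a2 t1 t2 :
      exec O c1 m cs1 a1 t1 m1 -> exec O c2 m1 cs2 a2 t2 m2 ->
      exec O (Seq c1 c2) m (cs1 ++ cs2) (a1 ++ a2) (t1 + t2) m2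
  | exec_if e c1 c2 m m' cs a t :
      exec O (if eval m e != Nil then c1 else c2) m cs a t m' ->
      exec O (If e c1 c2) m cs a (ecost m e + t).+1 m'
  | exec_while_stop e c m :
      eval m e = Nil -> exec O (While e c) m [::] [::] (ecost m e).+1 m
  | exec_while_loop e c m m1 m2 cs1 cs2 a1 a2 t1 t2 :
      eval m e <> Nil ->
      exec O c m cs1 a1 t1 m1 -> exec O (While e c) m1 cs2 a2 t2 m2 ->
      exec O (While e c) m (cs1 ++ cs2) (a1 ++ a2)
           (ecost m e + t1 + t2).+1 m2
  | exec_toss m i b : exec O (Toss i) m [:: b] [::] 1 (upd m i (enc_bool b))
  | exec_query m i e (a := O (num_of_bits (bits_of_data (eval m e)))) :
      exec O (Query i e) m [::] [:: a] (ecost m e + dsize (enc_bits a)).+1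
           (upd m i (enc_bits a)).

(* Input and output are held in variable 0; all other variables start empty.
   The program reads its coins off the random tape [mu], not necessarily to
   the end; the tape has no end marker. *)
Definition runs (O : nat -> seq bool) (M : cmd) (input : data) (mu : seq bool)
    (cs : seq bool) (ans : seq (seq bool)) (out : data) (t : nat) : Prop :=
  prefix cs mu /\
  exists m, exec O M (upd (fun=> Nil) 0 input) cs ans t m /\ m 0%N = out.

Definition no_oracle : nat -> seq bool := fun=> [::].

Definition polynomially_bounded (T : nat -> nat) : Prop :=
  exists c k : nat, forall n, (T n <= c * n ^ k + c)%N.

(* The randomized function [f], on inputs [i] of size [sz i], is computed in
   polynomial time using at most [r (sz i)] coins. *)
Definition ppt (I : Type) (enc : I -> data) (sz : I -> nat) (r : nat -> nat)
    (f : I -> seq bool -> data) : Prop :=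
  exists (M : cmd) (T : nat -> nat), polynomially_bounded T /\
    forall i mu, size mu = r (sz i) ->
      exists cs ans t,
        runs no_oracle M (enc i) mu cs ans (f i mu) t /\ (t <= T (sz i))%N.

Definition polytime (I : Type) (enc : I -> data) (sz : I -> nat)
    (f : I -> data) : Prop :=
  ppt enc sz (fun=> 0%N) (fun i _ => f i).

(* Wires are numbered from 0: first the inputs, then the gates, in order. *)

Inductive gate :=
  | Gconst of bool
  | Gnot of nat
  | Gand of nat & nat
  | Gor of nat & nat.

Definition gate_ok (k : nat) (g : gate) : bool :=
  match g with
  | Gconst _ => true
  | Gnot i => (i < k)%N
  | Gand i j | Gor i j => (i < k)%N && (j < k)%N
  end.

Fixpoint gates_ok (k : nat) (gs : seq gate) : bool :=
  if gs is g :: gs' then gate_ok k g && gates_ok k.+1 gs' else true.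

Record circuit := Circuit {
  c_inputs : nat;
  c_gates : seq gate;
  c_output : nat;
  c_wf : gates_ok c_inputs c_gates && (c_output < c_inputs + size c_gates)%N
}.

Definition csize (C : circuit) : nat := (c_inputs C + size (c_gates C))%N.

Definition gate_value (w : seq bool) (g : gate) : bool :=
  match g with
  | Gconst b => b
  | Gnot i => ~~ nth false w i
  | Gand i j => nth false w i && nth false w j
  | Gor i j => nth false w i || nth false w j
  end.

(* meaningful when [size a = c_inputs C] *)
Definition ceval (C : circuit) (a : seq bool) : bool :=
  nth false (foldl (fun w g => rcons w (gate_value w g)) a (c_gates C))
      (c_output C).

Definition enc_gate (g : gate) : data :=
  match g with
  | Gconst b => enc_seq [:: enc_num 0; enc_bool b]
  | Gnot i => enc_seq [:: enc_num 1; enc_num i]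
  | Gand i j => enc_seq [:: enc_num 2; enc_num i; enc_num j]
  | Gor i j => enc_seq [:: enc_num 3; enc_num i; enc_num j]
  end.

(* The number of inputs is written in unary. *)
Definition enc_circuit (C : circuit) : data :=
  enc_seq [:: enc_seq (nseq (c_inputs C) Nil);
              enc_seq (map enc_gate (c_gates C));
              enc_num (c_output C)].

Record fdist (R : realType) (T : Type) := FDist {
  fd_space : finType;
  fd_weight : fd_space -> R;
  fd_val : fd_space -> T;
  fd_ge0 : forall o, 0 <= fd_weight o;
  fd_sum1 : \sum_o fd_weight o = 1
}.

Definition Pr (R : realType) (T : Type) (D : fdist R T) (E : T -> Prop) : R :=
  \sum_(o : fd_space D | `[< E (fd_val o) >]) fd_weight o.

Section Distributions.
Variable R : realType.

Lemma dirac_ge0 (o : unit) : 0 <= (fun=> 1 : R) o.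
Proof. exact: ler01. Qed.

Lemma dirac_sum1 : \sum_(o : unit) (1 : R) = 1.
Proof. by rewrite sumr_const card_unit. Qed.

Definition fdirac (T : Type) (x : T) : fdist R T :=
  FDist (fun=> x) dirac_ge0 dirac_sum1.

Lemma coins_ge0 r (o : r.-tuple bool) : 0 <= (fun=> (2 ^+ r)^-1 : R) o.
Proof. by rewrite invr_ge0 exprn_ge0. Qed.

Lemma coins_sum1 r : \sum_(o : r.-tuple bool) (2 ^+ r)^-1 = 1 :> R.
Proof.
by rewrite sumr_const card_tuple card_bool -[_ *+ _]mulr_natl natrX mulfV.
Qed.

Definition coins (r : nat) : fdist R (seq bool) :=
  FDist (fun o : r.-tuple bool => tval o) (@coins_ge0 r) (coins_sum1 r).

Variables (T U : Type) (D : fdist R T) (E : fdist R U).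

Lemma fprod_ge0 (o : fd_space D * fd_space E) :
  0 <= (fun o => fd_weight o.1 * fd_weight o.2) o.
Proof. by apply: mulr_ge0; apply: fd_ge0. Qed.

Lemma fprod_sum1 :
  \sum_(o : fd_space D * fd_space E) fd_weight o.1 * fd_weight o.2 = 1.
Proof.
rewrite -(pair_bigA _ (fun a b => fd_weight a * fd_weight b)) /=.
rewrite -[RHS](fd_sum1 D); apply: eq_bigr => a _.
by rewrite -mulr_sumr fd_sum1 mulr1.
Qed.

Definition fprod : fdist R (T * U) :=
  FDist (fun o => (fd_val o.1, fd_val o.2)) fprod_ge0 fprod_sum1.

End Distributions.

(* meaningful for strings of equal length *)
Definition rel_hamming (R : realType) (S : eqType) (a b : seq S) : R :=
  (count (fun p => p.1 != p.2) (zip a b))%:R / (size a)%:R.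

(* The distance to the empty set is +oo. *)
Definition dist_to (R : realType) (S : eqType) (a : seq S) (A : set (seq S)) :
    \bar R :=
  ereal_inf [set (rel_hamming R a b)%:E | b in A]%classic.

Record alphabet := Alphabet {
  symbol :> finType;
  symbol_width : nat;
  symbol_bits : symbol -> seq bool;
  symbol_size : forall s, size (symbol_bits s) = symbol_width;
  symbol_inj : injective symbol_bits;
  symbol_gt0 : (0 < #|{: symbol}|)%N
}.

Lemma boolean_inj : injective (fun b : bool => [:: b]).
Proof. by move=> b c []. Qed.

Lemma boolean_gt0 : (0 < #|{: bool}|)%N.
Proof. by rewrite card_bool. Qed.

Definition boolean : alphabet :=
  @Alphabet bool 1 (fun b => [:: b]) (fun=> erefl) boolean_inj boolean_gt0.

(* Proofs are oracles from locations to symbols.  On each input, polynomial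
   time algorithms reach only finitely many locations, so a finite proof may be
   extended by arbitrary symbols. *)
Definition proof (S : alphabet) : Type := nat -> S.

Definition bits_oracle (S : alphabet) (pi : proof S) : nat -> seq bool :=
  fun i => symbol_bits (pi i).

(* [nv_query x mu] is Q(x;mu); the decision D(x,.;mu) is given by the circuit
   [nv_circuit x mu], which the verifier outputs along with its queries. *)
Record verifier (I : Type) := Verifier {
  nv_query : I -> seq bool -> seq nat;
  nv_circuit : I -> seq bool -> circuit
}.

Definition answers (S : alphabet) I (V : verifier I) (x : I) (mu : seq bool)
    (pi : proof S) : seq S :=
  map pi (nv_query V x mu).

Definition decides (S : alphabet) I (V : verifier I) (x : I) (mu : seq bool)
    (a : seq S) : bool :=
  ceval (nv_circuit V x mu) (flatten (map (@symbol_bits S) a)).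

Definition accepts (S : alphabet) I (V : verifier I) (x : I) (mu : seq bool)
    (pi : proof S) : bool :=
  decides V x mu (answers V x mu pi).

Definition Acc (S : alphabet) I (V : verifier I) (x : I) (mu : seq bool) :
    set (seq S) :=
  [set a | size a = size (nv_query V x mu) /\ decides V x mu a]%classic.

Definition enc_verifier_output I (V : verifier I) (x : I) (mu : seq bool) :
    data :=
  Cons (enc_seq (map enc_num (nv_query V x mu)))
       (enc_circuit (nv_circuit V x mu)).

(* Polynomial time, randomness complexity [r], query complexity [q] and decision
   complexity [d]. *)
Definition verifier_complexity (S : alphabet) I (enc : I -> data)
    (sz : I -> nat) (V : verifier I) (r q d : nat -> nat) : Prop :=
  ppt enc sz r (enc_verifier_output V) /\
  forall x mu, size mu = r (sz x) ->
    [/\ (size (nv_query V x mu) <= q (sz x))%N,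
        c_inputs (nv_circuit V x mu) =
          (size (nv_query V x mu) * symbol_width S)%N
      & csize (nv_circuit V x mu) = d (sz x)].

Section PCP.
Variables (R : realType) (S : alphabet).
Variable Rel : seq bool -> seq bool -> Prop.

Definition language_of (x : seq bool) : Prop := exists w, Rel x w.

Definition prover : Type := seq bool -> seq bool -> fdist R (proof S).

Definition pcp_complete (P : prover) (V : verifier (seq bool))
    (r : nat -> nat) : Prop :=
  forall x w, Rel x w ->
    Pr (fprod (P x w) (coins R (r (size x))))
       (fun pm => accepts V x pm.2 pm.1) = 1.

Definition pcp_sound (V : verifier (seq bool)) (r : nat -> nat)
    (s : nat -> R) : Prop :=
  forall x, ~ language_of x -> forall pi : proof S,
    Pr (coins R (r (size x))) (fun mu => accepts V x mu pi) <= s (size x).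

Definition pcp_robustly_sound (V : verifier (seq bool)) (r : nat -> nat)
    (s rho : nat -> R) : Prop :=
  forall x, ~ language_of x -> forall pi : proof S,
    Pr (coins R (r (size x)))
       (fun mu => (dist_to R (answers V x mu pi) (Acc V x mu)
                     <= (rho (size x))%:E)%E)
      <= s (size x).

(* A malicious verifier is a polynomial-time adaptive oracle program; its time
   and query bounds hold for every proof oracle. *)
Definition malicious (A : cmd) (T qs : nat -> nat) : Prop :=
  polynomially_bounded T /\
  forall (x : seq bool) (pi : proof S) mu, size mu = T (size x) ->
    exists cs ans out t,
      [/\ runs (bits_oracle pi) A (enc_bits x) mu cs ans out t,
          (t <= T (size x))%N & (size ans <= qs (size x))%N].

(* Coins tossed and query answers received. *)
Definition view : Type := (seq bool * seq (seq bool))%type.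

Definition enc_view (v : view) : data :=
  Cons (enc_bits v.1) (enc_seq (map enc_bits v.2)).

Definition has_view (A : cmd) (x : seq bool) (pi : proof S) (mu : seq bool)
    (v : view) : Prop :=
  exists out t, runs (bits_oracle pi) A (enc_bits x) mu v.1 v.2 out t.

Definition perfect_zk (P : prover) (qs : nat -> nat) : Prop :=
  forall (A : cmd) (T : nat -> nat), malicious A T qs ->
    exists (rs : nat -> nat) (Sim : seq bool -> seq bool -> data),
      ppt enc_bits (@size bool) rs Sim /\
      forall x w, Rel x w -> forall v : view,
        Pr (coins R (rs (size x))) (fun mu => Sim x mu = enc_view v) =
        Pr (fprod (P x w) (coins R (T (size x))))
           (fun pm => has_view A x pm.1 pm.2 v).

Definition has_zk_pcp (r q d : nat -> nat) (s : nat -> R)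
    (qs : nat -> nat) : Prop :=
  exists (P : prover) (V : verifier (seq bool)),
    [/\ verifier_complexity S enc_bits (@size bool) V r q d,
        pcp_complete P V r, pcp_sound V r s & perfect_zk P qs].

Definition has_robust_zk_pcp (r q d : nat -> nat) (s rho : nat -> R)
    (qs : nat -> nat) : Prop :=
  exists (P : prover) (V : verifier (seq bool)),
    [/\ verifier_complexity S enc_bits (@size bool) V r q d,
        pcp_complete P V r, pcp_robustly_sound V r s rho & perfect_zk P qs].

End PCP.

Record pair_language := PairLanguage {
  pl_input : Type;
  pl_enc : pl_input -> data;
  pl_size : pl_input -> nat;
  pl_section : pl_input -> set (seq bool);
  pl_length : pl_input -> nat;
  pl_lengthP : forall x y, pl_section x y -> size y = pl_length x
}.

Definition circuit_value_section (C : circuit) : set (seq bool) :=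
  [set y | size y = c_inputs C /\ ceval C y]%classic.

Lemma circuit_value_lengthP C y :
  circuit_value_section C y -> size y = c_inputs C.
Proof. by case. Qed.

Definition circuit_value : pair_language :=
  PairLanguage enc_circuit csize circuit_value_lengthP.

(* Oracle access to (y, pi): the locations below [size y] are those of y, and
   the location [size y + i] is the location [i] of pi. *)
Definition pair_oracle (y : seq bool) (pi : proof boolean) : proof boolean :=
  fun i => if (i < size y)%N then nth false y i else pi (i - size y)%N.

Definition string_proof (s : seq bool) : proof boolean := nth false s.

Section PCPP.
Variables (R : realType) (L : pair_language).

Definition pp_prover : Type :=
  pl_input L -> seq bool -> fdist R (proof boolean).

Definition pcpp_complete (P : pp_prover) (V : verifier (pl_input L))
    (r : nat -> nat) : Prop :=
  forall x y, pl_section x y ->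
    Pr (fprod (P x y) (coins R (r (pl_size x))))
       (fun pm => accepts V x pm.2 (pair_oracle y pm.1)) = 1.

Definition pcpp_sound (V : verifier (pl_input L)) (r : nat -> nat)
    (delta s : nat -> R) : Prop :=
  forall x y, size y = pl_length x ->
    ((delta (pl_size x))%:E <= dist_to R y (pl_section x))%E ->
    forall pi : proof boolean,
      Pr (coins R (r (pl_size x)))
         (fun mu => accepts V x mu (pair_oracle y pi)) <= s (pl_size x).

Definition deterministic_efficient (P : pp_prover) : Prop :=
  exists f : pl_input L -> seq bool -> seq bool,
    (forall x y, P x y = fdirac R (string_proof (f x y))) /\
    polytime (fun xy => Cons (pl_enc xy.1) (enc_bits xy.2))
             (fun xy => (pl_size xy.1 + size xy.2)%N)
             (fun xy => enc_bits (f xy.1 xy.2)).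

Definition has_boolean_pcpp_det_prover (r q d : nat -> nat)
    (delta s : nat -> R) : Prop :=
  exists (P : pp_prover) (V : verifier (pl_input L)),
    [/\ deterministic_efficient P,
        verifier_complexity boolean (@pl_enc L) (@pl_size L) V r q d,
        pcpp_complete P V r & pcpp_sound V r delta s].

End PCPP.

(* Main.v *)
Require Import Defs.
From mathcomp Require Import all_boot all_order all_algebra.
From mathcomp Require Import boolp classical_sets reals constructive_ereal.
From mathcomp Require Import zify.
Import Defs.

(* The composed proof consists of an outer proof [pi] and, for every outer random
   string, of the inner proof that the outer decision circuit accepts the answers
   of [pi].  The composed verifier runs the outer verifier on its coins, without
   reading [pi], and then the inner verifier on the outer decision circuit; if
   the answers of [pi] are far from acceptable ones, which robustness makes
   likely, then they are far from satisfying the circuit, and the inner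
   verifier rejects with its own probability.

   For zero knowledge, the inner prover is deterministic, so a query to the
   composed proof is answered by at most [q_out] queries to [pi]: a malicious
   verifier A of the composed system becomes a malicious verifier A' of the outer
   one, whose view determines that of A.  The simulator runs the simulator for A'
   and replays A' on the view it obtains.  Off the language this view may be
   garbage, on which A' need not halt; replaying with a memory of the answers
   already given makes every replay a run of A' with some proof. *)

Set Implicit Arguments.
Unset Strict Implicit.
Unset Printing Implicit Defensive.

Local Open Scope nat_scope.

(** * Polynomial bounds *)

(** [r_out] need not be computable, so a program cannot locate the end of the outer random tape.
    Inner proofs are therefore addressed by the coins that the outer verifier actually reads, and
    the inner coins are taken from directly behind them. By determinism the coins read form a
    prefix-free code, so this rearrangement of the tape keeps it uniform and the inner coins are
    fresh given the outer run. Averaging over outer tapes bounds acceptance by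
    [(1 - eps_in) + eps_in * (1 - eps_out)], which is [1 - eps_out * eps_in]. The answers checked by
    the inner verifier are read at outer locations, which do not depend on the coins; this ties all
    inner checks to one outer proof. Zero knowledge is an equality of the probabilities of single
    views, so it suffices that the view of A is a function of the view of A', computable in
    polynomial time without a proof at hand. As programs are syntax, this means compiling one
    program into another with explicit costs. The sizes of intermediate states are only known up to
    upper bounds, hence time bounds are kept monotone. *)

Definition poly_mono (p : nat -> nat) : Prop :=
  {homo p : m n / m <= n} /\ polynomially_bounded p.

Lemma leq_expl m n e : m <= n -> m ^ e <= n ^ e.
Proof. by case: e => [|e] // le_mn; rewrite leq_exp2r. Qed.

(** With the single parameter [a], products and compositions are handled by enlarging base and
    exponent. *)
Lemma polynomially_boundedP p :
  polynomially_bounded p <-> exists a, forall n, p n <= (n + a) ^ a.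
Proof.
split=> [[c [k pP]]|[a pP]].
  exists (c + c + k + 2) => n; apply: leq_trans (pP n) _.
  have le1 : c * n ^ k + c <= (n + (c + c + k + 2)) ^ k.+1.
    have lek : n ^ k <= (n + (c + c + k + 2)) ^ k by rewrite leq_expl // leq_addr.
    have ge1 : 0 < (n + (c + c + k + 2)) ^ k by rewrite expn_gt0 !addnS.
    rewrite expnS; move: (_ ^ k) (n ^ k) lek ge1 => u v lek ge1.
    apply: (@leq_trans (c * u + c * u)); last by rewrite -mulnDl leq_mul //; lia.
    by rewrite leq_add ?leq_mul2l ?lek ?orbT //; rewrite leq_pmulr.
  apply: leq_trans le1 _; rewrite leq_pexp2l //; lia.
exists ((a.+1) ^ a * 2 ^ a), a => n; apply: leq_trans (pP n) _.
case: n => [|n].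
  apply: leq_trans (leq_addl _ _); rewrite add0n -expnMn leq_expl //; lia.
apply: leq_trans (leq_addr _ _); rewrite -!expnMn leq_expl //; nia.
Qed.

Lemma poly_mono_const c : poly_mono (fun=> c).
Proof. by split=> //; exists c, 0 => n; rewrite leq_addl. Qed.

Lemma poly_mono_id : poly_mono id.
Proof. by split=> //; exists 1, 1 => n; rewrite mul1n leq_addr. Qed.

Lemma poly_mono_mul p q :
  poly_mono p -> poly_mono q -> poly_mono (fun n => p n * q n).
Proof.
move=> [mp /polynomially_boundedP[a pP]] [mq /polynomially_boundedP[b qP]].
split=> [m n le_mn|]; first by rewrite leq_mul ?mp ?mq.
apply/polynomially_boundedP; exists (a + b) => n; rewrite expnD.
apply: leq_mul.
  by apply: leq_trans (pP n) _; apply: leq_expl; lia.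
by apply: leq_trans (qP n) _; apply: leq_expl; lia.
Qed.

Lemma poly_mono_comp p q :
  poly_mono p -> poly_mono q -> poly_mono (fun n => p (q n)).
Proof.
move=> [mp /polynomially_boundedP[a pP]] [mq /polynomially_boundedP[b qP]].
split=> [m n le_mn|]; first by rewrite mp ?mq.
(* With [c = a + b + 1], the argument [q n + a] is at most [(n + c) ^ c], one factor [n + c]
   absorbing the summand [a]; raising to the power [c] gives the exponent [c ^ 2]. *)
apply/polynomially_boundedP; exists ((a + b + 1) ^ 2 + (a + b + 1)) => n.
apply: leq_trans (pP _) _; set c := a + b + 1.
apply: (@leq_trans (((n + c) ^ c) ^ c)).
  apply: (@leq_trans (((n + c) ^ c) ^ a)).
    apply: leq_expl; rewrite /c addn1 expnS.
    have := qP n; have ge1 : 0 < (n + (a + b).+1) ^ (a + b) by rewrite expn_gt0 addnS.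
    have : (n + b) ^ b <= (n + (a + b).+1) ^ (a + b).
      apply: (@leq_trans ((n + (a + b).+1) ^ b)); first by apply: leq_expl; lia.
      by rewrite leq_pexp2l //; lia.
    nia.
  by rewrite leq_pexp2l // /c ?expn_gt0; lia.
rewrite -expnM mulnn.
apply: (@leq_trans ((n + (c ^ 2 + c)) ^ (c ^ 2))); first by apply: leq_expl; lia.
by rewrite leq_pexp2l //; lia.
Qed.

Lemma poly_mono_add p q :
  poly_mono p -> poly_mono q -> poly_mono (fun n => p n + q n).
Proof.
move=> Pp Pq; have [mp _] := Pp; have [mq _] := Pq.
split=> [m n le_mn|]; first by rewrite leq_add ?mp ?mq.
(* The sum is at most [(p n).+1 * (q n).+1], which reduces it to a product. *)
have P1 r : poly_mono r -> poly_mono (fun n => (r n).+1).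
  move=> [mr /polynomially_boundedP[a rP]].
  split=> [m n le_mn|]; first by rewrite ltnS mr.
  apply/polynomially_boundedP; exists a.+2 => n; rewrite expnS.
  have gt0 : 0 < (n + a.+2) ^ a.+1 by rewrite expn_gt0 addnS.
  have le_r : r n <= (n + a.+2) ^ a.+1.
    apply: leq_trans (rP n) (leq_trans (leq_expl a _) (leq_pexp2l _ _)); lia.
  apply: (@leq_trans (2 * (n + a.+2) ^ a.+1)); first by lia.
  by rewrite leq_mul //; lia.
have [_ [c [k cP]]] := poly_mono_mul (P1 _ Pp) (P1 _ Pq).
exists c, k => n; apply: leq_trans (cP n); nia.
Qed.

Lemma polynomially_bounded_mono T : polynomially_bounded T ->
  exists2 p, poly_mono p & forall n, T n <= p n.
Proof.
move=> [c [k TP]]; exists (fun n => c * n ^ k + c) => //; split=> [m n le_mn|].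
  by rewrite leq_add2r leq_mul2l leq_expl ?orbT.
by exists c, k.
Qed.

(** * Programs *)

(* [exec] with the queried locations [ls] instead of their answers. *)
Inductive lexec (O : nat -> seq bool) :
    cmd -> memory -> seq bool -> seq nat -> nat -> memory -> Prop :=
  | lexec_skip m : lexec O Skip m [::] [::] 1 m
  | lexec_assign m i e :
      lexec O (Assign i e) m [::] [::] (ecost m e).+1 (upd m i (eval m e))
  | lexec_seq c1 c2 m m1 m2 cs1 cs2 l1 l2 t1 t2 :
      lexec O c1 m cs1 l1 t1 m1 -> lexec O c2 m1 cs2 l2 t2 m2 ->
      lexec O (Seq c1 c2) m (cs1 ++ cs2) (l1 ++ l2) (t1 + t2) m2
  | lexec_if e c1 c2 m m' cs l t :
      lexec O (if eval m e != Nil then c1 else c2) m cs l t m' ->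
      lexec O (If e c1 c2) m cs l (ecost m e + t).+1 m'
  | lexec_while_stop e c m :
      eval m e = Nil -> lexec O (While e c) m [::] [::] (ecost m e).+1 m
  | lexec_while_loop e c m m1 m2 cs1 cs2 l1 l2 t1 t2 :
      eval m e <> Nil ->
      lexec O c m cs1 l1 t1 m1 -> lexec O (While e c) m1 cs2 l2 t2 m2 ->
      lexec O (While e c) m (cs1 ++ cs2) (l1 ++ l2) (ecost m e + t1 + t2).+1 m2
  | lexec_toss m i b : lexec O (Toss i) m [:: b] [::] 1 (upd m i (enc_bool b))
  | lexec_query m i e (l := num_of_bits (bits_of_data (eval m e))) :
      lexec O (Query i e) m [::] [:: l] (ecost m e + dsize (enc_bits (O l))).+1
           (upd m i (enc_bits (O l))).

Lemma exec_lexec O c m cs a t m' : exec O c m cs a t m' ->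
  exists2 ls, a = map O ls & lexec O c m cs ls t m'.
Proof.
elim=> {c m cs a t m'}.
- by move=> m; exists [::] => //; exact: lexec_skip.
- by move=> m i e; exists [::] => //; exact: lexec_assign.
- move=> c1 c2 m m1 m2 cs1 cs2 a1 a2 t1 t2 _ [l1 -> e1] _ [l2 -> e2].
  by exists (l1 ++ l2); [rewrite map_cat|exact: lexec_seq e1 e2].
- by move=> e c1 c2 m m' cs a t _ [l -> e1]; exists l => //; exact: lexec_if.
- by move=> e c m e0; exists [::] => //; exact: lexec_while_stop.
- move=> e c m m1 m2 cs1 cs2 a1 a2 t1 t2 ne _ [l1 -> e1] _ [l2 -> e2].
  by exists (l1 ++ l2); [rewrite map_cat|exact: lexec_while_loop ne e1 e2].
- by move=> m i b; exists [::] => //; exact: lexec_toss.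
- move=> m i e a; exists [:: num_of_bits (bits_of_data (eval m e))] => //.
  exact: lexec_query.
Qed.

Lemma lexec_exec O c m cs ls t m' :
  lexec O c m cs ls t m' -> exec O c m cs (map O ls) t m'.
Proof.
elim=> *; rewrite ?map_cat; [ exact: exec_skip | exact: exec_assign
  | by apply: exec_seq; eassumption | exact: exec_if | exact: exec_while_stop
  | by apply: exec_while_loop; eassumption | exact: exec_toss | exact: exec_query ].
Qed.

(* Two runs on the same random tape agree until the first query on which their
   oracles differ. *)
Lemma lexec_diverge O O' c m cs ls t m1 : lexec O c m cs ls t m1 ->
  forall cs' ls' t' m1' r r', lexec O' c m cs' ls' t' m1' -> cs ++ r = cs' ++ r' ->
  [/\ cs = cs', ls = ls', map O ls = map O' ls & m1 = m1'] \/
  exists p l s s', [/\ ls = p ++ l :: s, ls' = p ++ l :: s',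
    map O p = map O' p & O l <> O' l].
Proof.
elim=> {c m cs ls t m1}.
- by move=> m cs' a' t' m1' r r' ex _; inversion ex; left.
- by move=> m i e cs' a' t' m1' r r' ex _; inversion ex; left.
- move=> c1 c2 m m1 m2 cs1 cs2 a1 a2 t1 t2 _ IH1 _ IH2 cs' a' t' m1' r r' ex.
  inversion ex; subst; rewrite -!catA => eq_cs.
  have [[? ? eq1 ?]|] := IH1 _ _ _ _ _ _ ltac:(eassumption) eq_cs; last first.
    move=> [p [l [s [s' [-> -> eqp ne]]]]]; right.
    by exists p, l, (s ++ a2), (s' ++ l2); rewrite -!catA.
  subst; move/eqP: eq_cs; rewrite eqseq_cat // eqxx => /eqP eq_cs.
  have [[-> -> eq2 ->]|] := IH2 _ _ _ _ _ _ ltac:(eassumption) eq_cs.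
    by left; rewrite !map_cat eq1 eq2.
  move=> [p [l [s [s' [-> -> eqp ne]]]]]; right.
  by exists (l1 ++ p), l, s, s'; rewrite -!catA !map_cat eq1 eqp.
- move=> e c1 c2 m m' cs a t _ IH cs' a' t' m1' r r' ex.
  by inversion ex; subst => eq_cs; apply: IH eq_cs; eassumption.
- move=> e c m e0 cs' a' t' m1' r r' ex.
  by inversion ex; subst; left.
- move=> e c m m1 m2 cs1 cs2 a1 a2 t1 t2 e1 _ IH1 _ IH2 cs' a' t' m1' r r' ex.
  inversion ex; subst; first by [].
  rewrite -!catA => eq_cs.
  have [[? ? eq1 ?]|] := IH1 _ _ _ _ _ _ ltac:(eassumption) eq_cs; last first.
    move=> [p [l [s [s' [-> -> eqp ne]]]]]; right.
    by exists p, l, (s ++ a2), (s' ++ l2); rewrite -!catA.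
  subst; move/eqP: eq_cs; rewrite eqseq_cat // eqxx => /eqP eq_cs.
  have [[-> -> eq2 ->]|] := IH2 _ _ _ _ _ _ ltac:(eassumption) eq_cs.
    by left; rewrite !map_cat eq1 eq2.
  move=> [p [l [s [s' [-> -> eqp ne]]]]]; right.
  by exists (l1 ++ p), l, s, s'; rewrite -!catA !map_cat eq1 eqp.
- by move=> m i b cs' a' t' m1' r r' ex; inversion ex; subst => -[<- _]; left.
- move=> m i e l cs' a' t' m1' r r' ex; inversion ex; subst => _.
  have [eqO|/eqP ne] := eqVneq (O l) (O' l); last by right; exists [::], l, [::], [::].
  by left; rewrite /= -/l eqO.
Qed.

(** The remainders [r] and [r'] are the unread parts of a common tape. Hence the coins that a
    program reads from a given memory and oracle form a prefix-free code. *)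
Lemma exec_det O c m cs a t m1 : exec O c m cs a t m1 ->
  forall cs' a' t' m1' r r', exec O c m cs' a' t' m1' -> cs ++ r = cs' ++ r' ->
  [/\ cs = cs', a = a', t = t' & m1 = m1'].
Proof.
elim=> {c m cs a t m1}.
- by move=> m cs' a' t' m1' r r' ex _; inversion ex.
- by move=> m i e cs' a' t' m1' r r' ex _; inversion ex.
- move=> c1 c2 m m1 m2 cs1 cs2 a1 a2 t1 t2 _ IH1 _ IH2 cs' a' t' m1' r r' ex.
  inversion ex; subst; rewrite -!catA => eq_cs.
  have [? ? ? ?] := IH1 _ _ _ _ _ _ ltac:(eassumption) eq_cs; subst.
  move/eqP: eq_cs; rewrite eqseq_cat // eqxx => /eqP eq_cs.
  by have [? ? ? ?] := IH2 _ _ _ _ _ _ ltac:(eassumption) eq_cs; subst.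
- move=> e c1 c2 m m' cs a t _ IH cs' a' t' m1' r r' ex.
  inversion ex; subst => eq_cs.
  by have [? ? ? ?] := IH _ _ _ _ _ _ ltac:(eassumption) eq_cs; subst.
- move=> e c m e0 cs' a' t' m1' r r' ex.
  by inversion ex; subst.
- move=> e c m m1 m2 cs1 cs2 a1 a2 t1 t2 e1 _ IH1 _ IH2 cs' a' t' m1' r r' ex.
  inversion ex; subst; first by [].
  rewrite -!catA => eq_cs.
  have [? ? ? ?] := IH1 _ _ _ _ _ _ ltac:(eassumption) eq_cs; subst.
  move/eqP: eq_cs; rewrite eqseq_cat // eqxx => /eqP eq_cs.
  by have [? ? ? ?] := IH2 _ _ _ _ _ _ ltac:(eassumption) eq_cs; subst.
- by move=> m i b cs' a' t' m1' r r' ex; inversion ex; subst => -[<-].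
- by move=> m i e a cs' a' t' m1' r r' ex; inversion ex; subst.
Qed.

Lemma runs_det O M inp mu cs a out t cs' a' out' t' mu' :
  runs O M inp mu cs a out t -> runs O M inp mu' cs' a' out' t' ->
  prefix cs mu' -> [/\ cs = cs', a = a', out = out' & t = t'].
Proof.
move=> [_ [m [ex <-]]] [pre' [m' [ex' <-]]] pre.
case/prefixP: pre pre' => r -> /prefixP[r' eq_mu].
by have [-> -> -> ->] := exec_det ex ex' eq_mu.
Qed.

Lemma dsize_gt0 d : 0 < dsize d.
Proof. by case: d. Qed.

Lemma dsize_bool b : dsize (enc_bool b) <= 3.
Proof. by case: b. Qed.

Lemma dsize_eval m e : dsize (eval m e) <= ecost m e.
Proof. by case: e => *; exact: leq_addr. Qed.

(** A tree is paid for by its size when it is produced, except by a toss, which costs 1 and may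
    write a tree of size 3. *)
Lemma exec_dsize O c m cs a t m' : exec O c m cs a t m' ->
  forall i, dsize (m' i) <= dsize (m i) + 3 * t.
Proof.
elim=> {c m cs a t m'}.
- by move=> m i; lia.
- move=> m i e j; rewrite /upd; case: eqP => _; last by lia.
  by have := dsize_eval m e; lia.
- by move=> c1 c2 m m1 m2 ? ? ? ? t1 t2 _ IH1 _ IH2 i; have := IH1 i; have := IH2 i; lia.
- by move=> e c1 c2 m m' ? ? t _ IH i; have := IH i; lia.
- by move=> *; lia.
- by move=> e c m m1 m2 ? ? ? ? t1 t2 _ _ IH1 _ IH2 i; have := IH1 i; have := IH2 i; lia.
- by move=> m i b j; rewrite /upd; case: eqP => _; have := dsize_bool b; lia.
- move=> m i e a j; rewrite /upd; case: eqP => _; lia.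
Qed.

Lemma exec_size_answers O c m cs a t m' : exec O c m cs a t m' -> size a <= t.
Proof. by elim=> //= *; rewrite ?size_cat; lia. Qed.

Lemma exec_size_coins O c m cs a t m' : exec O c m cs a t m' -> size cs <= t.
Proof. by elim=> //= *; rewrite ?size_cat; lia. Qed.

(** * Variables and costs of expressions *)

Definition dhd d := if d is Cons a _ then a else Nil.
Definition dtl d := if d is Cons _ b then b else Nil.

Lemma dsize_hd d : dsize (dhd d) <= dsize d.
Proof. by case: d => //= a b; lia. Qed.

Lemma dsize_tl d : dsize (dtl d) <= dsize d.
Proof. by case: d => //= a b; lia. Qed.

(** A strict upper bound on the variable indices, so that [evars e <= 1] says that only variable 0
    is read. *)
Fixpoint evars (e : expr) : nat :=
  match e with
  | Evar i => i.+1
  | Enil => 0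
  | Ehd e1 | Etl e1 => evars e1
  | Econs e1 e2 | Eeq e1 e2 => maxn (evars e1) (evars e2)
  end.

Fixpoint cvars (c : cmd) : nat :=
  match c with
  | Skip => 0
  | Assign i e | Query i e => maxn i.+1 (evars e)
  | Seq c1 c2 => maxn (cvars c1) (cvars c2)
  | If e c1 c2 => maxn (evars e) (maxn (cvars c1) (cvars c2))
  | While e c1 => maxn (evars e) (cvars c1)
  | Toss i => i.+1
  end.

Lemma eval_eq m m' e : (forall j, j < evars e -> m j = m' j) ->
  eval m e = eval m' e /\ ecost m e = ecost m' e.
Proof.
elim: e => [i|//|e1 IH1 e2 IH2|e IH|e IH|e1 IH1 e2 IH2] /= mm.
- by rewrite mm.
- have [|-> ->] := IH1 => [j lt_j|]; first by apply: mm; lia.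
  by have [|-> ->] := IH2 => [j lt_j|]; first by apply: mm; lia.
- by have [|-> ->] := IH.
- by have [|-> ->] := IH.
- have [|-> ->] := IH1 => [j lt_j|]; first by apply: mm; lia.
  by have [|-> ->] := IH2 => [j lt_j|]; first by apply: mm; lia.
Qed.

(* The glue code keeps its whole state, a tuple, in variable 0. *)
Definition ev (d : data) (e : expr) : data := eval (fun=> d) e.

Lemma eval_ev m e : evars e <= 1 -> eval m e = ev (m 0) e.
Proof.
by move=> e1; apply: (eval_eq _).1 => j lt_j; have ->: j = 0 by lia.
Qed.

(** [esize] and [ework] are the coefficients of linear bounds, in the size of the state, on the
    value and on the cost of an expression. *)
Fixpoint esize (e : expr) : nat :=
  match e with
  | Evar _ | Enil => 1
  | Ehd e1 | Etl e1 => esize e1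
  | Econs e1 e2 => (esize e1 + esize e2).+1
  | Eeq _ _ => 3
  end.

Fixpoint ework (e : expr) : nat :=
  esize e +
  match e with
  | Evar _ | Enil => 0
  | Ehd e1 | Etl e1 => ework e1
  | Econs e1 e2 | Eeq e1 e2 => ework e1 + ework e2
  end.

Lemma dsize_ev d e : dsize (ev d e) <= esize e * dsize d.
Proof.
rewrite /ev; have d0 := dsize_gt0 d.
elim: e => [i||e1 IH1 e2 IH2|e IH|e IH|e1 IH1 e2 IH2] /=; try lia.
- exact: leq_trans (dsize_hd (eval _ e)) IH.
- exact: leq_trans (dsize_tl (eval _ e)) IH.
- by have := dsize_bool (eval (fun=> d) e1 == eval (fun=> d) e2); lia.
Qed.

Lemma ecost_ev m e : evars e <= 1 -> ecost m e <= ework e * dsize (m 0).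
Proof.
move=> e1; have -> : ecost m e = ecost (fun=> m 0) e.
  by apply: (eval_eq _).2 => j lt_j; have ->: j = 0 by lia.
move: (m 0) => d {e1 m}.
elim: e => [i||e1 IH1 e2 IH2|e IH|e IH|e1 IH1 e2 IH2];
  rewrite [ecost _ _]/= [ework _]/= mulnDl ?mulnDl leq_add ?leq_add //;
  exact: (dsize_ev d (Econs _ _)) || exact: (dsize_ev d (Ehd _)) ||
  exact: (dsize_ev d (Etl _)) || exact: (dsize_ev d (Eeq _ _)) ||
  exact: (dsize_ev d Enil) || exact: (dsize_ev d (Evar _)).
Qed.

(* Callees live at the variables from [k] on; those strictly between 0 and [k]
   belong to the caller and are left alone. *)
Definition step (k : nat) (O : nat -> seq bool) (c : cmd) (d : data)
    (cs : seq bool) (q B : nat) (d' : data) : Prop :=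
  forall m, m 0 = d -> exists m' ans t,
    [/\ exec O c m cs ans t m', t <= B, size ans <= q, m' 0 = d' &
        forall j, 0 < j < k -> m' j = m j].

Section Step.
Variables (k : nat) (O : nat -> seq bool).

Lemma step_weaken c d cs q q' B B' d' :
  step k O c d cs q B d' -> q <= q' -> B <= B' -> step k O c d cs q' B' d'.
Proof.
move=> st le_q le_B m /st[m' [ans [t [ex tB aq m'0 fr]]]].
by exists m', ans, t; split=> //; [exact: leq_trans tB le_B | exact: leq_trans aq le_q].
Qed.

Lemma step_dsize c d cs q B d' :
  step k O c d cs q B d' -> dsize d' <= dsize d + 3 * B.
Proof.
move=> /(_ (fun=> d) erefl)[m' [ans [t [/exec_dsize/(_ 0) sz tB _ <- _]]]].
by apply: leq_trans sz _; lia.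
Qed.

Lemma step_assign e d : evars e <= 1 ->
  step k O (Assign 0 e) d [::] 0 (ework e * dsize d).+1 (ev d e).
Proof.
move=> e1 m md; exists (upd m 0 (eval m e)), [::], (ecost m e).+1; split=> //.
- exact: exec_assign.
- by rewrite ltnS -md ecost_ev.
- by rewrite /upd eqxx eval_ev // md.
- by move=> j /andP[j0 _]; rewrite /upd; case: eqP j0 => // ->.
Qed.

Lemma step_seq c1 c2 d d1 d2 cs1 cs2 q1 q2 B1 B2 :
  step k O c1 d cs1 q1 B1 d1 -> step k O c2 d1 cs2 q2 B2 d2 ->
  step k O (Seq c1 c2) d (cs1 ++ cs2) (q1 + q2) (B1 + B2) d2.
Proof.
move=> st1 st2 m /st1[m1 [a1 [t1 [ex1 tB1 aq1 /st2 st fr1]]]].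
have [m2 [a2 [t2 [ex2 tB2 aq2 m20 fr2]]]] := st.
exists m2, (a1 ++ a2), (t1 + t2); split=> //.
- exact: exec_seq ex1 ex2.
- exact: leq_add.
- by rewrite size_cat leq_add.
- by move=> j lt_j; rewrite fr2 ?fr1.
Qed.

Lemma step_if e c1 c2 d cs q B d' : evars e <= 1 ->
  step k O (if ev d e != Nil then c1 else c2) d cs q B d' ->
  step k O (If e c1 c2) d cs q (ework e * dsize d + B).+1 d'.
Proof.
move=> e1 st m md; have [m' [ans [t [ex tB aq m'0 fr]]]] := st m md.
exists m', ans, (ecost m e + t).+1; split=> //.
  by apply: exec_if; rewrite eval_ev // md.
by rewrite ltnS leq_add // -md ecost_ev.
Qed.

End Step.

(** The index carries what the program does not see, such as the oracle and the values behind the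
    encodings. One polynomial in the size of the initial state serves all indices, which makes the
    bounds composable. *)
Definition computes (I : Type) (D : I -> Prop) (k : nat)
    (O : I -> nat -> seq bool) (c : cmd) (din : I -> data) (cs : I -> seq bool)
    (q : I -> nat) (dout : I -> data) : Prop :=
  exists2 p, poly_mono p & forall i, D i ->
    step k (O i) c (din i) (cs i) (q i) (p (dsize (din i))) (dout i).

Section Computes.
Variables (I : Type) (D : I -> Prop) (k : nat) (O : I -> nat -> seq bool).

Lemma computes_assign e (din dout : I -> data) : evars e <= 1 ->
  (forall i, D i -> ev (din i) e = dout i) ->
  computes D k O (Assign 0 e) din (fun=> [::]) (fun=> 0) dout.
Proof.
move=> e1 eqd; exists (fun n => (ework e * n) + 1).
  by apply: poly_mono_add (poly_mono_const _); apply: poly_mono_mul (poly_mono_const _) poly_mono_id.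
by move=> i Di; rewrite -(eqd i Di) addn1; apply: step_assign.
Qed.

Lemma computes_seq c1 c2 d d1 d2 cs1 cs2 q1 q2 :
  computes D k O c1 d cs1 q1 d1 -> computes D k O c2 d1 cs2 q2 d2 ->
  computes D k O (Seq c1 c2) d (fun i => cs1 i ++ cs2 i) (fun i => q1 i + q2 i) d2.
Proof.
move=> [p1 pm1 st1] [p2 pm2 st2].
(* The second program starts from a state that [step_dsize] bounds by [n + 3 * p1 n]. *)
exists (fun n => p1 n + p2 (n + 3 * p1 n)).
  apply: poly_mono_add => //; apply: poly_mono_comp => //.
  by apply: poly_mono_add poly_mono_id _; apply: poly_mono_mul (poly_mono_const _) _.
move=> i Di; apply: (step_seq (st1 i Di)).
apply: step_weaken (st2 i Di) (leqnn _) _.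
by apply: pm2.1; apply: step_dsize (st1 i Di).
Qed.

Lemma computes_seq0 c1 c2 d d1 d2 cs q :
  computes D k O c1 d (fun=> [::]) (fun=> 0) d1 ->
  computes D k O c2 d1 cs q d2 ->
  computes D k O (Seq c1 c2) d cs q d2.
Proof. exact: computes_seq. Qed.

Lemma computes_if e c1 c2 din cs q dout : evars e <= 1 ->
  computes (fun i => D i /\ ev (din i) e != Nil) k O c1 din cs q dout ->
  computes (fun i => D i /\ ev (din i) e = Nil) k O c2 din cs q dout ->
  computes D k O (If e c1 c2) din cs q dout.
Proof.
move=> e1 [p1 pm1 st1] [p2 pm2 st2].
exists (fun n => ework e * n + (p1 n + p2 n) + 1).
  apply: poly_mono_add (poly_mono_const _); apply: poly_mono_add.
    exact: poly_mono_mul (poly_mono_const _) poly_mono_id.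
  exact: poly_mono_add.
move=> i Di; rewrite addn1; apply: step_if => //; case: ifP => [nz|/negbFE/eqP z].
  by apply: step_weaken (st1 i _) _ _ => //; lia.
by apply: step_weaken (st2 i _) _ _ => //; lia.
Qed.

Lemma computes_eq c d d' cs cs' q q' e e' :
  computes D k O c d cs q e -> (forall i, D i -> d i = d' i) ->
  (forall i, D i -> cs i = cs' i) -> (forall i, D i -> q i <= q' i) ->
  (forall i, D i -> e i = e' i) -> computes D k O c d' cs' q' e'.
Proof.
move=> [p pm st] eqd eqcs leq eqe; exists p => // i Di.
rewrite -eqd -?eqcs -?eqe //; apply: step_weaken (st i Di) _ _ => //.
exact: leq.
Qed.

Lemma computes_reindex J (DJ : J -> Prop) (OJ : J -> nat -> seq bool)
    (g : I -> J) c d cs q e d' cs' q' e' :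
  computes DJ k OJ c d cs q e ->
  (forall i, D i -> DJ (g i)) -> (forall i, D i -> OJ (g i) = O i) ->
  (forall i, D i -> d (g i) = d' i) -> (forall i, D i -> cs (g i) = cs' i) ->
  (forall i, D i -> q (g i) <= q' i) -> (forall i, D i -> e (g i) = e' i) ->
  computes D k O c d' cs' q' e'.
Proof.
move=> [p pm st] subD eqO eqd eqcs leq eqe; exists p => // i Di.
rewrite -eqd -?eqcs -?eqe // -eqO //.
by apply: step_weaken (st _ (subD i Di)) _ _ => //; apply: leq.
Qed.

(* [w] is a potential bounding the size of the state, and [mu] the number of
   remaining iterations. *)
Lemma computes_while e c en (f g : I -> I) (w mu : I -> nat) P q :
  evars e <= 1 -> poly_mono P ->
  (forall i, D i -> ev (en i) e != Nil ->
     [/\ D (f i), O (f i) = O i, mu (f i) < mu i & w (f i) <= w i]) ->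
  (forall i, D i -> g i = if ev (en i) e != Nil then g (f i) else i) ->
  (forall i, D i -> [/\ dsize (en i) <= w i, mu i <= w i & w i <= P (dsize (en i))]) ->
  computes (fun i => D i /\ ev (en i) e != Nil) k O c en (fun=> [::]) (fun=> q)
    (en \o f) ->
  computes D k O (While e c) en (fun=> [::]) (fun i => mu i * q) (en \o g).
Proof.
move=> e1 Pm iter gE wP [p pm st].
pose B W := W.+1 * (ework e * W + p W).+1.
exists (fun n => (P n + 1) * (ework e * P n + p (P n) + 1)).
  have [? ?] := (poly_mono_comp pm Pm, poly_mono_const 1).
  apply: poly_mono_mul; first exact: poly_mono_add.
  apply: poly_mono_add => //; apply: poly_mono_add => //.
  exact: poly_mono_mul (poly_mono_const _) Pm.
move=> i0 Di0; have [_ le_mu le_P] := wP i0 Di0.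
(* The bound [W] on the potential stays fixed during the induction, so each iteration and the final
   test are charged the same amount, [n.+1] times in all. *)
suff loop n W i : D i -> mu i <= n -> w i <= W ->
    step k (O i) (While e c) (en i) [::] (mu i * q)
         (n.+1 * (ework e * W + p W).+1) (en (g i)).
  apply: step_weaken (loop _ _ i0 Di0 le_mu (leqnn _)) (leqnn _) _.
  rewrite !addn1; apply: leq_mul => //; rewrite ltnS leq_add ?leq_mul //.
  exact: pm.1.
elim: n i => [|n IH] i Di le_n le_W m m0.
  have z : ev (en i) e = Nil.
    apply/eqP/negPn/negP => nz; have [_ _ lt_mu _] := iter i Di nz; lia.
  exists m, [::], (ecost m e).+1; split=> //.
  - by apply: exec_while_stop; rewrite eval_ev // m0.
  - have := ecost_ev m e1; rewrite m0 mul1n ltnS => /leq_trans; apply.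
    apply: leq_trans (leq_addr _ _); rewrite leq_mul //.
    by have [h _ _] := wP i Di; apply: leq_trans h le_W.
  - by rewrite gE // z.
have cost : ecost m e <= ework e * W.
  have := ecost_ev m e1; rewrite m0 => /leq_trans; apply; rewrite leq_mul //.
  by have [h _ _] := wP i Di; apply: leq_trans h le_W.
case: (eqVneq (ev (en i) e) Nil) => [z|nz].
  exists m, [::], (ecost m e).+1; split=> //.
  - by apply: exec_while_stop; rewrite eval_ev // m0.
  - rewrite mulSn (leq_trans _ (leq_addr _ _)) // ltnS.
    exact: leq_trans cost (leq_addr _ _).
  - by rewrite gE // z.
have [Df Of lt_mu le_w] := iter i Di nz.
have [m1 [a1 [t1 [ex1 tB1 aq1 m10 fr1]]]] := st i (conj Di nz) m m0.
have [] := IH (f i) Df _ _ m1 m10; [lia|lia|].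
rewrite Of => m2 [a2 [t2 [ex2 tB2 aq2 m20 fr2]]].
exists m2, (a1 ++ a2), (ecost m e + t1 + t2).+1; split=> //.
- apply: (exec_while_loop (cs1 := [::])) ex1 ex2.
  by rewrite eval_ev // m0; apply/eqP.
- rewrite [n.+2 * _]mulSn -addSn; apply: leq_add => //.
  rewrite ltnS; apply: leq_add => //; apply: leq_trans tB1 _; apply: pm.1.
  by have [h _ _] := wP i Di; apply: leq_trans h le_W.
- rewrite size_cat; apply: (@leq_trans ((mu (f i)).+1 * q)).
    by rewrite mulSn leq_add.
  by rewrite leq_mul2r lt_mu orbT.
- by rewrite gE // nz.
- by move=> j lt_j; rewrite fr2 ?fr1.
Qed.

End Computes.

(** * Tree encodings of lists and bit strings *)

Definition dseq_weight (l : seq data) : nat := sumn [seq (dsize d).+1 | d <- l].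

Lemma dsize_enc_seq l : dsize (enc_seq l) = (dseq_weight l).+1.
Proof. by elim: l => //= d l ->; rewrite /dseq_weight /= addSn addnS. Qed.

Lemma dseq_weight_size l : (size l).*2 <= dseq_weight l.
Proof.
by elim: l => //= d l; have := dsize_gt0 d; rewrite /dseq_weight /=; lia.
Qed.

Fixpoint dseq (d : data) : seq data := if d is Cons a b then a :: dseq b else [::].

Lemma dseqK : cancel dseq enc_seq.
Proof. by elim=> //= a _ b ->. Qed.

Lemma enc_seqK : cancel enc_seq dseq.
Proof. by elim=> //= a l ->. Qed.

Lemma bits_of_enc_seq l : bits_of_data (enc_seq l) = [seq d != Nil | d <- l].
Proof. by elim: l => //= d l ->. Qed.

Lemma enc_bool_neq0 b : (enc_bool b != Nil) = b.
Proof. by case: b. Qed.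

Lemma enc_bitsK : cancel enc_bits bits_of_data.
Proof.
move=> s; rewrite /enc_bits bits_of_enc_seq -map_comp -[RHS]map_id.
by apply: eq_map => b; rewrite /= enc_bool_neq0.
Qed.

Lemma dsize_enc_bits s : size s < dsize (enc_bits s) <= 4 * size s + 1.
Proof.
rewrite /enc_bits dsize_enc_seq; have := dseq_weight_size (map enc_bool s).
rewrite size_map /dseq_weight => h; apply/andP; split; first lia.
rewrite addn1 ltnS; elim: s {h} => //= b s; have := dsize_bool b; lia.
Qed.

(** * Elementary loops: reversal, parsing of locations, decrement, lookup *)

Notation v0 := (Evar 0).
Notation etrue := (Econs Enil Enil).
Notation ebool e := (Eeq (Eeq e Enil) Enil).

Definition oracle := nat -> seq bool.

Definition rev_loop : cmd :=
  While (Ehd v0) (Assign 0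
    (Econs (Etl (Ehd v0)) (Econs (Econs (Ehd (Ehd v0)) (Ehd (Etl v0))) (Etl (Etl v0))))).

Lemma rev_loopP k :
  computes (fun=> True) k (fun x : oracle * seq data * seq data * data => x.1.1.1)
    rev_loop
    (fun x => Cons (enc_seq x.1.1.2) (Cons (enc_seq x.1.2) x.2))
    (fun=> [::]) (fun=> 0)
    (fun x => Cons Nil (Cons (enc_seq (catrev x.1.1.2 x.1.2)) x.2)).
Proof.
pose en (x : oracle * seq data * seq data * data) :=
  Cons (enc_seq x.1.1.2) (Cons (enc_seq x.1.2) x.2).
pose f (x : oracle * seq data * seq data * data) :=
  (x.1.1.1, behead x.1.1.2, head Nil x.1.1.2 :: x.1.2, x.2).
pose g (x : oracle * seq data * seq data * data) :=
  (x.1.1.1, [::] : seq data, catrev x.1.1.2 x.1.2, x.2).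
apply: computes_eq (computes_while (f := f) (g := g) (w := dsize \o en)
  (mu := fun x => size x.1.1.2) (en := en) (q := 0) _ poly_mono_id _ _ _ _)
  _ _ _ _ => //.
- move=> [[[O [|a l]] m] R] _ //= _; split=> //; lia.
- by move=> [[[O [|a l]] m] R].
- move=> [[[O l] m] R] _; split=> //=.
  by rewrite dsize_enc_seq; have := dseq_weight_size l; lia.
- apply: computes_assign => // -[[[O [|a l]] m] R] [_] //.
- by move=> i; rewrite muln0.
Qed.

(* The digits of a numeral are pushed in front of the string, each one behind a
   marker [true]; the string starts with [false], so that [parse] undoes it. *)
Fixpoint locenc (nb acc : seq bool) : seq bool :=
  if nb is b :: nb' then locenc nb' (true :: b :: acc) else acc.

Definition mark_loop : cmd :=
  While (Ehd v0) (Assign 0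
    (Econs (Etl (Ehd v0))
       (Econs (Econs etrue (Econs (Ehd (Ehd v0)) (Ehd (Etl v0)))) (Etl (Etl v0))))).

Lemma mark_loopP k :
  computes (fun=> True) k (fun x : oracle * seq bool * seq bool * data => x.1.1.1)
    mark_loop
    (fun x => Cons (enc_bits x.1.1.2) (Cons (enc_bits x.1.2) x.2))
    (fun=> [::]) (fun=> 0)
    (fun x => Cons Nil (Cons (enc_bits (locenc x.1.1.2 x.1.2)) x.2)).
Proof.
pose en (x : oracle * seq bool * seq bool * data) :=
  Cons (enc_bits x.1.1.2) (Cons (enc_bits x.1.2) x.2).
pose f (x : oracle * seq bool * seq bool * data) :=
  (x.1.1.1, behead x.1.1.2, true :: head false x.1.1.2 :: x.1.2, x.2).
pose g (x : oracle * seq bool * seq bool * data) :=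
  (x.1.1.1, [::] : seq bool, locenc x.1.1.2 x.1.2, x.2).
apply: computes_eq (computes_while (f := f) (g := g)
  (w := fun x => dsize (en x) + 4 * size x.1.1.2)
  (mu := fun x => size x.1.1.2) (en := en) (q := 0) _
  (P := fun n => n + 4 * n) _ _ _ _ _)
  _ _ _ _ => //.
- apply: poly_mono_add poly_mono_id _; apply: poly_mono_mul (poly_mono_const _) poly_mono_id.
- by move=> [[[O [|a l]] m] R] _ //= _; split=> //=; rewrite -/(enc_bits l) -/(enc_bits m); lia.
- by move=> [[[O [|a l]] m] R].
- move=> [[[O l] m] R] _; split=> //=; have := dsize_enc_bits l; lia.
- apply: computes_assign => // -[[[O [|a l]] m] R] [_] //.
- by move=> i; rewrite muln0.
Qed.

(** Total, since a malicious location need not be well formed. A marker without a digit reads the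
    digit [false], in accordance with the head and the tail of [Nil] being [Nil]. *)
Fixpoint parse (u acc : seq bool) : seq bool * seq bool :=
  match u with
  | true :: b :: u' => parse u' (b :: acc)
  | true :: nil => (nil, false :: acc)
  | false :: u' => (u', acc)
  | nil => (nil, acc)
  end.

Lemma parse_locenc nb acc s :
  parse (locenc nb (false :: s)) acc = (s, nb ++ acc).
Proof.
have gen r : parse (locenc nb r) acc = parse r (nb ++ acc).
  by elim: nb r acc => //= b nb IH r acc; rewrite IH.
by rewrite gen.
Qed.

(** [parse] as the loop performs it: on trees, every one but [Nil] counting as [true], and halting
    in front of the terminator, whence the [behead] in [dparseE]. *)
Fixpoint dparse (u : seq data) (acc : seq bool) : seq data * seq bool :=
  match u with
  | a :: (b :: u') => if a != Nil then dparse u' ((b != Nil) :: acc) else (u, acc)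
  | a :: nil => if a != Nil then (nil, false :: acc) else (u, acc)
  | nil => (u, acc)
  end.

Lemma dparseE u acc :
  parse [seq d != Nil | d <- u] acc =
  ([seq d != Nil | d <- behead (dparse u acc).1], (dparse u acc).2).
Proof.
have [n] := ubnP (size u); elim: n u acc => // n IH [|a [|b u]] acc //= lt_n.
  by case: (a == Nil).
case: (a == Nil) => //=.
by apply: IH; apply: ltnW.
Qed.

Definition parse_loop : cmd :=
  While (Ehd (Ehd v0)) (Assign 0
    (Econs (Etl (Etl (Ehd v0)))
       (Econs (Econs (ebool (Ehd (Etl (Ehd v0)))) (Ehd (Etl v0))) (Etl (Etl v0))))).

Lemma parse_loopP k :
  computes (fun=> True) k (fun x : oracle * seq data * seq bool * data => x.1.1.1)
    parse_loop
    (fun x => Cons (enc_seq x.1.1.2) (Cons (enc_bits x.1.2) x.2))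
    (fun=> [::]) (fun=> 0)
    (fun x => Cons (enc_seq (dparse x.1.1.2 x.1.2).1)
                (Cons (enc_bits (dparse x.1.1.2 x.1.2).2) x.2)).
Proof.
pose en (x : oracle * seq data * seq bool * data) :=
  Cons (enc_seq x.1.1.2) (Cons (enc_bits x.1.2) x.2).
pose f (x : oracle * seq data * seq bool * data) :=
  (x.1.1.1, drop 2 x.1.1.2, (nth Nil x.1.1.2 1 != Nil) :: x.1.2, x.2).
pose g (x : oracle * seq data * seq bool * data) :=
  (x.1.1.1, (dparse x.1.1.2 x.1.2).1, (dparse x.1.1.2 x.1.2).2, x.2).
apply: computes_eq (computes_while (f := f) (g := g) (w := dsize \o en)
  (mu := fun x => size x.1.1.2) (en := en) (q := 0) _ poly_mono_id _ _ _ _)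
  _ _ _ _ => //.
- move=> [[[O [|[|a1 a2] l]] m] R] _ //= _; split=> //=.
    by rewrite size_drop ltnS leq_subr.
  rewrite -/(enc_bits m); have ? := dsize_gt0 a1; have ? := dsize_gt0 a2.
  case: l => [|b l] /=; first by lia.
  by rewrite drop0; have ? := dsize_bool (b != Nil); have ? := dsize_gt0 b; lia.
- by move=> [[[O [|a [|b l]]] m] R] _ //; rewrite /ev /g /=; case: (a != Nil) => //; rewrite drop0.
- move=> [[[O l] m] R] _; split=> //=.
  by rewrite dsize_enc_seq; have := dseq_weight_size l; lia.
- apply: computes_assign => // -[[[O [|a [|b l]]] m] R] [_] // _.
  by rewrite /ev /en /f /= drop0; case: b.
- by move=> i; rewrite muln0.
Qed.

(** Predecessor in bijective base 2. The digit 2 becomes 1; the digit 1 would become 0, which is not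
    a digit, so it becomes 2 with a borrow from the next digit, or vanishes if it is the leading
    one. *)
Fixpoint predb (nb : seq bool) : seq bool :=
  match nb with
  | true :: s => false :: s
  | false :: s => if s is nil then nil else true :: predb s
  | nil => nil
  end.

Lemma num_of_predb nb : num_of_bits (predb nb) = (num_of_bits nb).-1.
Proof.
elim: nb => [|[] s IH] //.
case: s IH => [|b s] IH //.
have num_cons c r : num_of_bits (c :: r) = (c + (num_of_bits r).*2).+1 by [].
have -> : predb [:: false, b & s] = true :: predb (b :: s) by [].
have gt0 : 0 < num_of_bits (b :: s) by [].
by rewrite (num_cons true) IH (num_cons false); lia.
Qed.

Lemma size_predb nb : size (predb nb) <= size nb.
Proof. by elim: nb => [|[] [|b s] IH]. Qed.

Fixpoint strip (nb acc : seq bool) : seq bool * seq bool :=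
  if nb is false :: s then strip s (true :: acc) else (nb, acc).

(** [strip] carries the borrow through the low digits 1, turning them into 2. A digit 2 that stops
    the borrow becomes 1; if there is none, all digits were 1 and the numeral loses a digit, which
    is the [behead]. *)
Lemma strip_predb nb acc : nb != [::] ->
  (if (strip nb acc).1 is true :: s then catrev (strip nb acc).2 (false :: s)
   else catrev (behead (strip nb acc).2) [::]) = catrev acc (predb nb).
Proof.
by elim: nb acc => // -[] // [|b s] IH acc _ //=; rewrite -/(strip (b :: s) _) IH.
Qed.

Definition strip_loop : cmd :=
  While (Eeq (Ehd v0) (Econs Enil (Etl (Ehd v0)))) (Assign 0
    (Econs (Etl (Ehd v0)) (Econs (Econs etrue (Ehd (Etl v0))) (Etl (Etl v0))))).

Lemma strip_loopP k :
  computes (fun=> True) k (fun x : oracle * seq bool * seq bool * data => x.1.1.1)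
    strip_loop
    (fun x => Cons (enc_bits x.1.1.2) (Cons (enc_bits x.1.2) x.2))
    (fun=> [::]) (fun=> 0)
    (fun x => Cons (enc_bits (strip x.1.1.2 x.1.2).1)
                (Cons (enc_bits (strip x.1.1.2 x.1.2).2) x.2)).
Proof.
pose en (x : oracle * seq bool * seq bool * data) :=
  Cons (enc_bits x.1.1.2) (Cons (enc_bits x.1.2) x.2).
pose f (x : oracle * seq bool * seq bool * data) :=
  (x.1.1.1, behead x.1.1.2, true :: x.1.2, x.2).
pose g (x : oracle * seq bool * seq bool * data) :=
  (x.1.1.1, (strip x.1.1.2 x.1.2).1, (strip x.1.1.2 x.1.2).2, x.2).
have test O l m R : (ev (en (O, l, m, R)) (Eeq (Ehd v0) (Econs Enil (Etl (Ehd v0)))) != Nil) =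
    (if l is false :: _ then true else false).
  rewrite /ev /en /= enc_bool_neq0; case: l => //= -[] s //.
  by rewrite eqxx.
apply: computes_eq (computes_while (f := f) (g := g)
  (w := fun x => dsize (en x) + 4 * size x.1.1.2)
  (mu := fun x => size x.1.1.2) (en := en) (q := 0) _
  (P := fun n => n + 4 * n) _ _ _ _ _)
  _ _ _ _ => //.
- apply: poly_mono_add poly_mono_id _; apply: poly_mono_mul (poly_mono_const _) poly_mono_id.
- move=> [[[O l] m] R] _; rewrite test; case: l => [|[] l] //= _; split=> //=.
  by rewrite -/(enc_bits l) -/(enc_bits m); lia.
- by move=> [[[O l] m] R] _; rewrite test; case: l => [|[] l].
- by move=> [[[O l] m] R] _; split=> //=; have := dsize_enc_bits l; lia.
- apply: computes_assign => // -[[[O l] m] R]; rewrite test.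
  by case: l => [|[] l] [].
- by move=> i; rewrite muln0.
Qed.

Definition pred_cmd : cmd :=
  Seq (Assign 0 (Econs (Ehd v0) (Econs Enil (Etl v0))))
  (Seq strip_loop
  (Seq (If (Ehd v0)
         (Assign 0 (Econs (Ehd (Etl v0))
                      (Econs (Econs Enil (Etl (Ehd v0))) (Etl (Etl v0)))))
         (Assign 0 (Econs (Etl (Ehd (Etl v0))) (Econs Enil (Etl (Etl v0))))))
  (Seq rev_loop
       (Assign 0 (Etl v0))))).

Lemma pred_cmdP k :
  computes (fun x => x.1.2 != [::]) k (fun x : oracle * seq bool * data => x.1.1)
    pred_cmd
    (fun x => Cons (enc_bits x.1.2) x.2) (fun=> [::]) (fun=> 0)
    (fun x => Cons (enc_bits (predb x.1.2)) x.2).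
Proof.
pose a (x : oracle * seq bool * data) := (strip x.1.2 [::]).1.
pose b (x : oracle * seq bool * data) := (strip x.1.2 [::]).2.
pose a' x := if a x is true :: s then false :: s else [::].
pose b' x := if a x is true :: s then b x else behead (b x).
apply: (computes_seq0 (d1 := fun x => Cons (enc_bits x.1.2) (Cons Nil x.2))).
  exact: computes_assign.
apply: (computes_seq0 (d1 := fun x => Cons (enc_bits (a x)) (Cons (enc_bits (b x)) x.2))).
  by apply: (computes_reindex (strip_loopP k) (g := fun x => (x.1.1, x.1.2, [::], x.2))).
have strip_hd x : a x = if a x is true :: s then true :: s else [::].
  suff gen s acc : (strip s acc).1 = if (strip s acc).1 is true :: r then true :: r else [::].
    exact: gen.
  by elim: s acc => // -[] // s IH acc /=.
apply: (computes_seq0 (d1 := fun x => Cons (enc_bits (b' x)) (Cons (enc_bits (a' x)) x.2))).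
  apply: computes_if => //; apply: computes_assign => // x [_];
    rewrite /ev /= /a' /b' strip_hd; case: (a x) => [|[] s] //=;
    by case: (b x).
apply: (computes_seq0 (d1 := fun x => Cons Nil (Cons (enc_bits (predb x.1.2)) x.2)));
  last exact: computes_assign.
apply: (computes_reindex (rev_loopP k)
  (g := fun x => (x.1.1, map enc_bool (b' x), map enc_bool (a' x), x.2))) => // x nz /=.
rewrite -[predb _]/(catrev [::] (predb x.1.2)) -strip_predb // /a' /b' /a /b.
by rewrite /enc_bits; case: (strip _ _) => -[|[] s] t /=; rewrite !catrevE map_cat map_rev.
Qed.

(** The index is decremented in binary while the list is consumed, and the loop stops when either is
    exhausted: an index may be exponentially large in its length, but the list bounds the number of
    iterations. *)
Definition lookup_cmd : cmd :=
  Seq (While (Eeq (Econs (ebool (Ehd v0)) (ebool (Ehd (Etl v0)))) (Econs etrue etrue))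
    (Seq (Assign 0 (Econs (Ehd (Etl v0)) (Econs (Etl (Ehd v0)) (Etl (Etl v0)))))
    (Seq pred_cmd
         (Assign 0 (Econs (Ehd (Etl v0)) (Econs (Ehd v0) (Etl (Etl v0))))))))
  (Assign 0 (Econs (Ehd v0) (Etl (Etl v0)))).

Lemma lookup_cmdP k :
  computes (fun=> True) k (fun x : oracle * seq data * seq bool * data => x.1.1.1)
    lookup_cmd
    (fun x => Cons (enc_seq x.1.1.2) (Cons (enc_bits x.1.2) x.2))
    (fun=> [::]) (fun=> 0)
    (fun x => Cons (enc_seq (drop (num_of_bits x.1.2) x.1.1.2)) x.2).
Proof.
pose X := (oracle * seq data * seq bool * data)%type.
pose en (x : X) := Cons (enc_seq x.1.1.2) (Cons (enc_bits x.1.2) x.2).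
pose f (x : X) : X := (x.1.1.1, behead x.1.1.2, predb x.1.2, x.2).
pose fix rest (l : seq data) (nb : seq bool) {struct l} : seq bool :=
  if l is _ :: l' then if nb != [::] then rest l' (predb nb) else nb else nb.
pose g (x : X) : X :=
  (x.1.1.1, drop (num_of_bits x.1.2) x.1.1.2, rest x.1.1.2 x.1.2, x.2).
have test O l m R : (ev (en (O, l, m, R))
    (Eeq (Econs (ebool (Ehd v0)) (ebool (Ehd (Etl v0)))) (Econs etrue etrue)) != Nil) =
    (l != [::]) && (m != [::]).
  by rewrite /ev /en /=; case: l; case: m.
apply: (computes_seq0 (d1 := en \o g)); last exact: computes_assign.
apply: computes_eq (computes_while (f := f) (g := g)
  (w := fun x => dsize (enc_seq x.1.1.2) + 4 * size x.1.2 + dsize x.2 + 3)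
  (mu := fun x => size x.1.1.2) (en := en) (q := 0) _
  (P := fun n => 4 * n + 3) _ _ _ _ _)
  _ _ _ _ => //.
- apply: poly_mono_add (poly_mono_const _); apply: poly_mono_mul (poly_mono_const _) poly_mono_id.
- move=> [[[O l] m] R] _; rewrite test => /andP[l0 m0]; split=> //=; case: l l0 => //= a l _.
  by have := size_predb m; lia.
- move=> [[[O l] m] R] _; rewrite test; case: l => [|a l] //=.
  case: m => [|b m] //=; rewrite /g /=; congr (_, _, _, _).
  by rewrite -/(predb (b :: m)) num_of_predb.
- move=> [[[O l] m] R] _; split=> /=.
  + by have := dsize_enc_bits m; lia.
  + by rewrite dsize_enc_seq; have := dseq_weight_size l; lia.
  + by have := dsize_enc_bits m; lia.
- apply: (computes_seq0 (d1 := fun x =>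
    Cons (enc_bits x.1.2) (Cons (enc_seq (behead x.1.1.2)) x.2))).
    by apply: computes_assign => // -[[[O [|a l]] m] R] [].
  apply: (computes_seq0 (d1 := fun x =>
    Cons (enc_bits (predb x.1.2)) (Cons (enc_seq (behead x.1.1.2)) x.2))).
    apply: (computes_reindex (pred_cmdP k)
      (g := fun x => (x.1.1.1, x.1.2, Cons (enc_seq (behead x.1.1.2)) x.2))) => //.
    by move=> [[[O l] m] R] []; rewrite test => _ /andP[].
  exact: computes_assign.
- by move=> i; rewrite muln0.
Qed.

(** * Running a program inside another one *)

Fixpoint eshift (k : nat) (e : expr) : expr :=
  match e with
  | Evar i => Evar (k + i)
  | Enil => Enil
  | Econs e1 e2 => Econs (eshift k e1) (eshift k e2)
  | Ehd e1 => Ehd (eshift k e1)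
  | Etl e1 => Etl (eshift k e1)
  | Eeq e1 e2 => Eeq (eshift k e1) (eshift k e2)
  end.

(** Variables are relocated by [k]; the replacements [tc] and [qc] of tosses and queries decide what
    kind of simulation this is. Note that [tc] and [qc] get the old variable index, but a relocated
    expression. *)
Fixpoint trans (k : nat) (tc : nat -> cmd) (qc : nat -> expr -> cmd) (c : cmd) : cmd :=
  match c with
  | Skip => Skip
  | Assign i e => Assign (k + i) (eshift k e)
  | Seq c1 c2 => Seq (trans k tc qc c1) (trans k tc qc c2)
  | If e c1 c2 => If (eshift k e) (trans k tc qc c1) (trans k tc qc c2)
  | While e c1 => While (eshift k e) (trans k tc qc c1)
  | Toss i => tc i
  | Query i e => qc i (eshift k e)
  end.

Lemma eval_shift k n m M e : evars e <= n -> (forall j, j < n -> M (k + j) = m j) ->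
  eval M (eshift k e) = eval m e /\ ecost M (eshift k e) = ecost m e.
Proof.
move=> le_n mM; elim: e le_n => [i||e1 IH1 e2 IH2|e IH|e IH|e1 IH1 e2 IH2] //= le_n.
- by rewrite mM.
- have [|-> ->] := IH1; first by lia.
  by have [|-> ->] := IH2; first by lia.
- by have [|-> ->] := IH.
- by have [|-> ->] := IH.
- have [|-> ->] := IH1; first by lia.
  by have [|-> ->] := IH2; first by lia.
Qed.

Section Trans.
Variables (k n : nat) (O O' : nat -> seq bool).
Variables (tc : nat -> cmd) (qc : nat -> expr -> cmd).
(* [St s cs ls]: in state [s], the run still tosses [cs] and queries [ls]. *)
Variable St : data -> seq bool -> seq nat -> Prop.
(* The coins and queries of the source, the coins and answers of its image. *)
Variable Out : seq bool -> seq nat -> seq bool -> seq (seq bool) -> Prop.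
Variables Tm B : nat.

Hypothesis k_gt0 : 0 < k.
Hypothesis B_gt0 : 0 < B.
Hypothesis Out_nil : Out [::] [::] [::] [::].
Hypothesis Out_cat : forall cs1 a1 cs1' a1' cs2 a2 cs2' a2',
  Out cs1 a1 cs1' a1' -> Out cs2 a2 cs2' a2' ->
  Out (cs1 ++ cs2) (a1 ++ a2) (cs1' ++ cs2') (a1' ++ a2').

Definition simulates_step (c : cmd) (i : nat) (d : data) (cs : seq bool)
    (ls : seq nat) (csr : seq bool) (lr : seq nat) (M : memory) : Prop :=
  exists M' cs' a' t',
    [/\ exec O' c M cs' a' t' M', t' <= B, St (M' 0) csr lr, Out cs ls cs' a' &
      M' (k + i) = d /\ forall j, 0 < j < k + n -> j != k + i -> M' j = M j].

Hypothesis toss_ok : forall i b cs ls M, i < n -> St (M 0) (b :: cs) ls ->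
  simulates_step (tc i) i (enc_bool b) [:: b] [::] cs ls M.

Hypothesis query_ok : forall i e l cs ls M, i < n -> ecost M e <= Tm ->
  l = num_of_bits (bits_of_data (eval M e)) -> St (M 0) cs (l :: ls) ->
  simulates_step (qc i e) i (enc_bits (O l)) [::] [:: l] cs ls M.

(** The run to be imitated is known in advance, so the invariant may speak of the coins and queries
    still to come; the continuations [csr] and [ar] carry the induction through sequences and loops.
    Since a source command costs at least 1, charging its image [B] per unit of time suffices. *)
Lemma trans_exec c m cs a t m' : lexec O c m cs a t m' -> cvars c <= n -> t <= Tm ->
  forall csr ar M, (forall j, j < n -> M (k + j) = m j) ->
  St (M 0) (cs ++ csr) (a ++ ar) ->
  exists M' cs' a' t',
    [/\ exec O' (trans k tc qc c) M cs' a' t' M', t' <= t * B, St (M' 0) csr ar,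
        Out cs a cs' a' &
        (forall j, j < n -> M' (k + j) = m' j) /\ forall j, 0 < j < k -> M' j = M j].
Proof.
have mB u : u <= u * B by rewrite leq_pmulr.
elim=> {c m cs a t m'}.
- move=> m _ _ csr ar M mM st; exists M, [::], [::], 1; split=> //.
  exact: exec_skip.
- move=> m i e /= le_n le_T csr ar M mM st.
  have [evE coE] := eval_shift (leq_trans (leq_maxr _ _) le_n) mM.
  exists (upd M (k + i) (eval m e)), [::], [::], (ecost m e).+1; split=> //.
  + by rewrite -evE -coE; apply: exec_assign.
  + by rewrite /upd; case: eqP => // eq0; move: k_gt0; lia.
  + split=> j lt_j; rewrite /upd; first by rewrite eqn_add2l mM.
    by case: eqP => // eq_j; lia.
- move=> c1 c2 m m1 m2 cs1 cs2 a1 a2 t1 t2 _ IH1 _ IH2 /= le_n le_T csr ar M mM.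
  rewrite -!catA => st.
  have n1 : cvars c1 <= n by lia.
  have n2 : cvars c2 <= n by lia.
  have T1 : t1 <= Tm by lia.
  have T2 : t2 <= Tm by lia.
  have [M1 [cs1' [a1' [t1' [ex1 le1 st1 out1 [mM1 fr1]]]]]] := IH1 n1 T1 _ _ M mM st.
  have [M2 [cs2' [a2' [t2' [ex2 le2 st2 out2 [mM2 fr2]]]]]] := IH2 n2 T2 _ _ M1 mM1 st1.
  exists M2, (cs1' ++ cs2'), (a1' ++ a2'), (t1' + t2'); split=> //.
  + exact: exec_seq ex1 ex2.
  + by rewrite mulnDl leq_add.
  + exact: Out_cat.
  + by split=> // j lt_j; rewrite fr2 ?fr1.
- move=> e c1 c2 m m' cs a t ex IH /= le_n le_T csr ar M mM st.
  have [evE coE] := eval_shift (leq_trans (leq_maxl _ _) le_n) mM.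
  have n1 : cvars (if eval m e != Nil then c1 else c2) <= n by case: ifP; lia.
  have T1 : t <= Tm by lia.
  have [M1 [cs1' [a1' [t1' [ex1 le1 st1 out1 [mM1 fr1]]]]]] := IH n1 T1 _ _ M mM st.
  exists M1, cs1', a1', (ecost m e + t1').+1; split=> //.
  + rewrite -coE; apply: exec_if; rewrite evE.
    by case: ifP ex1.
  + by have := mB (ecost m e); rewrite mulSn !mulnDl; lia.
- move=> e c m e0 /= le_n le_T csr ar M mM st.
  have [evE coE] := eval_shift (leq_trans (leq_maxl _ _) le_n) mM.
  exists M, [::], [::], (ecost m e).+1; split=> //.
  by rewrite -coE; apply: exec_while_stop; rewrite evE.
- move=> e c m m1 m2 cs1 cs2 a1 a2 t1 t2 e1 _ IH1 _ IH2 /= le_n le_T csr ar M mM.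
  rewrite -!catA => st.
  have [evE coE] := eval_shift (leq_trans (leq_maxl _ _) le_n) mM.
  have n1 : cvars c <= n by lia.
  have T1 : t1 <= Tm by lia.
  have T2 : t2 <= Tm by lia.
  have [M1 [cs1' [a1' [t1' [ex1 le1 st1 out1 [mM1 fr1]]]]]] := IH1 n1 T1 _ _ M mM st.
  have [M2 [cs2' [a2' [t2' [ex2 le2 st2 out2 [mM2 fr2]]]]]] := IH2 le_n T2 _ _ M1 mM1 st1.
  exists M2, (cs1' ++ cs2'), (a1' ++ a2'), (ecost m e + t1' + t2').+1; split=> //.
  + by rewrite -coE; apply: exec_while_loop ex1 ex2; rewrite evE.
  + by have := mB (ecost m e); rewrite mulSn !mulnDl; lia.
  + exact: Out_cat.
  + by split=> // j lt_j; rewrite fr2 ?fr1.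
- move=> m i b /= le_n le_T csr ar M mM st.
  have [M' [cs' [a' [t' [ex le st' out [M'i fr]]]]]] := toss_ok le_n st.
  exists M', cs', a', t'; split=> //; first by rewrite mul1n.
  split=> j lt_j; last by apply: fr; lia.
  rewrite /upd; case: eqP => [->//|/eqP ne]; rewrite fr ?eqn_add2l ?mM //; lia.
- move=> m i e a le_n le_T csr ar M mM st; rewrite /= in le_n le_T.
  have [evE coE] := eval_shift (leq_trans (leq_maxr _ _) le_n) mM.
  have lt_i : i < n by lia.
  have co : ecost M (eshift k e) <= Tm by lia.
  have aE : a = num_of_bits (bits_of_data (eval M (eshift k e))) by rewrite evE.
  have [M' [cs' [a' [t' [ex le st' out [M'i fr]]]]]] := query_ok lt_i co aE st.
  exists M', cs', a', t'; split=> //; first by apply: leq_trans le _; rewrite leq_pmull.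
  split=> j lt_j; last by apply: fr; lia.
  rewrite /upd; case: eqP => [->//|/eqP ne]; rewrite fr ?eqn_add2l ?mM //; lia.
Qed.

End Trans.

(** A callee expects empty variables, but earlier calls may have left values in them. *)
Fixpoint clear (k n : nat) : cmd :=
  if n is n'.+1 then Seq (clear k n') (Assign (k + n') Enil) else Skip.

Lemma clear_exec O k n M : 0 < k -> exists M', [/\
  exec O (clear k n) M [::] [::] (2 * n + 1) M', M' 0 = M 0,
  forall j, j < n -> M' (k + j) = Nil & forall j, 0 < j < k -> M' j = M j].
Proof.
move=> k0; elim: n => [|n [M1 [ex M10 M1n fr]]] /=.
  by exists M; split=> //; apply: exec_skip.
exists (upd M1 (k + n) Nil); split.
- have -> : 2 * n.+1 + 1 = (2 * n + 1) + 2 by lia.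
  by apply: (exec_seq (cs1 := [::]) (a1 := [::])) ex _; apply: (exec_assign _ _ _ Enil).
- by rewrite /upd; case: eqP => // ?; lia.
- by move=> j; rewrite /upd eqn_add2l ltnS leq_eqVlt; case: eqP => //= _; apply: M1n.
- by move=> j lt_j; rewrite /upd; case: eqP => [?|_]; [lia|exact: fr].
Qed.

(* Runs [c] on the head of the state.  [setup] computes the state in which the
   translation of [c] starts, and [final] what is left below the output. *)
Definition call (k : nat) (tc : nat -> cmd) (qc : nat -> expr -> cmd) (c : cmd)
    (setup final : expr) : cmd :=
  Seq (clear k (maxn 1 (cvars c))) (Seq (Assign k (Ehd v0)) (Seq (Assign 0 setup)
  (Seq (trans k tc qc c) (Assign 0 (Econs (Evar k) final))))).

(** The [maxn 1] reserves the input and output variable even for a program that mentions no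
    variable. The final state [s] remains in the time bound, to be estimated through [St] by each
    use. *)
Lemma call_exec k O O' tc qc St Out c setup final inp d cs a t m' csr ar M B :
  let n := maxn 1 (cvars c) in
  0 < k -> 0 < B -> Out [::] [::] [::] [::] ->
  (forall cs1 a1 cs1' a1' cs2 a2 cs2' a2',
    Out cs1 a1 cs1' a1' -> Out cs2 a2 cs2' a2' ->
    Out (cs1 ++ cs2) (a1 ++ a2) (cs1' ++ cs2') (a1' ++ a2')) ->
  (forall i b cs ls M, i < n -> St (M 0) (b :: cs) ls ->
    simulates_step k n O' St Out B (tc i) i (enc_bool b) [:: b] [::] cs ls M) ->
  (forall i e l cs ls M, i < n -> ecost M e <= t ->
    l = num_of_bits (bits_of_data (eval M e)) -> St (M 0) cs (l :: ls) ->
    simulates_step k n O' St Out B (qc i e) i (enc_bits (O l)) [::] [:: l] cs ls M) ->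
  lexec O c (upd (fun=> Nil) 0 inp) cs a t m' ->
  evars setup <= 1 -> evars final <= 1 ->
  M 0 = Cons inp d -> St (ev (Cons inp d) setup) (cs ++ csr) (a ++ ar) ->
  exists M' cs' a' t' s,
    [/\ exec O' (call k tc qc c setup final) M cs' a' t' M',
        t' <= 2 * n + 10 + 2 * (dsize inp + dsize d) + ework setup * dsize (Cons inp d)
              + t * B + 2 * dsize (m' 0) + 2 * ework final * dsize s,
        Out cs a cs' a', St s csr ar &
        M' 0 = Cons (m' 0) (ev s final) /\ forall j, 0 < j < k -> M' j = M j].
Proof.
move=> n k0 B0 Out0 OutD tossP queryP ex s1 f1 M0 st.
have [M1 [ex1 M10 M1n fr1]] := clear_exec O' n M k0.
pose M2 := upd M1 k inp; pose M3 := upd M2 0 (ev (Cons inp d) setup).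
have nk i : (0 == k + i) = false by lia.
have M20 : M2 0 = Cons inp d by rewrite /M2 /upd -[k]addn0 nk M10 M0.
have ex2 : exec O' (Assign k (Ehd v0)) M1 [::] [::] (ecost M1 (Ehd v0)).+1 M2.
  have -> : M2 = upd M1 k (eval M1 (Ehd v0)) by rewrite /M2 /= M10 M0.
  exact: exec_assign.
have ex3 : exec O' (Assign 0 setup) M2 [::] [::] (ecost M2 setup).+1 M3.
  have -> : M3 = upd M2 0 (eval M2 setup) by rewrite /M3 eval_ev // M20.
  exact: exec_assign.
have mM3 j : j < n -> M3 (k + j) = upd (fun=> Nil) 0 inp j.
  move=> lt_j; rewrite /M3 /M2 /upd eq_sym nk -[X in _ == X]addn0 eqn_add2l.
  by case: eqP => // _; apply: M1n.
have st3 : St (M3 0) (cs ++ csr) (a ++ ar) by rewrite /M3 /upd eqxx.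
have [M4 [cs' [a' [t' [ex4 le4 st4 out4 [mM4 fr4]]]]]] :=
  trans_exec k0 B0 Out0 OutD tossP queryP ex (leq_maxr _ _) (leqnn _) mM3 st3.
have M4k : M4 k = m' 0 by rewrite -[k]addn0 mM4 // leq_maxl.
pose M5 := upd M4 0 (Cons (m' 0) (ev (M4 0) final)).
have ex5 : exec O' (Assign 0 (Econs (Evar k) final)) M4 [::] [::]
    (ecost M4 (Econs (Evar k) final)).+1 M5.
  have -> : M5 = upd M4 0 (eval M4 (Econs (Evar k) final)).
    by rewrite /M5 /= M4k (eval_ev _ f1).
  exact: exec_assign.
exists M5, cs', a', ((2 * n + 1) + ((ecost M1 (Ehd v0)).+1 + ((ecost M2 setup).+1 +
  (t' + (ecost M4 (Econs (Evar k) final)).+1)))), (M4 0); split=> //.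
- apply: (exec_seq (cs1 := [::]) (a1 := [::])) ex1 _.
  apply: (exec_seq (cs1 := [::]) (a1 := [::])) ex2 _.
  apply: (exec_seq (cs1 := [::]) (a1 := [::])) ex3 _.
  by rewrite -[cs']cats0 -[a']cats0; apply: exec_seq ex4 ex5.
- have := ecost_ev M2 s1; rewrite M20 => c2; rewrite /= in c2.
  have := ecost_ev M4 f1 => c4; have := dsize_eval M4 final.
  have := dsize_gt0 (m' 0).
  rewrite [ecost _ (Econs _ _)]/= [ecost _ (Ehd _)]/= M10 M0 M4k /= -mulnA; lia.
- split=> [|j lt_j]; first by rewrite /M5 /upd eqxx.
  have j0 : (j == 0) = false by lia.
  have jk : (j == k) = false by lia.
  by rewrite /M5 /upd j0 fr4 // /M3 /M2 /upd j0 jk fr1.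
Qed.

Ltac poly_mono_tac :=
  repeat (first [ assumption | exact: poly_mono_const | exact: poly_mono_id
                | apply: poly_mono_add | apply: poly_mono_mul ]).

(** * Calls that record their coins or take them from a tape *)

Definition rec_toss (k i : nat) : cmd :=
  Seq (Toss (k + i))
      (Assign 0 (Econs (Econs (Evar (k + i)) (Ehd v0)) (Etl v0))).

Definition rec_query (k i : nat) (e : expr) : cmd := Assign (k + i) Enil.

(* Records the coins, last one first; the answers of [no_oracle] are empty. *)
Definition rec_call (k : nat) (c : cmd) : cmd :=
  call k (rec_toss k) (rec_query k) c (Econs Enil v0) v0.

Lemma rec_callP (I : Type) (D : I -> Prop) k O c (inp rest out : I -> data) cs p :
  0 < k -> poly_mono p ->
  (forall i, D i -> exists a t m', [/\ exec no_oracle c (upd (fun=> Nil) 0 (inp i)) (cs i) a t m',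
     m' 0 = out i & t <= p (dsize (inp i))]) ->
  computes D k O (rec_call k c) (fun i => Cons (inp i) (rest i)) cs (fun=> 0)
    (fun i => Cons (out i) (Cons (enc_bits (rev (cs i))) (Cons (inp i) (rest i)))).
Proof.
move=> k0 pm run; pose n := maxn 1 (cvars c).
(* [S N] bounds the state during the call: at most [p N] recorded coins, each of encoded size at
   most 4, on top of the original state. [B N] bounds the cost of imitating one command. *)
pose S N := 4 * p N + N + 10; pose B N := 10 * S N + 20.
exists (fun N => 2 * n + 10 + 2 * N + ework (Econs Enil v0) * N + p N * B N
                 + 2 * (N + 3 * p N) + 2 * 1 * S N).
  by rewrite /B /S; poly_mono_tac.
move=> i Di M M0; have [a [t [m' [ex m'0 le_t]]]] := run i Di.
have [base baseE] : exists b, b = Cons (inp i) (rest i) by eexists.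
set N := dsize _.
have NE : N = (dsize (inp i) + dsize (rest i)).+1 by [].
have bE : dsize base = N by rewrite baseE.
clearbody N.
have le_pN : t <= p N by apply: leq_trans le_t _; apply: pm.1; rewrite NE; lia.
pose St (s : data) (csr : seq bool) (ar : seq nat) :=
  exists2 done, s = Cons (enc_bits done) base & catrev csr done = rev (cs i).
have StS s csr ar : St s csr ar -> dsize s <= S N.
  move=> [done -> /(congr1 size)]; rewrite catrevE size_cat !size_rev => sz.
  have := exec_size_coins ex; have := dsize_enc_bits done.
  rewrite /S [dsize (Cons _ _)]/= bE; lia.
pose Out (cs1 : seq bool) (a1 : seq nat) cs2 (a2 : seq (seq bool)) :=
  cs2 = cs1 /\ a2 = [::].
have nk j : (0 == k + j) = false by lia.
have [ls aE' lex] := exec_lexec ex.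
have [||||||||M' [cs' [a' [t' [s [ex' le' [csE aE] sts [M'0 fr]]]]]]] :=
  @call_exec k no_oracle (O i) (rec_toss k) (rec_query k) St Out c (Econs Enil v0) v0
    (inp i) (rest i) (cs i) ls t m' [::] [::] M (B N) k0 _ _ _ _ _ lex _ _ M0 _.
- by rewrite /B addnS.
- by [].
- by move=> cs1 a1 cs1' a1' cs2 a2 cs2' a2' [-> ->] [-> ->].
- move=> j b csr ar M1 lt_j st; have := StS _ _ _ st; case: st => done M10 cat_eq sz.
  pose M2 := upd M1 (k + j) (enc_bool b).
  pose s' := Cons (enc_bits (b :: done)) base.
  have ev2 : eval M2 (Econs (Econs (Evar (k + j)) (Ehd v0)) (Etl v0)) = s'.
    by rewrite /M2 /= /upd eqxx nk M10.
  exists (upd M2 0 s'), [:: b], [::],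
    (1 + (ecost M2 (Econs (Econs (Evar (k + j)) (Ehd v0)) (Etl v0))).+1); split.
  + apply: (exec_seq (cs1 := [:: b]) (cs2 := [::]) (a1 := [::])); first exact: exec_toss.
    by rewrite -ev2; apply: exec_assign.
  + rewrite /= /M2 /upd eqxx nk M10 /B /= bE; rewrite M10 /= bE in sz.
    by have := dsize_bool b; lia.
  + by exists (b :: done); [|exact: cat_eq].
  + by [].
  + split=> [|j' lt_j' ne]; first by rewrite /M2 /upd [k + j == 0]eq_sym nk eqxx.
    by rewrite /M2 /upd (negPf ne); case: eqP => // ?; lia.
- move=> j e l csr ar M1 lt_j _ _ [done M10 cat_eq].
  exists (upd M1 (k + j) Nil), [::], [::], 2; split=> //.
  + exact: (exec_assign _ _ _ Enil).
  + by rewrite /B; lia.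
  + by exists done; [rewrite /upd nk|exact: cat_eq].
  + split=> [|j' lt_j' ne]; first by rewrite /upd eqxx.
    by rewrite /upd (negPf ne).
- by [].
- by [].
- by exists [::]; rewrite ?baseE // cats0 catrevE cats0.
exists M', a', t'; rewrite -csE; split=> //.
- apply: leq_trans le' _; rewrite -/n.
  have := exec_dsize ex 0; rewrite m'0 /upd /= => szo; have := StS _ _ _ sts.
  have : t * B N <= p N * B N by rewrite leq_mul2r le_pN orbT.
  rewrite -NE; lia.
- by rewrite aE.
- rewrite M'0 m'0 -baseE; case: sts => done -> /=; rewrite /ev /= => ->.
  by rewrite csE.
Qed.

(** The tape discipline of [rep_toss]: any head other than [Nil] is the coin [true], and an
    exhausted tape goes on yielding [false], in agreement with padding by [false]. *)
Fixpoint reads (tp : data) (cs : seq bool) : Prop :=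
  if cs is b :: cs' then (dhd tp != Nil) = b /\ reads (dtl tp) cs' else True.

Lemma reads_padded tp r :
  reads tp (take r (bits_of_data tp ++ nseq r false)).
Proof.
suff gen m : r <= m -> reads tp (take r (bits_of_data tp ++ nseq m false)) by exact: gen.
elim: r tp m => [|r IH] tp m; first by rewrite take0.
case: tp => [|a tp] /=.
  by case: m => // m le_m /=; split=> //; apply: (IH Nil).
by move=> lt_m; split=> //; apply: IH; lia.
Qed.

Lemma reads_prefix tp cs s : prefix cs s -> reads tp s -> reads tp cs.
Proof.
by elim: cs tp s => //= b cs IH tp [|b' s] //= /andP[/eqP -> /IH pre] [-> /pre].
Qed.

Lemma reads_enc cs : reads (enc_bits cs) cs.
Proof. by elim: cs => //= b cs IH; rewrite enc_bool_neq0. Qed.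

Definition rep_toss (k i : nat) : cmd :=
  Seq (Assign (k + i) (ebool (Ehd (Ehd v0))))
      (Assign 0 (Econs (Etl (Ehd v0)) (Etl v0))).

(* Takes the coins from a tape, blank beyond its end. *)
Definition rep_call (k : nat) (c : cmd) : cmd :=
  call k (rep_toss k) (rec_query k) c (Etl v0) (Etl v0).

Lemma assign_pair_exec k n O i e1 e2 M : 0 < k -> i < n -> evars e1 <= 1 -> evars e2 <= 1 ->
  exists M' t, [/\ exec O (Seq (Assign (k + i) e1) (Assign 0 e2)) M [::] [::] t M',
    t <= (ework e1 + ework e2) * dsize (M 0) + 2, M' 0 = ev (M 0) e2 &
    M' (k + i) = ev (M 0) e1 /\ forall j, 0 < j < k + n -> j != k + i -> M' j = M j].
Proof.
move=> k0 lt_i le1 le2; pose M1 := upd M (k + i) (eval M e1).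
have nk : (0 == k + i) = false by lia.
have M10 : M1 0 = M 0 by rewrite /M1 /upd nk.
exists (upd M1 0 (eval M1 e2)), ((ecost M e1).+1 + (ecost M1 e2).+1); split.
- by apply: (exec_seq (cs1 := [::]) (a1 := [::])); apply: exec_assign.
- by have := ecost_ev M le1; have := ecost_ev M1 le2; rewrite M10; lia.
- by rewrite /upd eqxx eval_ev // M10.
- split=> [|j lt_j ne]; first by rewrite /upd eq_sym nk /M1 /upd eqxx eval_ev.
  by rewrite /M1 /upd (negPf ne); case: eqP => // ?; lia.
Qed.

Lemma rep_callP (I : Type) (D : I -> Prop) k O c (inp tp rest out : I -> data) cs p :
  0 < k -> poly_mono p ->
  (forall i, D i -> exists a t m', [/\ exec no_oracle c (upd (fun=> Nil) 0 (inp i)) (cs i) a t m',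
     m' 0 = out i & t <= p (dsize (inp i))]) ->
  (forall i, D i -> reads (tp i) (cs i)) ->
  computes D k O (rep_call k c)
    (fun i => Cons (inp i) (Cons (tp i) (rest i)))
    (fun=> [::]) (fun=> 0) (fun i => Cons (out i) (rest i)).
Proof.
move=> k0 pm run rtp; pose n := maxn 1 (cvars c).
pose w := ework (ebool (Ehd (Ehd v0))) + ework (Econs (Etl (Ehd v0)) (Etl v0)).
pose B N := w * N + 2.
exists (fun N => 2 * n + 10 + 2 * N + ework (Etl v0) * N + p N * B N
                 + 2 * (N + 3 * p N) + 2 * ework (Etl v0) * N).
  by rewrite /B; poly_mono_tac.
move=> i Di M M0; have [a [t [m' [ex m'0 le_t]]]] := run i Di.
set N := dsize _.
have NE : N = (dsize (inp i) + (dsize (tp i) + dsize (rest i)).+1).+1 by [].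
clearbody N.
have le_pN : t <= p N by apply: leq_trans le_t _; apply: pm.1; rewrite NE; lia.
pose St (s : data) (csr : seq bool) (ar : seq nat) :=
  exists tp1, [/\ s = Cons tp1 (rest i), reads tp1 csr & dsize s <= N].
pose Out (cs1 : seq bool) (a1 : seq nat) (cs2 : seq bool) (a2 : seq (seq bool)) :=
  cs2 = [::] /\ a2 = [::].
have [ls _ lex] := exec_lexec ex.
have [||||||||M' [cs' [a' [t' [s [ex' le' [csE aE] sts [M'0 fr]]]]]]] :=
  @call_exec k no_oracle (O i) (rep_toss k) (rec_query k) St Out c (Etl v0) (Etl v0)
    (inp i) (Cons (tp i) (rest i)) (cs i) ls t m' [::] [::] M (B N)
    k0 _ _ _ _ _ lex _ _ M0 _.
- by rewrite /B addnS.
- by [].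
- by move=> cs1 a1 cs1' a1' cs2 a2 cs2' a2' [-> ->] [-> ->].
- move=> j b csr ar M1 lt_j [tp1 [M10 /= [rb rtp1] sz]].
  have [M2 [t2 [ex2 le2 M20 [M2k fr2]]]] :=
    @assign_pair_exec k n (O i) j (ebool (Ehd (Ehd v0)))
    (Econs (Etl (Ehd v0)) (Etl v0)) M1 k0 lt_j isT isT.
  exists M2, [::], [::], t2; split=> //.
  + by apply: leq_trans le2 _; rewrite /B leq_add2r leq_mul.
  + rewrite M20 M10 in sz *; exists (dtl tp1); split=> //.
    by apply: leq_trans sz => /=; have := dsize_tl tp1; rewrite /dtl; lia.
  + split=> //; rewrite M2k M10 /ev /= -rb -/(dhd tp1).
    by case: (dhd tp1 == Nil).
- move=> j e l csr ar M1 lt_j _ _ [tp1 [M10 rtp1 sz]].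
  have nk : (0 == k + j) = false by lia.
  exists (upd M1 (k + j) Nil), [::], [::], 2; split=> //.
  + exact: (exec_assign _ _ _ Enil).
  + by rewrite /B; lia.
  + by exists tp1; rewrite /upd nk.
  + split=> [|j' lt_j' ne]; first by rewrite /upd eqxx.
    by rewrite /upd (negPf ne).
- by [].
- by [].
- rewrite !cats0; exists (tp i); split=> //; first exact: rtp.
  by rewrite NE /ev /=; lia.
exists M', a', t'; rewrite -csE; split=> //.
- apply: leq_trans le' _; rewrite -/n.
  have := exec_dsize ex 0; rewrite m'0 /upd /= => szo.
  have : t * B N <= p N * B N by rewrite leq_mul2r le_pN orbT.
  have [? [_ _ szs]] := sts.
  have : 2 * ework (Etl v0) * dsize s <= 2 * ework (Etl v0) * N by rewrite leq_mul.
  rewrite -NE; lia.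
- by rewrite aE.
- by rewrite M'0 m'0; case: sts => ? [-> _ _].
Qed.

(** * Encodings *)

Lemma num_of_bits_inj : injective num_of_bits.
Proof.
elim=> [|b s IH] [|b' s'] //= [eq_bs].
have eqb : b = b'.
  move/(congr1 odd): eq_bs; rewrite !oddD !odd_double !addbF.
  by case: b; case: b'.
by move: eq_bs; rewrite eqb => /addnI/double_inj/IH ->.
Qed.

Lemma num_of_bitsK : cancel num_of_bits bits_of_num.
Proof. by move=> s; apply: num_of_bits_inj; rewrite bits_of_numK. Qed.

Lemma enc_num_of_bits s : enc_num (num_of_bits s) = enc_bits s.
Proof. by rewrite /enc_num num_of_bitsK. Qed.

Lemma enc_numK n : num_of_bits (bits_of_data (enc_num n)) = n.
Proof. by rewrite enc_bitsK bits_of_numK. Qed.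

Lemma enc_num_inj : injective enc_num.
Proof.
by move=> m n /(congr1 (num_of_bits \o bits_of_data)); rewrite /= !enc_numK.
Qed.

Lemma enc_bits_inj : injective enc_bits.
Proof. exact: can_inj enc_bitsK. Qed.

Lemma enc_seq_inj : injective enc_seq.
Proof. exact: can_inj enc_seqK. Qed.

Lemma enc_bool_inj : injective enc_bool.
Proof. by case; case. Qed.

Lemma enc_gate_inj : injective enc_gate.
Proof.
have d01 : enc_num 0 <> enc_num 1 by move/enc_num_inj.
have d02 : enc_num 0 <> enc_num 2 by move/enc_num_inj.
have d03 : enc_num 0 <> enc_num 3 by move/enc_num_inj.
have d12 : enc_num 1 <> enc_num 2 by move/enc_num_inj.
have d13 : enc_num 1 <> enc_num 3 by move/enc_num_inj.
have d23 : enc_num 2 <> enc_num 3 by move/enc_num_inj.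
by case=> [b|i|i j|i j] [b'|i'|i' j'|i' j'] /enc_seq_inj h;
  (have {h} [] := h) => //; try (by move=> /esym e; exfalso; eauto);
  try (by move=> e; exfalso; eauto); do ?[move/enc_num_inj=> -> | move/enc_bool_inj=> ->].
Qed.

Lemma enc_circuit_inj : injective enc_circuit.
Proof.
move=> [n g o wf] [n' g' o' wf'] /enc_seq_inj[].
move=> /enc_seq_inj/(congr1 size); rewrite !size_nseq => eqn.
move=> /enc_seq_inj/(inj_map enc_gate_inj) eqg /enc_num_inj eqo; subst.
by rewrite (bool_irrelevance wf wf').
Qed.

(** A program only determines the encoded output; injectivity passes its determinism on to the
    queries and the decision circuit. *)
Lemma enc_verifier_output_inj I (V : verifier I) x mu y nu :
  enc_verifier_output V x mu = enc_verifier_output V y nu ->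
  nv_query V x mu = nv_query V y nu /\ nv_circuit V x mu = nv_circuit V y nu.
Proof.
move=> eqo; split; first exact: inj_map enc_num_inj _ _ (enc_seq_inj (congr1 dhd eqo)).
exact: enc_circuit_inj (congr1 dtl eqo).
Qed.

Lemma enc_view_inj : injective enc_view.
Proof.
move=> [cs a] [cs' a'] eqv; have eq1 := enc_bits_inj (congr1 dhd eqv).
have eq2 := inj_map enc_bits_inj (enc_seq_inj (congr1 dtl eqv)).
by rewrite /= in eq1 eq2; rewrite eq1 eq2.
Qed.

Lemma leq_size_enc_seq s : size s <= dsize (enc_seq s).
Proof. by rewrite dsize_enc_seq; have := dseq_weight_size s; lia. Qed.

Lemma leq_size_enc_bits s : size s <= dsize (enc_bits s).
Proof. by have := leq_size_enc_seq (map enc_bool s); rewrite size_map. Qed.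

Lemma leq_csize_enc C : csize C <= dsize (enc_circuit C).
Proof.
rewrite /csize; have := leq_size_enc_seq (nseq (c_inputs C) Nil).
have := leq_size_enc_seq (map enc_gate (c_gates C)).
by rewrite size_map size_nseq /=; lia.
Qed.

(* [uc i mu] is the part of the random tape [mu] that is read on input [i]. *)
Definition runs_ppt (I : Type) (enc : I -> data) (sz : I -> nat) (r : nat -> nat)
    (F : I -> seq bool -> data) (M : cmd) (p : nat -> nat)
    (uc : I -> seq bool -> seq bool) : Prop :=
  poly_mono p /\ forall i mu, size mu = r (sz i) -> prefix (uc i mu) mu /\
    exists a t m', [/\ exec no_oracle M (upd (fun=> Nil) 0 (enc i)) (uc i mu) a t m',
      m' 0 = F i mu & t <= p (dsize (enc i))].

(** Choice turns the coins read on each tape into a function [uc], on which the addresses of the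
    inner proofs will depend. The time bound is restated in the size of the encoded input, the
    measure used by [computes]. *)
Lemma ppt_runs I enc sz r (F : I -> seq bool -> data) :
  (forall i, sz i <= dsize (enc i)) -> ppt enc sz r F ->
  exists M p uc, runs_ppt enc sz r F M p uc.
Proof.
move=> le_sz [M [T [/polynomially_bounded_mono[p pm leT] run]]].
have /choice[uc ucP] : forall imu : I * seq bool, exists cs,
    size imu.2 = r (sz imu.1) -> prefix cs imu.2 /\
    exists a t m', [/\ exec no_oracle M (upd (fun=> Nil) 0 (enc imu.1)) cs a t m',
      m' 0 = F imu.1 imu.2 & t <= p (dsize (enc imu.1))].
  move=> [i mu] /=.
  have [szmu|/eqP ne] := eqVneq (size mu) (r (sz i)); last by exists [::] => /ne.
  have [cs [a [t [[pre [m' [ex m'0]]] le_t]]]] := run i mu szmu.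
  exists cs => _; split=> //; exists a, t, m'; split=> //.
  by apply: leq_trans le_t (leq_trans (leT _) _); apply: pm.1.
by exists M, p, (fun i mu => uc (i, mu)); split=> // i mu; apply: (ucP (i, mu)).
Qed.

(** This allows a tape to be exchanged for any other that extends the coins read, in particular for
    the padded address of an inner proof or for a spliced tape. *)
Lemma runs_ppt_det I enc sz r (F : I -> seq bool -> data) M p uc i mu nu :
  runs_ppt enc sz r F M p uc -> size mu = r (sz i) -> size nu = r (sz i) ->
  prefix (uc i mu) nu -> uc i nu = uc i mu /\ F i nu = F i mu.
Proof.
move=> [_ run] szm szn pre; have [_ [a [t [m' [ex m'0 _]]]]] := run i mu szm.
have [pre' [a' [t' [m1 [ex' m10 _]]]]] := run i nu szn.
case/prefixP: pre => s eqs; case/prefixP: pre' => s' eqs'.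
have [-> _ _ eqm] := exec_det ex ex' (etrans (esym eqs) eqs').
by rewrite -m'0 -m10 eqm.
Qed.

(** * The composed proof *)

Definition outer_loc (j : nat) : nat := num_of_bits (false :: bits_of_num j).

(** The index comes first, in self-delimiting form; the coins, whose number varies, then need no end
    marker. *)
Definition inner_loc (cs : seq bool) (n : nat) : nat :=
  num_of_bits (true :: locenc (bits_of_num n) (false :: cs)).

Definition pad (r : nat) (s : seq bool) : seq bool := take r (s ++ nseq r false).

Lemma size_pad r s : size (pad r s) = r.
Proof. by rewrite size_takel // size_cat size_nseq leq_addl. Qed.

Lemma prefix_pad r s : size s <= r -> prefix s (pad r s).
Proof.
by move=> le_r; rewrite /pad take_cat ltnNge le_r /= prefix_prefix.
Qed.

Section ComposedProof.
Variables (Vo : verifier (seq bool)) (f : circuit -> seq bool -> seq bool).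
Variable ro : nat -> nat.

(* The string that the inner verifier accesses when the outer one has tossed the
   coins [s]; every [s] is padded to a random tape, so that the malicious
   queries are answered, too. *)
Definition inner_string (x : seq bool) (pi : proof boolean) (s : seq bool) : seq bool :=
  let mu := pad (ro (size x)) s in
  let y := map pi (nv_query Vo x mu) in y ++ f (nv_circuit Vo x mu) y.

(** The first bit of a location selects the part. Every location must have a value, as malicious
    queries are arbitrary; the empty numeral reads location 0 of [pi]. *)
Definition composed (x : seq bool) (pi : proof boolean) : proof boolean :=
  fun l => match bits_of_num l with
           | true :: u => nth false (inner_string x pi (parse u [::]).1)
                             (num_of_bits (parse u [::]).2)
           | u => pi (num_of_bits (behead u))
           end.

Lemma composed_outer x pi j : composed x pi (outer_loc j) = pi j.
Proof. by rewrite /composed /outer_loc num_of_bitsK /= bits_of_numK. Qed.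

Lemma composed_inner x pi cs n :
  composed x pi (inner_loc cs n) = nth false (inner_string x pi cs) n.
Proof.
by rewrite /composed /inner_loc num_of_bitsK parse_locenc /= cats0 bits_of_numK.
Qed.

End ComposedProof.

(** * Answering the queries to the composed proof *)

Lemma computes_seql (I : Type) (D : I -> Prop) k O c1 c2 d d1 d2 cs q :
  computes D k O c1 d cs q d1 ->
  computes D k O c2 d1 (fun=> [::]) (fun=> 0) d2 ->
  computes D k O (Seq c1 c2) d cs q d2.
Proof.
move=> h1 h2; apply: computes_eq (computes_seq h1 h2) _ _ _ _ => // i _.
  by rewrite cats0.
by rewrite addn0.
Qed.

Lemma computes_leq (I : Type) (D : I -> Prop) k O c d cs q q' d' :
  computes D k O c d cs q d' -> (forall i, D i -> q i <= q' i) ->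
  computes D k O c d cs q' d'.
Proof. by move=> h le; apply: computes_eq h _ _ _ _. Qed.

Definition push_query (k : nat) (e : expr) : cmd :=
  Seq (Query k e) (Assign 0 (Econs (Evar k) v0)).

(** The 5 is the largest size of an encoded one-bit answer. *)
Lemma push_queryP (I : Type) (D : I -> Prop) k (O : I -> oracle) e din :
  0 < k -> evars e <= 1 -> (forall i j, dsize (enc_bits (O i j)) <= 5) ->
  computes D k O (push_query k e) din (fun=> [::]) (fun=> 1)
    (fun i => Cons (enc_bits (O i (num_of_bits (bits_of_data (ev (din i) e))))) (din i)).
Proof.
move=> k0 e1 O5; exists (fun n => ework e * n + 2 * n + 20); first by poly_mono_tac.
move=> i _ M M0; set a := O i _; pose M1 := upd M k (enc_bits a).
have k0' : (0 == k) = false by lia.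
have M10 : M1 0 = din i by rewrite /M1 /upd k0'.
have M1k : M1 k = enc_bits a by rewrite /M1 /upd eqxx.
pose t2 := (ecost M1 (Econs (Evar k) v0)).+1.
exists (upd M1 0 (eval M1 (Econs (Evar k) v0))), [:: a],
  ((ecost M e + dsize (enc_bits a)).+1 + t2); split=> //.
- apply: (@exec_seq _ _ _ _ M1 _ [::] [::] [:: a] [::]); last exact: exec_assign.
  have aE : a = O i (num_of_bits (bits_of_data (eval M e))) by rewrite eval_ev // M0.
  by rewrite /M1 aE; apply: exec_query.
- have := ecost_ev M e1; have := O5 i (num_of_bits (bits_of_data (ev (din i) e))).
  rewrite M0 -/a /t2 /= M1k M10; lia.
- by rewrite /upd /= M10 M1k.
- by move=> j lt_j; rewrite /M1 /upd; case: eqP => [?|_]; [lia|case: eqP => // ?; lia].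
Qed.

Definition ask_loop (k : nat) : cmd :=
  While (Ehd v0) (Seq (push_query k (Ehd (Ehd v0)))
    (Assign 0 (Econs (Etl (Ehd (Etl v0)))
      (Econs (Econs (Ehd (Ehd v0)) (Ehd (Etl (Etl v0)))) (Etl (Etl (Etl v0))))))).

Lemma ask_loopP k : 0 < k ->
  computes (fun=> True) k
    (fun x : proof boolean * seq nat * seq bool * data => bits_oracle x.1.1.1)
    (ask_loop k)
    (fun x => Cons (enc_seq (map enc_num x.1.1.2)) (Cons (enc_bits x.1.2) x.2))
    (fun=> [::]) (fun x => size x.1.1.2)
    (fun x => Cons Nil (Cons (enc_bits (catrev (map x.1.1.1 x.1.1.2) x.1.2)) x.2)).
Proof.
move=> k0; pose X := (proof boolean * seq nat * seq bool * data)%type.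
pose en (x : X) := Cons (enc_seq (map enc_num x.1.1.2)) (Cons (enc_bits x.1.2) x.2).
pose f (x : X) : X := (x.1.1.1, behead x.1.1.2, x.1.1.1 (head 0 x.1.1.2) :: x.1.2, x.2).
pose g (x : X) : X := (x.1.1.1, [::], catrev (map x.1.1.1 x.1.1.2) x.1.2, x.2).
apply: computes_eq (computes_while (f := f) (g := g)
  (w := fun x => dsize (en x) + 4 * size x.1.1.2)
  (mu := fun x => size x.1.1.2) (en := en) (q := 1) _
  (P := fun n => n + 4 * n) _ _ _ _ _)
  _ _ _ _ => //.
- by poly_mono_tac.
- move=> [[[pi [|a l]] m] R] _ //= _; split=> //=; rewrite -/(enc_bits m).
  by have := dsize_bool (pi a); lia.
- by move=> [[[pi [|a l]] m] R].
- move=> [[[pi l] m] R] _; split=> //=; have := leq_size_enc_seq (map enc_num l);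
    rewrite size_map; lia.
- apply: computes_seql; first by apply: push_queryP => // -[[[pi l] m] R] j /=; case: (pi j).
  apply: computes_assign => // -[[[pi [|a l]] m] R] [_] // _.
  by rewrite /ev /= enc_numK.
- by move=> i _; rewrite muln1.
Qed.

Section AnswerQueries.
Variables (Vo : verifier (seq bool)) (f : circuit -> seq bool -> seq bool).
Variables (ro qo : nat -> nat) (Mo Mf : cmd) (po pf : nat -> nat).
Variable uco : seq bool -> seq bool -> seq bool.
Variable ucf : circuit * seq bool -> seq bool -> seq bool.
Hypothesis Mo_ok : runs_ppt enc_bits (@size bool) ro (enc_verifier_output Vo) Mo po uco.
Hypothesis Mf_ok : runs_ppt (fun Cy => Cons (enc_circuit Cy.1) (enc_bits Cy.2))
  (fun Cy => csize Cy.1 + size Cy.2) (fun=> 0) (fun Cy _ => enc_bits (f Cy.1 Cy.2))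
  Mf pf ucf.
Hypothesis query_bound : forall x mu, size mu = ro (size x) ->
  size (nv_query Vo x mu) <= qo (size x).

(* In the comments, [loc] is the location without its first bit, [n] the index
   into the string [y ++ z] of the inner oracle, and [s] the outer coins. *)
Definition inner_answer (k : nat) : cmd :=
  (* (loc, (nil, (x, R))) *)
  Seq (Assign 0 (Econs (Etl (Ehd v0)) (Econs Enil (Etl v0))))
  (Seq parse_loop
  (* (x, (s, (n, (x, R)))) *)
  (Seq (Assign 0 (Econs (Ehd (Etl (Etl v0)))
        (Econs (Etl (Ehd v0)) (Etl v0))))
  (Seq (rep_call k Mo)
  (* (Q, (nil, (C, (n, (x, R))))) *)
  (Seq (Assign 0 (Econs (Ehd (Ehd v0)) (Econs Enil (Econs (Etl (Ehd v0)) (Etl v0)))))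
  (Seq (ask_loop k)
  (* (rev y, (nil, (rev y, (C, (n, (x, R)))))) *)
  (Seq (Assign 0 (Econs (Ehd (Etl v0)) (Econs Enil (Etl v0))))
  (Seq rev_loop
  (* ((C, y), (nil, (rev y, (n, (x, R))))) *)
  (Seq (Assign 0 (Econs (Econs (Ehd (Etl (Etl (Etl v0)))) (Ehd (Etl v0)))
        (Econs Enil
        (Econs (Ehd (Etl (Etl v0))) (Etl (Etl (Etl (Etl v0))))))))
  (Seq (rep_call k Mf)
  (* (rev y, (z, (n, (x, R)))) *)
  (Seq (Assign 0 (Econs (Ehd (Etl v0)) (Econs (Ehd v0) (Etl (Etl v0)))))
  (Seq rev_loop
  (Seq (Assign 0 (Etl v0))
  (Seq lookup_cmd
       (Assign 0 (Econs (Econs (Ehd (Ehd v0)) Enil) (Etl v0)))))))))))))))).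

Definition answer_cmd (k : nat) : cmd :=
  If (Ehd (Ehd v0)) (inner_answer k)
    (Seq (push_query k (Etl (Ehd v0))) (Assign 0 (Econs (Ehd v0) (Etl (Etl v0))))).

Let composed_proof := composed Vo f ro.

Let index := (proof boolean * seq bool * data * data)%type.

(** An inner location is answered by recomputing its entire inner string, which is possible because
    the inner prover is a function computed by [Mf]. The query count is the larger of those of the
    two branches, an outer location taking one query. *)
Lemma answer_cmdP k : 0 < k ->
  computes (fun=> True) k (fun i : index => bits_oracle i.1.1.1) (answer_cmd k)
    (fun i => Cons i.1.2 (Cons (enc_bits i.1.1.2) i.2)) (fun=> [::])
    (fun i => maxn 1 (qo (size i.1.1.2)))
    (fun i => Cons (enc_bits [:: composed_proof i.1.1.2 i.1.1.1 (num_of_bits (bits_of_data i.1.2))])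
                (Cons (enc_bits i.1.1.2) i.2)).
Proof.
move=> k0; apply: computes_if => //; last first.
  apply: (computes_leq (q := fun=> 1)) => [|i _]; last exact: leq_maxl.
  apply: computes_seql.
    by apply: push_queryP => // -[[[pi x] d] R] j /=; case: (pi j).
  apply: computes_assign => // -[[[pi x] [|a d]] R] [_ nz];
    rewrite /composed_proof /composed num_of_bitsK //.
  by rewrite /ev /= in nz *; rewrite nz.
pose x (i : index) := i.1.1.2; pose pi (i : index) := i.1.1.1.
pose u (i : index) := (dparse (dseq (dtl i.1.2)) [::]).1.
pose n (i : index) := (dparse (dseq (dtl i.1.2)) [::]).2.
pose s (i : index) := bits_of_data (enc_seq (behead (u i))).
pose mu i := pad (ro (size (x i))) (s i).
pose Q i := nv_query Vo (x i) (mu i); pose C i := nv_circuit Vo (x i) (mu i).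
pose y i : seq bool := map (pi i) (Q i); pose z i := f (C i) (y i).
pose R (i : index) := Cons (enc_bits (x i)) i.2.
pose NR i := Cons (enc_bits (n i)) (R i).
pose ry i : seq bool := catrev (y i) [::].
apply: (computes_seq0 (d1 := fun i => Cons (enc_seq (dseq (dtl i.1.2))) (Cons Nil (R i)))).
  by apply: computes_assign => // i _; rewrite dseqK.
apply: (computes_seq0 (d1 := fun i => Cons (enc_seq (u i)) (NR i))).
  by apply: (computes_reindex (parse_loopP k)
    (g := fun i => (bits_oracle (pi i), dseq (dtl i.1.2), [::], R i))).
apply: (computes_seq0 (d1 := fun i => Cons (enc_bits (x i))
   (Cons (enc_seq (behead (u i))) (NR i)))).
  by apply: computes_assign => // i _; rewrite /ev /=; case: (u i).
apply: (computes_seq0 (d1 := fun i => Cons (enc_verifier_output Vo (x i) (mu i)) (NR i))).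
  have [pm run] := Mo_ok.
  apply: (rep_callP (cs := fun i => uco (x i) (mu i)) _ _ k0 pm) => i _.
    exact: (run (x i) (mu i) (size_pad _ _)).2.
  (* The tape handed to [Mo] is the address as it stands; the blanks behind its end provide the
     padding, so that [ro] never has to be evaluated. *)
  apply: reads_prefix (reads_padded _ _).
  exact: (run (x i) (mu i) (size_pad _ _)).1.
apply: (computes_seq0 (d1 := fun i => Cons (enc_seq (map enc_num (Q i)))
  (Cons (enc_bits [::]) (Cons (enc_circuit (C i)) (NR i))))).
  exact: computes_assign.
apply: (computes_seql (d1 := fun i =>
   Cons Nil (Cons (enc_bits (ry i)) (Cons (enc_circuit (C i)) (NR i))))).
  apply: (computes_reindex (ask_loopP k0)
    (g := fun i => (pi i, Q i, [::], Cons (enc_circuit (C i)) (NR i)))) => // i _ /=.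
  by apply: leq_trans (leq_maxr _ _); apply: query_bound; apply: size_pad.
apply: (computes_seq0 (d1 := fun i => Cons (enc_bits (ry i)) (Cons Nil
   (Cons (enc_bits (ry i)) (Cons (enc_circuit (C i)) (NR i)))))).
  exact: computes_assign.
apply: (computes_seq0 (d1 := fun i => Cons Nil (Cons (enc_bits (y i))
   (Cons (enc_bits (ry i)) (Cons (enc_circuit (C i)) (NR i)))))).
  apply: (computes_reindex (rev_loopP k) (g := fun i => (bits_oracle (pi i),
    map enc_bool (ry i), [::], Cons (enc_bits (ry i)) (Cons (enc_circuit (C i)) (NR i))))) => // i _.
  by rewrite /= /ry !catrevE !cats0 -map_rev revK.
apply: (computes_seq0 (d1 := fun i => Cons (Cons (enc_circuit (C i)) (enc_bits (y i)))
   (Cons Nil (Cons (enc_bits (ry i)) (NR i))))).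
  exact: computes_assign.
apply: (computes_seq0 (d1 := fun i => Cons (enc_bits (z i)) (Cons (enc_bits (ry i)) (NR i)))).
  have [pm run] := Mf_ok.
  apply: (rep_callP (cs := fun=> [::]) _ _ k0 pm) => i _ //.
  by have [] := run (C i, y i) [::] erefl; case: (ucf _ _).
apply: (computes_seq0 (d1 := fun i => Cons (enc_bits (ry i)) (Cons (enc_bits (z i)) (NR i)))).
  exact: computes_assign.
apply: (computes_seq0 (d1 := fun i => Cons Nil (Cons (enc_bits (y i ++ z i)) (NR i)))).
  apply: (computes_reindex (rev_loopP k) (g := fun i => (bits_oracle (pi i),
    map enc_bool (ry i), map enc_bool (z i), NR i))) => // i _.
  by rewrite /= /ry !catrevE !cats0 -map_rev revK /enc_bits map_cat.
apply: (computes_seq0 (d1 := fun i => Cons (enc_bits (y i ++ z i)) (NR i))).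
  exact: computes_assign.
apply: (computes_seq0 (d1 := fun i =>
    Cons (enc_seq (drop (num_of_bits (n i)) (map enc_bool (y i ++ z i)))) (R i))).
  by apply: (computes_reindex (lookup_cmdP k)
    (g := fun i => (bits_oracle (pi i), map enc_bool (y i ++ z i), n i, R i))).
apply: computes_assign => // i [_ nz].
have -> : composed_proof (x i) (pi i) (num_of_bits (bits_of_data i.1.2)) =
    nth false (y i ++ z i) (num_of_bits (n i)).
  have bitsE : bits_of_data i.1.2 = true :: [seq e != Nil | e <- dseq (dtl i.1.2)].
    rewrite -bits_of_enc_seq dseqK.
    by case: i.1.2 nz => [|a d]; rewrite /ev //= => ->.
  rewrite /composed_proof /composed num_of_bitsK bitsE dparseE -/(u i) -/(n i).
  by rewrite /inner_string -bits_of_enc_seq.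
(* Beyond the end of the string both sides take their defaults, which agree: the head of [Nil] is
   [Nil], the encoding of [false]. *)
rewrite /ev /= -map_drop -[in RHS](addn0 (num_of_bits (n i))) -nth_drop.
by case: (drop _ _).
Qed.

End AnswerQueries.

(** * Simulating a malicious verifier *)

(** Two levels of nesting: the variables of [A] start at 1, and [k] lies beyond them, so that the
    calls made in answering leave them alone. *)
Definition simulate_query (Mo Mf : cmd) (k i : nat) (e : expr) : cmd :=
  Seq (Assign 0 (Econs e v0)) (Seq (answer_cmd Mo Mf k)
  (Seq (Assign (1 + i) (Ehd v0))
       (Assign 0 (Econs (Ehd (Etl v0)) (Econs (Ehd v0) (Etl (Etl v0))))))).

(* Runs [A] against the composed proof, and outputs the list of the answers that
   [A] got, last one first, below an irrelevant head. *)
Definition simulate (Mo Mf A : cmd) : cmd :=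
  Seq (Assign 0 (Econs v0 v0))
    (call 1 (fun i => Toss (1 + i)) (simulate_query Mo Mf (1 + maxn 1 (cvars A))) A
       (Econs (Ehd v0) Enil) (Etl v0)).

Section Simulate.
Variables (Vo : verifier (seq bool)) (f : circuit -> seq bool -> seq bool).
Variables (ro qo : nat -> nat) (Mo Mf : cmd) (po pf : nat -> nat).
Variable uco : seq bool -> seq bool -> seq bool.
Variable ucf : circuit * seq bool -> seq bool -> seq bool.
Hypothesis Mo_ok : runs_ppt enc_bits (@size bool) ro (enc_verifier_output Vo) Mo po uco.
Hypothesis Mf_ok : runs_ppt (fun Cy => Cons (enc_circuit Cy.1) (enc_bits Cy.2))
  (fun Cy => csize Cy.1 + size Cy.2) (fun=> 0) (fun Cy _ => enc_bits (f Cy.1 Cy.2))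
  Mf pf ucf.
Hypothesis query_bound : forall x mu, size mu = ro (size x) ->
  size (nv_query Vo x mu) <= qo (size x).
Variable A : cmd.

(** Tosses are passed on unchanged, so both runs have the same coins [cs]; together with the
    recorded answers they make up the view of [A]. *)
Lemma simulateP : exists2 p, poly_mono p & forall x (pi : proof boolean) cs ans t m',
  exec (bits_oracle (composed Vo f ro x pi)) A (upd (fun=> Nil) 0 (enc_bits x)) cs ans t m' ->
  exists a' t' M',
    [/\ exec (bits_oracle pi) (simulate Mo Mf A) (upd (fun=> Nil) 0 (enc_bits x)) cs a' t' M',
      t' <= p (t + dsize (enc_bits x)), size a' <= size ans * maxn 1 (qo (size x)) &
      dtl (M' 0) = enc_seq (map enc_bits (rev ans))].
Proof.
pose n := maxn 1 (cvars A).
have [pg pgm stg] := answer_cmdP Mo_ok Mf_ok query_bound (ltn0Sn n).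
pose w := ework (Ehd v0) + ework (Econs (Ehd (Etl v0)) (Econs (Ehd v0) (Etl (Etl v0)))).
pose B N := 30 * N + 30 + pg (10 * N + 10) + w * (10 * N + 20).
pose w1 := ework (Econs v0 v0); pose w2 := ework (Econs (Ehd v0) Enil).
pose w3 := ework (Etl v0).
exists (fun N => (w1 * N + 1) + (2 * n + 10 + 4 * N + w2 * (2 * N + 1) + N * B N + 6 * N
                  + 2 * w3 * (10 * N + 10))).
  have pgm' : poly_mono (fun N => pg (10 * N + 10)).
    by apply: poly_mono_comp => //; poly_mono_tac.
  by rewrite /B; poly_mono_tac.
move=> x pi cs ans t m' ex; set X := dsize (enc_bits x); set N := t + X.
(* An encoded one-bit answer has size at most 5, and a list cell adds 1. *)
have sz1 l : all (fun a : seq bool => size a == 1) l ->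
    dsize (enc_seq (map enc_bits l)) <= 6 * size l + 1.
  elim: l => //= a l IH /andP[sza /IH]; case: a sza => [|b [|]] //= _.
  by have := dsize_bool b; lia.
pose O := bits_oracle (composed Vo f ro x pi).
have [ls ansE lex] := exec_lexec ex.
pose St (s : data) (csr : seq bool) (ar : seq nat) := exists done,
  [/\ s = Cons (enc_bits x) (enc_seq (map enc_bits done)),
    catrev (map O ar) done = rev ans & all (fun a : seq bool => size a == 1) done].
have StS s csr ar : St s csr ar -> dsize s <= 7 * N + 2.
  move=> [done [-> /(congr1 size)]]; rewrite catrevE size_cat !size_rev => sz /sz1.
  by have := exec_size_answers ex; rewrite /N /= -/X; lia.
pose qm := maxn 1 (qo (size x)).
pose Out (cs1 : seq bool) (a1 : seq nat) cs2 (a2 : seq (seq bool)) :=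
  cs2 = cs1 /\ size a2 <= size a1 * qm.
pose M1 := upd (upd (fun=> Nil) 0 (enc_bits x)) 0 (Cons (enc_bits x) (enc_bits x)).
have ex1 : exec (bits_oracle pi) (Assign 0 (Econs v0 v0)) (upd (fun=> Nil) 0 (enc_bits x))
    [::] [::] (ecost (upd (fun=> Nil) 0 (enc_bits x)) (Econs v0 v0)).+1 M1.
  exact: exec_assign.
have [|||||||||M' [cs' [a' [t' [s [ex' le' [csE aE] sts [M'0 fr]]]]]]] :=
  @call_exec 1 (bits_oracle (composed Vo f ro x pi)) (bits_oracle pi)
    (fun i => Toss (1 + i)) (simulate_query Mo Mf (1 + n)) St Out A
    (Econs (Ehd v0) Enil) (Etl v0) (enc_bits x) (enc_bits x) cs ls t m' [::] [::]
    M1 (B N) (ltn0Sn _) _ _ _ _ _ lex _ _ _ _.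
- by rewrite /B; lia.
- by [].
- move=> cs1 a1 cs1' a1' cs2 a2 cs2' a2' [-> le1] [-> le2]; split=> //.
  by rewrite !size_cat mulnDl leq_add.
- move=> i b csr ar M lt_i [done [M0 cat_eq all1]].
  exists (upd M (1 + i) (enc_bool b)), [:: b], [::], 1; split=> //.
  + exact: exec_toss.
  + by rewrite /B; lia.
  + by exists done; rewrite /upd.
  + split=> [|j lt_j ne]; first by rewrite /upd eqxx.
    by rewrite /upd (negPf ne).
- move=> i e l csr ar M lt_i le_e lE stM; have szs := StS _ _ _ stM.
  have [done [M0 cat_eq all1]] := stM.
  set d := eval M e in lE; have [a aO] : exists a, a = O l by eexists.
  rewrite -/(O l) -aO; pose R := enc_seq (map enc_bits done).
  have sz_a : size a = 1 by rewrite aO.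
  have sz_d : dsize d <= t by apply: leq_trans (dsize_eval M e) le_e.
  pose M2 := upd M 0 (Cons d (M 0)).
  have exA : exec (bits_oracle pi) (Assign 0 (Econs e v0)) M [::] [::]
    (ecost M (Econs e v0)).+1 M2 by exact: exec_assign.
  have M20 : M2 0 = Cons d (Cons (enc_bits x) R) by rewrite /M2 /upd M0.
  have [M3 [a3 [t3 [ex3 le3 sz3 M30 fr3]]]] := stg (pi, x, d, R) I M2 M20.
  rewrite /= in M30 le3 sz3.
  have aE' : a = [:: composed Vo f ro x pi (num_of_bits (bits_of_data d))] by rewrite aO -lE.
  rewrite -aE' in M30.
  have [M4 [t4 [ex4 le4 M40 [M4k fr4]]]] := @assign_pair_exec 1 n (bits_oracle pi) i (Ehd v0)
    (Econs (Ehd (Etl v0)) (Econs (Ehd v0) (Etl (Etl v0)))) M3 (ltn0Sn _) lt_i isT isT.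
  rewrite M0 /= -/X -/R in szs.
  exists M4, [::], a3, ((ecost M (Econs e v0)).+1 + (t3 + t4)); split.
  + apply: (exec_seq (cs1 := [::]) (a1 := [::])) exA _.
    rewrite -[a3]cats0; apply: (exec_seq (cs1 := [::])) ex3 _; exact: ex4.
  + rewrite /B; have : t3 <= pg (10 * N + 10).
      by apply: leq_trans le3 _; apply: pgm.1; rewrite /= -/X; move: sz_d szs; rewrite /N; lia.
    have : t4 <= w * (10 * N + 20) + 2.
      apply: leq_trans le4 _; rewrite leq_add2r leq_mul // M30 /= -/X.
      by case: (a) sz_a szs => [|b [|]] //= _ szs; have := dsize_bool b; lia.
    by rewrite /= M0 /= -/X -/R -/d; move: le_e sz_d szs; rewrite /N; lia.
  + exists (a :: done); split=> //; first by rewrite M40 M30.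
      by rewrite aO.
    by rewrite /= sz_a all1.
  + by split=> //=; rewrite mul1n.
  + split=> [|j lt_j ne]; first by rewrite M4k M30.
    rewrite fr4 // fr3; last by lia.
    by rewrite /M2 /upd; case: eqP => // ?; lia.
- by [].
- by [].
- by [].
- by exists [::]; split=> //; rewrite cats0 catrevE cats0 -ansE.
have [done [sE cat_eq all1]] := sts; have szs := StS _ _ _ sts.
move: aE; rewrite -(size_map O) -ansE => aE.
exists a', ((ecost (upd (fun=> Nil) 0 (enc_bits x)) (Econs v0 v0)).+1 + t'), M'; split=> //.
- by rewrite -csE; apply: (exec_seq (cs1 := [::]) (a1 := [::])) ex1 ex'.
- apply: leq_add.
    rewrite addn1 ltnS; have := @ecost_ev (upd (fun=> Nil) 0 (enc_bits x)) (Econs v0 v0) isT.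
    move/leq_trans; apply; rewrite leq_mul // /upd /= -/X /N; lia.
  apply: leq_trans le' _; rewrite -/n [dsize (Cons _ _)]/= -/X -/w2 -/w3.
  have le_tN : t * B N <= N * B N by rewrite leq_mul2r leq_addr orbT.
  have le_w2 : w2 * (X + X).+1 <= w2 * (2 * N + 1) by rewrite leq_mul // /N; lia.
  have le_w3 : 2 * w3 * dsize s <= 2 * w3 * (10 * N + 10) by rewrite leq_mul //; lia.
  have szo := exec_dsize ex 0; rewrite /upd /= -/X in szo.
  move: le_tN le_w2 le_w3 szo; rewrite /N; lia.
- by rewrite M'0 sE /ev /= -cat_eq.
Qed.

End Simulate.


(** * Replaying a run from its view *)

(** Keys are stored reversed, as this is how [canon_loop] leaves them. *)
Definition enc_entry (e : nat * bool) : data :=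
  Cons (enc_bits (rev (bits_of_num e.1))) (enc_bool e.2).

Definition enc_table (T : seq (nat * bool)) : data := enc_seq (map enc_entry T).

Fixpoint find_from (T : seq (nat * bool)) (l : nat) : seq (nat * bool) :=
  if T is e :: T' then if e.1 == l then T else find_from T' l else [::].

(* A location asked again gets its former answer, whatever the answer tape [an]
   says: so every tape of answers comes from a proof. *)
Definition memo_next (an : data) (T : seq (nat * bool)) (l : nat) :
    bool * seq (nat * bool) :=
  if find_from T l is e :: _ then (e.2, T)
  else (dhd (dhd an) != Nil, (l, dhd (dhd an) != Nil) :: T).

(** Different trees may denote the same location, every tree but [Nil] counting as [true]; without
    normalization the table could miss a repeated query. *)
Definition canon_loop : cmd :=
  While (Ehd v0) (Assign 0
    (Econs (Etl (Ehd v0))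
       (Econs (Econs (ebool (Ehd (Ehd v0))) (Ehd (Etl v0))) (Etl (Etl v0))))).

Lemma canon_loopP k :
  computes (fun=> True) k (fun x : oracle * seq data * seq bool * data => x.1.1.1)
    canon_loop
    (fun x => Cons (enc_seq x.1.1.2) (Cons (enc_bits x.1.2) x.2))
    (fun=> [::]) (fun=> 0)
    (fun x => Cons Nil (Cons (enc_bits (catrev [seq d != Nil | d <- x.1.1.2] x.1.2)) x.2)).
Proof.
pose X := (oracle * seq data * seq bool * data)%type.
pose en (x : X) := Cons (enc_seq x.1.1.2) (Cons (enc_bits x.1.2) x.2).
pose f (x : X) : X := (x.1.1.1, behead x.1.1.2, (head Nil x.1.1.2 != Nil) :: x.1.2, x.2).
pose g (x : X) : X :=
  (x.1.1.1, [::], catrev [seq d != Nil | d <- x.1.1.2] x.1.2, x.2).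
apply: computes_eq (computes_while (f := f) (g := g)
  (w := fun x => dsize (en x) + 4 * size x.1.1.2)
  (mu := fun x => size x.1.1.2) (en := en) (q := 0) _
  (P := fun n => n + 4 * n) _ _ _ _ _)
  _ _ _ _ => //.
- by poly_mono_tac.
- move=> [[[O [|a l]] m] R] _ //= _; split=> //=; rewrite -/(enc_bits m).
  by have := dsize_bool (a != Nil); lia.
- by move=> [[[O [|a l]] m] R].
- move=> [[[O l] m] R] _; split=> //=; have := leq_size_enc_seq l; lia.
- apply: computes_assign => // -[[[O [|a l]] m] R] [_] // _.
  by rewrite /ev /=; case: a.
- by move=> i; rewrite muln0.
Qed.

Definition find_loop : cmd :=
  While (Eeq (Econs (ebool (Ehd v0)) (Eeq (Ehd (Ehd (Ehd v0))) (Ehd (Etl v0))))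
             (Econs etrue Enil))
    (Assign 0 (Econs (Etl (Ehd v0)) (Etl v0))).

Lemma find_loopP k :
  computes (fun=> True) k (fun x : oracle * seq (nat * bool) * nat * data => x.1.1.1)
    find_loop
    (fun x => Cons (enc_table x.1.1.2) (Cons (enc_bits (rev (bits_of_num x.1.2))) x.2))
    (fun=> [::]) (fun=> 0)
    (fun x => Cons (enc_table (find_from x.1.1.2 x.1.2))
       (Cons (enc_bits (rev (bits_of_num x.1.2))) x.2)).
Proof.
pose X := (oracle * seq (nat * bool) * nat * data)%type.
pose en (x : X) := Cons (enc_table x.1.1.2) (Cons (enc_bits (rev (bits_of_num x.1.2))) x.2).
pose f (x : X) : X := (x.1.1.1, behead x.1.1.2, x.1.2, x.2).
pose g (x : X) : X := (x.1.1.1, find_from x.1.1.2 x.1.2, x.1.2, x.2).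
have test O T l R : (ev (en (O, T, l, R))
    (Eeq (Econs (ebool (Ehd v0)) (Eeq (Ehd (Ehd (Ehd v0))) (Ehd (Etl v0))))
         (Econs etrue Enil)) != Nil) = (if T is e :: _ then e.1 != l else false).
  rewrite /ev /en /= enc_bool_neq0; case: T => [|[l' b] T] /=.
    by rewrite !eqE /=.
  have -> : (enc_bits (rev (bits_of_num l')) == enc_bits (rev (bits_of_num l))) = (l' == l).
    apply/eqP/eqP => [/enc_bits_inj/(congr1 rev)|-> //].
    by rewrite !revK => /(congr1 num_of_bits); rewrite !bits_of_numK.
  by case: (l' == l).
apply: computes_eq (computes_while (f := f) (g := g) (w := dsize \o en)
  (mu := fun x => size x.1.1.2) (en := en) (q := 0) _ poly_mono_id _ _ _ _)
  _ _ _ _ => //.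
- move=> [[[O T] l] R] _; rewrite test; case: T => // e T _; split=> //.
  by rewrite /f /en /enc_table /=; lia.
- move=> [[[O T] l] R] _; rewrite test; case: T => // e T.
  by rewrite /g /f /=; case: (e.1 == l).
- move=> [[[O T] l] R] _; split=> //=.
  by have := leq_size_enc_seq (map enc_entry T); rewrite size_map /enc_table; lia.
- by apply: computes_assign => // -[[[O T] l] R] []; rewrite test; case: T.
- by move=> i; rewrite muln0.
Qed.

Section MemoCmd.
(* The state (key, ((tape, (answers, table)), rest)), below the found entries. *)
Let S := Etl (Etl v0).
Let tape := Ehd (Ehd S).
Let answers := Ehd (Etl (Ehd S)).
Let table := Etl (Etl (Ehd S)).

Definition memo_cmd : cmd :=
  Seq (Assign 0 (Econs (Ehd v0) (Econs Enil (Etl v0))))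
  (Seq canon_loop
  (Seq (Assign 0 (Econs table (Etl v0)))
  (Seq find_loop
  (If (Ehd v0)
     (Assign 0 (Econs (Econs (Etl (Ehd (Ehd v0))) Enil)
        (Econs (Econs tape (Econs (Etl answers) table)) (Etl S))))
     (Assign 0 (Econs (Econs (ebool (Ehd (Ehd answers))) Enil)
        (Econs (Econs tape (Econs (Etl answers)
           (Econs (Econs (Ehd (Etl v0)) (ebool (Ehd (Ehd answers)))) table))) (Etl S)))))))).
End MemoCmd.

Record memo_state := MemoState {
  ms_oracle : oracle;
  ms_query : data;
  ms_tape : data;
  ms_answers : data;
  ms_table : seq (nat * bool);
  ms_rest : data
}.

Definition ms_loc (i : memo_state) : nat := num_of_bits (bits_of_data (ms_query i)).

Lemma memo_cmdP k :
  computes (fun=> True) k ms_oracle memo_cmd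
    (fun i => Cons (ms_query i)
       (Cons (Cons (ms_tape i) (Cons (ms_answers i) (enc_table (ms_table i)))) (ms_rest i)))
    (fun=> [::]) (fun=> 0)
    (fun i => let r := memo_next (ms_answers i) (ms_table i) (ms_loc i) in
       Cons (enc_bits [:: r.1])
         (Cons (Cons (ms_tape i) (Cons (dtl (ms_answers i)) (enc_table r.2))) (ms_rest i))).
Proof.
pose S i := Cons (Cons (ms_tape i) (Cons (ms_answers i) (enc_table (ms_table i)))) (ms_rest i).
pose key i := enc_bits (rev (bits_of_num (ms_loc i))).
apply: (computes_seq0 (d1 := fun i => Cons (enc_seq (dseq (ms_query i))) (Cons Nil (S i)))).
  by apply: computes_assign => // i _; rewrite dseqK.
apply: (computes_seq0 (d1 := fun i => Cons Nil (Cons (key i) (S i)))).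
  apply: (computes_reindex (canon_loopP k)
    (g := fun i => (ms_oracle i, dseq (ms_query i), [::], S i))) => // i _ /=.
  by rewrite /key /ms_loc num_of_bitsK catrevE cats0 -bits_of_enc_seq dseqK.
apply: (computes_seq0 (d1 := fun i => Cons (enc_table (ms_table i)) (Cons (key i) (S i)))).
  exact: computes_assign.
apply: (computes_seq0 (d1 := fun i => Cons (enc_table (find_from (ms_table i) (ms_loc i)))
    (Cons (key i) (S i)))).
  by apply: (computes_reindex (find_loopP k)
    (g := fun i => (ms_oracle i, ms_table i, ms_loc i, S i))).
apply: computes_if => //; apply: computes_assign => // i [_]; rewrite /memo_next;
  case: (find_from _ _) => //= _.
rewrite /ev /= -/(dhd (ms_answers i)) -/(dhd (dhd (ms_answers i))).
by case: (dhd (dhd _) == Nil).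
Qed.

(** Certifies that a replay is a run against the proof [pi], so that the time and query bounds,
    which hold for all proofs, apply to it. *)
Fixpoint memo_compatible (pi : proof boolean) (an : data) (T : seq (nat * bool))
    (ls : seq nat) : Prop :=
  if ls is l :: ls' then
    (memo_next an T l).1 = pi l /\ memo_compatible pi (dtl an) (memo_next an T l).2 ls'
  else True.

Definition memo_toss (k i : nat) : cmd :=
  Seq (Assign (k + i) (ebool (Ehd (Ehd (Ehd v0)))))
      (Assign 0 (Econs (Econs (Etl (Ehd (Ehd v0))) (Etl (Ehd v0))) (Etl v0))).

Definition memo_query (k i : nat) (e : expr) : cmd :=
  Seq (Assign 0 (Econs e v0)) (Seq memo_cmd
  (Seq (Assign (k + i) (Ehd v0)) (Assign 0 (Etl v0)))).

Definition memo_setup : expr :=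
  Econs (Econs (Ehd (Ehd (Etl v0))) (Econs (Etl (Ehd (Etl v0))) Enil)) (Etl (Etl v0)).

(* Takes the coins and the answers from two tapes. *)
Definition memo_call (k : nat) (c : cmd) : cmd :=
  call k (memo_toss k) (memo_query k) c memo_setup (Etl v0).

(** The proof [pi] appears only in the hypothesis: the program imitates the run against it without
    access to it, as the tape and the table give the same answers. *)
Lemma memo_callP (I : Type) (D : I -> Prop) k O c (inp tp an rest out : I -> data) p :
  0 < k -> poly_mono p ->
  (forall i, D i -> exists (pi : proof boolean) cs ls t m',
     [/\ lexec (bits_oracle pi) c (upd (fun=> Nil) 0 (inp i)) cs ls t m',
       m' 0 = out i, t <= p (dsize (inp i)), reads (tp i) cs &
       memo_compatible pi (an i) [::] ls]) ->
  computes D k O (memo_call k c)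
    (fun i => Cons (inp i) (Cons (Cons (tp i) (an i)) (rest i)))
    (fun=> [::]) (fun=> 0) (fun i => Cons (out i) (rest i)).
Proof.
move=> k0 pm run; pose n := maxn 1 (cvars c).
have [pg pgm stg] := memo_cmdP (k + n).
pose et := ebool (Ehd (Ehd (Ehd v0))).
pose et' := Econs (Econs (Etl (Ehd (Ehd v0))) (Etl (Ehd v0))) (Etl v0).
pose w := ework et + ework et' + ework (Ehd v0) + ework (Etl v0).
(* The table gets at most [p N] entries, with keys of length at most [p N], because evaluating a
   location costs at least its size. *)
pose S N := N + p N * (4 * p N + 10) + 10.
pose B N := 2 * p N + 2 * S N + 10 + pg (p N + S N + 10) + w * (S N + 10) + 2.
exists (fun N => 2 * n + 10 + 2 * N + ework memo_setup * N + p N * B N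
                 + 2 * (N + 3 * p N) + 2 * ework (Etl v0) * S N).
  have pgm' : poly_mono (fun N => pg (p N + S N + 10)).
    by apply: poly_mono_comp => //; rewrite /S; poly_mono_tac.
  by rewrite /B /S; poly_mono_tac.
move=> i Di M M0; have [pi [cs [ls [t [m' [lex m'0 le_t rtp comp]]]]]] := run i Di.
have ex := lexec_exec lex.
set N := dsize _.
have NE : N = (dsize (inp i) + ((dsize (tp i) + dsize (an i)).+1 + dsize (rest i)).+1).+1.
  by [].
clearbody N.
have le_pN : t <= p N by apply: leq_trans le_t _; apply: pm.1; rewrite NE; lia.
have sz_table T : all (fun e : nat * bool => size (bits_of_num e.1) <= t) T ->
    size T <= t -> dsize (enc_table T) <= p N * (4 * p N + 10) + 1.
  move=> allT szT; apply: (@leq_trans (size T * (4 * t + 10) + 1)); last first.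
    by rewrite leq_add2r leq_mul //; lia.
  elim: T allT {szT} => //= -[l b] T IH /andP[/= sz_l /IH]; rewrite /enc_table /=.
  have := dsize_enc_bits (rev (bits_of_num l)); have := dsize_bool b.
  by rewrite size_rev; move: (dsize _) => z; lia.
pose St (s : data) (csr : seq bool) (lr : seq nat) := exists tp1 an1 T1,
  [/\ s = Cons (Cons tp1 (Cons an1 (enc_table T1))) (rest i), reads tp1 csr,
    memo_compatible pi an1 T1 lr, dsize tp1 + dsize an1 + dsize (rest i) + 2 <= N &
    size T1 + size lr <= t /\ all (fun e => size (bits_of_num e.1) <= t) T1].
have StS s csr lr : St s csr lr -> dsize s <= S N.
  move=> [tp1 [an1 [T1 [-> _ _ sz1 [sz2 allT]]]]].
  have := sz_table T1 allT (leq_trans (leq_addr _ _) sz2).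
  rewrite /S /=; lia.
pose Out (cs1 : seq bool) (a1 : seq nat) (cs2 : seq bool) (a2 : seq (seq bool)) :=
  cs2 = [::] /\ a2 = [::].
have nk j : (0 == k + j) = false by lia.
have [||||||||M' [cs' [a' [t' [s [ex' le' [csE aE] sts [M'0 fr]]]]]]] :=
  @call_exec k (bits_oracle pi) (O i) (memo_toss k) (memo_query k) St Out c memo_setup (Etl v0)
    (inp i) (Cons (Cons (tp i) (an i)) (rest i)) cs ls t m' [::] [::] M (B N)
    k0 _ _ _ _ _ lex _ _ M0 _.
- by rewrite /B !addnS.
- by [].
- by move=> cs1 a1 cs1' a1' cs2 a2 cs2' a2' [-> ->] [-> ->].
- move=> j b csr lr M1 lt_j stM; have szs := StS _ _ _ stM.
  have [tp1 [an1 [T1 [M10 /= [rb rtp1] comp1 sz1 sz2]]]] := stM.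
  have [M2 [t2 [ex2 le2 M20 [M2k fr2]]]] :=
    @assign_pair_exec k n (O i) j et et' M1 k0 lt_j isT isT.
  exists M2, [::], [::], t2; split=> //.
  + apply: leq_trans le2 _.
    have : (ework et + ework et') * dsize (M1 0) <= w * (S N + 10).
      by apply: leq_mul; rewrite /w; lia.
    rewrite /B; lia.
  + rewrite M20 M10; exists (dtl tp1), an1, T1; split=> //.
    by have := dsize_tl tp1; lia.
  + split=> //; rewrite M2k M10 /et /ev /= -rb -/(dhd tp1).
    by case: (dhd tp1 == Nil).
- move=> j e l csr lr M1 lt_j le_e lE stM; have szs := StS _ _ _ stM.
  have [tp1 [an1 [T1 [M10 rtp1 /= [rb comp1] sz1 [sz2 allT]]]]] := stM.
  set d := eval M1 e in lE.
  have sz_d : dsize d <= t by apply: leq_trans (dsize_eval M1 e) le_e.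
  pose M2 := upd M1 0 (Cons d (M1 0)).
  have exA : exec (O i) (Assign 0 (Econs e v0)) M1 [::] [::]
    (ecost M1 (Econs e v0)).+1 M2 by exact: exec_assign.
  have M20 : M2 0 = Cons d (Cons (Cons tp1 (Cons an1 (enc_table T1))) (rest i)).
    by rewrite /M2 /upd M10.
  have [M3 [a3 [t3 [ex3 le3 sz3 M30 fr3]]]] :=
    stg (MemoState (O i) d tp1 an1 T1 (rest i)) Logic.I M2 M20.
  rewrite /= /ms_loc /= -lE rb leqn0 in M30 le3 sz3.
  have [M4 [t4 [ex4 le4 M40 [M4k fr4]]]] := @assign_pair_exec k n (O i) j (Ehd v0)
    (Etl v0) M3 k0 lt_j isT isT.
  pose T2 := (memo_next an1 T1 l).2.
  have sz_l : size (bits_of_num l) <= t.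
    rewrite lE num_of_bitsK; apply: leq_trans sz_d.
    by elim: (d) => //= ? _ ? ?; lia.
  have StM4 : St (M4 0) csr lr.
    exists tp1, (dtl an1), T2; split=> //.
    + by rewrite M40 M30.
    + by have := dsize_tl an1; lia.
    + rewrite /T2 /memo_next; case: (find_from T1 l) => [|_ _] /=; last by split=> //; lia.
      by rewrite sz_l allT; split=> //; lia.
  have M30E : M3 0 = Cons (enc_bits [:: pi l]) (M4 0) by rewrite M40 M30.
  exists M4, [::], a3, ((ecost M1 (Econs e v0)).+1 + (t3 + t4)); split=> //.
  + apply: (exec_seq (cs1 := [::]) (a1 := [::])) exA _.
    rewrite -[a3]cats0; apply: (exec_seq (cs1 := [::])) ex3 _; exact: ex4.
  + have : t3 <= pg (p N + S N + 10).
      by apply: leq_trans le3 _; apply: pgm.1; move: szs; rewrite M10 /=; lia.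
    have : t4 <= w * (S N + 10) + 2.
      apply: leq_trans le4 _; rewrite leq_add2r; apply: leq_mul; first by rewrite /w; lia.
      rewrite M30E; have := StS _ _ _ StM4; have := dsize_bool (pi l) => /=; lia.
    have cost_v0 : ecost M1 v0 = dsize (M1 0) by rewrite /= addn0.
    have ed : dsize (eval M1 (Econs e v0)) = (dsize d + dsize (M1 0)).+1 by [].
    rewrite -[ecost M1 (Econs e v0)]/(dsize (eval M1 (Econs e v0)) +
      (ecost M1 e + ecost M1 v0)) ed cost_v0 /B; lia.
  + by split=> //; case: (a3) sz3.
  + split=> [|j' lt_j' ne]; first by rewrite M4k M30E.
    rewrite fr4 // fr3 //.
    by rewrite /M2 /upd; case: eqP => // ?; lia.
- by [].
- by [].
- rewrite !cats0; exists (tp i), (an i), [::]; split=> //; first by rewrite NE; lia.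
  by split=> //=; rewrite add0n; have := exec_size_answers ex; rewrite size_map.
exists M', a', t'; rewrite -csE; split=> //.
- apply: leq_trans le' _; rewrite -/n.
  have := exec_dsize ex 0; rewrite m'0 /upd /= => szo.
  have : t * B N <= p N * B N by rewrite leq_mul2r le_pN orbT.
  have szs := StS _ _ _ sts.
  have : 2 * ework (Etl v0) * dsize s <= 2 * ework (Etl v0) * S N by rewrite leq_mul.
  rewrite /= in NE; rewrite -NE; lia.
- by rewrite aE.
- by rewrite M'0 m'0; case: sts => ? [? [? [-> _ _ _ _]]].
Qed.

(** * The composed verifier *)

(* Location, in the composed proof, of the location [n] of the inner oracle. *)
Definition locate (Q : seq nat) (cs : seq bool) (n : nat) : nat :=
  if n < size Q then outer_loc (nth 0 Q n) else inner_loc cs n.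

(** A single lookup serves twice: its result is nonempty exactly when the index lies within the
    outer queries, and then its head is the outer location wanted. *)
Definition translate_body : cmd :=
  Seq (Assign 0 (Econs (Etl (Etl (Etl (Etl v0)))) (Econs (Ehd (Ehd v0)) v0)))
  (Seq lookup_cmd
  (Seq (If (Ehd v0)
         (Assign 0 (Econs (Econs Enil (Ehd (Ehd v0))) (Etl v0)))
         (Seq (Assign 0 (Econs (Ehd (Ehd (Etl v0)))
                 (Econs (Econs Enil (Ehd (Etl (Etl (Etl (Etl v0)))))) (Etl v0))))
         (Seq mark_loop
              (Assign 0 (Econs (Econs etrue (Ehd (Etl v0))) (Etl (Etl v0)))))))
       (Assign 0 (Econs (Etl (Ehd (Etl v0)))
          (Econs (Econs (Ehd v0) (Ehd (Etl (Etl v0)))) (Etl (Etl (Etl v0)))))))).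

Definition translation : Type := (oracle * seq nat * seq nat * (data * seq bool * seq nat))%type.

Definition enc_translation (i : translation) : data :=
  Cons (enc_seq (map enc_num i.1.1.2)) (Cons (enc_seq (map enc_num i.1.2))
    (Cons i.2.1.1 (Cons (enc_bits i.2.1.2) (enc_seq (map enc_num i.2.2))))).

Definition translate_next (i : translation) : translation :=
  (i.1.1.1, behead i.1.1.2, locate i.2.2 i.2.1.2 (head 0 i.1.1.2) :: i.1.2, i.2).

Lemma translate_bodyP k :
  computes (fun i : translation => i.1.1.2 != [::]) k (fun i => i.1.1.1) translate_body
    enc_translation (fun=> [::]) (fun=> 0) (enc_translation \o translate_next).
Proof.
pose n (i : translation) := head 0 i.1.1.2.
pose Q (i : translation) := i.2.2; pose cs (i : translation) := i.2.1.2.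
apply: (computes_seq0 (d1 := fun i => Cons (enc_seq (map enc_num (Q i)))
    (Cons (enc_bits (bits_of_num (n i))) (enc_translation i)))).
  by apply: computes_assign => // -[[[O [|a l]] m] R].
apply: (computes_seq0 (d1 := fun i => Cons (enc_seq (drop (n i) (map enc_num (Q i))))
    (enc_translation i))).
  apply: (computes_reindex (lookup_cmdP k) (g := fun i =>
    (i.1.1.1, map enc_num (Q i), bits_of_num (n i), enc_translation i))) => // i _ /=.
  by rewrite bits_of_numK.
have test i : (ev (Cons (enc_seq (drop (n i) (map enc_num (Q i)))) (enc_translation i))
    (Ehd v0) != Nil) = (n i < size (Q i)).
  rewrite -(size_map enc_num) -subn_gt0 -size_drop /ev /=.
  by case: (drop _ _).
apply: (computes_seq0 (d1 := fun i => Cons (enc_num (locate (Q i) (cs i) (n i)))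
    (enc_translation i))); last first.
  by apply: computes_assign => // -[[[O [|a l]] m] R].
apply: computes_if => //.
  apply: computes_assign => // i [_]; rewrite test => lt_n.
  rewrite /locate lt_n enc_num_of_bits /ev /= -map_drop (drop_nth 0) //.
apply: (computes_seq0 (d1 := fun i => Cons (enc_bits (bits_of_num (n i)))
    (Cons (enc_bits (false :: cs i)) (enc_translation i)))).
  by apply: computes_assign => // -[[[O [|a l]] m] R] [].
apply: (computes_seq0 (d1 := fun i => Cons Nil
    (Cons (enc_bits (locenc (bits_of_num (n i)) (false :: cs i))) (enc_translation i)))).
  by apply: (computes_reindex (mark_loopP k) (g := fun i =>
    (i.1.1.1, bits_of_num (n i), false :: cs i, enc_translation i))).
apply: computes_assign => // i [_ /eqP/negPn]; rewrite test => nlt.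
by rewrite /locate (negPf nlt) enc_num_of_bits.
Qed.

Lemma size_locenc nb acc : size (locenc nb acc) = (size nb).*2 + size acc.
Proof. by elim: nb acc => //= b nb IH acc; rewrite IH /= doubleS; lia. Qed.

(** The 8 arises from a marker for each digit of the index, each of the two bits having encoded size
    at most 4. *)
Lemma dsize_locate Q cs n : dsize (enc_num (locate Q cs n)) <=
  8 * dsize (enc_num n) + 4 * dsize (enc_bits cs) + dsize (enc_seq (map enc_num Q)) + 10.
Proof.
rewrite /locate; case: ltnP => [lt_n|_]; rewrite enc_num_of_bits.
  have : dsize (enc_num (nth 0 Q n)) <= dsize (enc_seq (map enc_num Q)).
    elim: Q n lt_n => //= a Q IH [|n] /= lt_n; first by lia.
    by have := IH n lt_n; lia.
  rewrite /= -/(enc_bits _) -/(enc_num _); lia.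
have /andP[_] := dsize_enc_bits (true :: locenc (bits_of_num n) (false :: cs)).
move=> /leq_trans; apply; rewrite /= size_locenc /=.
have /andP[+ _] := dsize_enc_bits (bits_of_num n); rewrite -/(enc_num n).
by have /andP[+ _] := dsize_enc_bits cs; lia.
Qed.

Lemma sumn_dsize (T : Type) (h : T -> data) c l :
  sumn [seq 8 * dsize (h x) + c | x <- l] <= 8 * dsize (enc_seq (map h l)) + c * size l.
Proof. by elim: l => //= x l IH; rewrite mulnS; lia. Qed.

Definition translate_loop : cmd := While (Ehd v0) translate_body.

Lemma translate_loopP k :
  computes (fun=> True) k (fun i : translation => i.1.1.1) translate_loop
    enc_translation (fun=> [::]) (fun=> 0)
    (fun i => enc_translation
       (i.1.1.1, [::], catrev (map (locate i.2.2 i.2.1.2) i.1.1.2) i.1.2, i.2)).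
Proof.
pose g (i : translation) : translation :=
  (i.1.1.1, [::], catrev (map (locate i.2.2 i.2.1.2) i.1.1.2) i.1.2, i.2).
(* A translated location may be larger than its source, so the potential prays in advance for all
   entries still to be translated. *)
pose c (i : translation) :=
  4 * dsize (enc_bits i.2.1.2) + dsize (enc_seq (map enc_num i.2.2)) + 20.
pose cost (i : translation) n := 8 * dsize (enc_num n) + c i.
apply: computes_eq (computes_while (f := translate_next) (g := g)
  (w := fun i => dsize (enc_translation i) + sumn (map (cost i) i.1.1.2))
  (mu := fun i => size i.1.1.2) (en := enc_translation) (q := 0) _
  (P := fun n => n + (8 * n + 25 * n * n)) _ _ _ _ _)
  _ _ _ _ => //.
- by poly_mono_tac.
- move=> [[[O [|a l]] m] [[Ci cs] Q]] _ //= _; split=> //.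
  have := dsize_locate Q cs a; rewrite /enc_translation /cost /c /=.
  by move: (dsize (enc_num (locate _ _ _))) (dsize (enc_num a)) => d1 d2; lia.
- by move=> [[[O [|a l]] m] R].
- move=> [[[O l] m] [[Ci cs] Q]] _; split=> /=; first by rewrite leq_addr.
    by have := leq_size_enc_seq (map enc_num l); rewrite size_map; lia.
  have := sumn_dsize enc_num (c (O, l, m, (Ci, cs, Q))) l; rewrite -/(cost _) /c /=.
  have := leq_size_enc_seq (map enc_num l); rewrite size_map.
  have := dsize_gt0 (enc_bits cs).
  rewrite -/(cost _); move: (sumn _) (dsize (enc_bits cs)) (dsize (enc_seq (map enc_num Q)))
    (dsize (enc_seq (map enc_num l))) (dsize (enc_seq (map enc_num m))) (dsize Ci) (size l).
  move=> S b q L M C s c0 sL leS.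
  have : (4 * b + q + 20) * s <= 25 * (L + (M + (C + (b + q).+1).+1).+1).+1
      * (L + (M + (C + (b + q).+1).+1).+1).+1 by apply: leq_mul; lia.
  lia.
- apply: (computes_reindex (translate_bodyP k) (g := id)) => // -[[[O [|a l]] m] R] [] //.
- by move=> i; rewrite muln0.
Qed.

Definition composed_verifier_cmd (Mo Mi : cmd) : cmd :=
  (* (x, nil) *)
  Seq (Assign 0 (Econs v0 Enil)) (Seq (rec_call 1 Mo)
  (* (rev cs, (nil, (Q, C))) *)
  (Seq (Assign 0 (Econs (Ehd (Etl v0)) (Econs Enil (Ehd v0)))) (Seq rev_loop
  (* (C, (cs, Q)) *)
  (Seq (Assign 0 (Econs (Etl (Etl (Etl v0)))
         (Econs (Ehd (Etl v0)) (Ehd (Etl (Etl v0)))))) (Seq (rec_call 1 Mi)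
  (* (Qi, (nil, (Ci, (cs, Q)))) *)
  (Seq (Assign 0 (Econs (Ehd (Ehd v0))
         (Econs Enil (Econs (Etl (Ehd v0)) (Etl (Etl (Etl v0))))))) (Seq rev_loop
  (Seq (Assign 0 (Econs (Ehd (Etl v0)) (Econs Enil (Etl (Etl v0)))))
  (Seq translate_loop
       (Assign 0 (Econs (Ehd (Etl v0)) (Ehd (Etl (Etl v0)))))))))))))).

Section ComposedVerifier.
Variables (Vo : verifier (seq bool)) (Vi : verifier circuit).
Variables (ro ri : nat -> nat) (Mo Mi : cmd) (po pi : nat -> nat).
Variable uco : seq bool -> seq bool -> seq bool.
Variable uci : circuit -> seq bool -> seq bool.
Hypothesis Mo_ok : runs_ppt enc_bits (@size bool) ro (enc_verifier_output Vo) Mo po uco.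
Hypothesis Mi_ok : runs_ppt enc_circuit csize ri (enc_verifier_output Vi) Mi pi uci.

(* The inner coins start where the outer verifier stops reading, since [ro] need
   not be computable. *)
Definition inner_tape (x : seq bool) (mu : seq bool) : seq bool :=
  let mo := take (ro (size x)) mu in
  take (ri (csize (nv_circuit Vo x mo))) (drop (size (uco x mo)) mu).

Definition composed_verifier : verifier (seq bool) := Verifier
  (fun x mu => let mo := take (ro (size x)) mu in
     map (locate (nv_query Vo x mo) (uco x mo))
       (nv_query Vi (nv_circuit Vo x mo) (inner_tape x mu)))
  (fun x mu => nv_circuit Vi (nv_circuit Vo x (take (ro (size x)) mu)) (inner_tape x mu)).

Lemma composed_verifier_cmdP :
  computes (fun i : seq bool * seq bool => [/\ ro (size i.1) <= size i.2 &
      size (inner_tape i.1 i.2) = ri (csize (nv_circuit Vo i.1 (take (ro (size i.1)) i.2)))])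
    1 (fun=> no_oracle) (composed_verifier_cmd Mo Mi) (fun i => enc_bits i.1)
    (fun i => let mo := take (ro (size i.1)) i.2 in
       uco i.1 mo ++ uci (nv_circuit Vo i.1 mo) (inner_tape i.1 i.2))
    (fun=> 0) (fun i => enc_verifier_output composed_verifier i.1 i.2).
Proof.
pose mo (i : seq bool * seq bool) := take (ro (size i.1)) i.2.
pose Q i := nv_query Vo i.1 (mo i); pose C i := nv_circuit Vo i.1 (mo i).
pose cs i := uco i.1 (mo i); pose mi i := inner_tape i.1 i.2.
pose Qi i := nv_query Vi (C i) (mi i); pose Ci i := enc_circuit (nv_circuit Vi (C i) (mi i)).
pose R i := Cons (enc_bits (cs i)) (enc_seq (map enc_num (Q i))).
apply: (computes_seq0 (d1 := fun i => Cons (enc_bits i.1) Nil)).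
  exact: computes_assign.
apply: computes_eq (computes_seq (cs1 := cs) (q1 := fun=> 0) (q2 := fun=> 0)
  (cs2 := fun i => uci (C i) (mi i))
  (d1 := fun i => Cons (enc_verifier_output Vo i.1 (mo i))
    (Cons (enc_bits (rev (cs i))) (Cons (enc_bits i.1) Nil))) _ _) _ _ _ _ => //.
  have [pm run] := Mo_ok; apply: (rec_callP _ _ _ pm) => // i [le_o _].
  have [_ [a [t [m' [ex m'0 le_t]]]]] := run i.1 (mo i) (size_takel le_o).
  by exists a, t, m'.
apply: (computes_seq0 (d1 := fun i => Cons (enc_bits (rev (cs i)))
    (Cons Nil (enc_verifier_output Vo i.1 (mo i))))).
  exact: computes_assign.
apply: (computes_seq0 (d1 := fun i => Cons Nil
    (Cons (enc_bits (cs i)) (enc_verifier_output Vo i.1 (mo i))))).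
  apply: (computes_reindex (rev_loopP 1) (g := fun i => (no_oracle,
    map enc_bool (rev (cs i)), [::], enc_verifier_output Vo i.1 (mo i)))) => // i _.
  by rewrite /= catrevE cats0 -map_rev revK.
apply: (computes_seq0 (d1 := fun i => Cons (enc_circuit (C i)) (R i))).
  exact: computes_assign.
apply: (computes_seql (d1 := fun i => Cons (enc_verifier_output Vi (C i) (mi i))
    (Cons (enc_bits (rev (uci (C i) (mi i)))) (Cons (enc_circuit (C i)) (R i))))).
  have [pm run] := Mi_ok; apply: (rec_callP _ _ _ pm) => // i [_ szi].
  have [_ [a [t [m' [ex m'0 le_t]]]]] := run (C i) (mi i) szi.
  by exists a, t, m'.
apply: (computes_seq0 (d1 := fun i => Cons (enc_seq (map enc_num (Qi i)))
    (Cons Nil (Cons (Ci i) (R i))))).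
  exact: computes_assign.
apply: (computes_seq0 (d1 := fun i => Cons Nil
    (Cons (enc_seq (map enc_num (rev (Qi i)))) (Cons (Ci i) (R i))))).
  apply: (computes_reindex (rev_loopP 1) (g := fun i => (no_oracle,
    map enc_num (Qi i), [::], Cons (Ci i) (R i)))) => // i _.
  by rewrite /= catrevE cats0 map_rev.
apply: (computes_seq0 (d1 := fun i => Cons (enc_seq (map enc_num (rev (Qi i))))
    (Cons Nil (Cons (Ci i) (R i))))).
  exact: computes_assign.
apply: (computes_seq0 (d1 := fun i => Cons Nil
    (Cons (enc_seq (map enc_num (map (locate (Q i) (cs i)) (Qi i)))) (Cons (Ci i) (R i))))).
  apply: (computes_reindex (translate_loopP 1) (g := fun i => (no_oracle,
    rev (Qi i), [::], (Ci i, cs i, Q i)))) => // i _.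
  by rewrite /enc_translation /= catrevE cats0 -map_rev revK.
exact: computes_assign.
Qed.

Lemma composed_verifier_ppt (r : nat -> nat) :
  (forall x mu, size mu = r (size x) -> ro (size x) <= size mu /\
    size (inner_tape x mu) = ri (csize (nv_circuit Vo x (take (ro (size x)) mu)))) ->
  ppt enc_bits (@size bool) r (enc_verifier_output composed_verifier).
Proof.
move=> sz; have [p pm st] := composed_verifier_cmdP.
exists (composed_verifier_cmd Mo Mi), (fun n => p (4 * n + 1)); split.
  suff: poly_mono (fun n => p (4 * n + 1)) by case.
  by apply: poly_mono_comp => //; poly_mono_tac.
move=> x mu szmu; have [le_o szi] := sz x mu szmu; set mo := take _ mu in szi.
have [m' [a [t [ex le_t _ m'0 _]]]] := st (x, mu) (conj le_o szi)
  (upd (fun=> Nil) 0 (enc_bits x)) erefl.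
exists (uco x mo ++ uci (nv_circuit Vo x mo) (inner_tape x mu)), a, t; split; last first.
  apply: leq_trans le_t _; apply: pm.1.
  by case/andP: (dsize_enc_bits x).
split; last by exists m'.
have [prei _] := Mi_ok.2 _ _ szi.
have [preo _] := Mo_ok.2 x mo (size_takel le_o).
have [u mo_eq] := prefixP preo.
(* The outer and the inner run read consecutive stretches of [mu]: the inner tape begins with [u],
   the part of the outer tape left unread. *)
have mu_eq : mu = uco x mo ++ (u ++ drop (ro (size x)) mu).
  by rewrite catA -mo_eq cat_take_drop.
have tape_eq : inner_tape x mu =
    take (ri (csize (nv_circuit Vo x mo))) (u ++ drop (ro (size x)) mu).
  by rewrite /inner_tape -/mo [X in drop _ X]mu_eq drop_size_cat.
have [v v_eq] := prefixP prei; rewrite [X in prefix _ X]mu_eq.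
rewrite -(cat_take_drop (ri (csize (nv_circuit Vo x mo))) (u ++ _)) -tape_eq.
rewrite [X in X ++ drop _ _]v_eq; apply/prefixP.
by eexists; rewrite -!catA.
Qed.

End ComposedVerifier.

(** * The simulator *)

(** On genuine answers the memory is harmless, since a proof answers a repeated query as before;
    thus a true view is replayed faithfully. *)
Lemma memo_compatible_genuine (pi : proof boolean) T ls :
  (forall l, if find_from T l is e :: _ then e.2 = pi l else True) ->
  memo_compatible pi (enc_seq (map enc_bits (map (bits_oracle pi) ls))) T ls.
Proof.
elim: ls T => //= l ls IH T okT.
have next : (memo_next (Cons (Cons (enc_bool (pi l)) Nil)
    (enc_seq (map enc_bits (map (bits_oracle pi) ls)))) T l).1 = pi l.
  rewrite /memo_next; case: (find_from T l) (okT l) => //= _.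
  by rewrite enc_bool_neq0.
split=> //; apply: IH => l'; move: next; rewrite /memo_next.
case: (find_from T l) => [/= nextE|e T' _] //=; last exact: okT.
by case: eqP => [<- //|_]; exact: okT.
Qed.

Lemma find_from_next an T l l' :
  find_from T l' != [::] -> find_from (memo_next an T l).2 l' != [::].
Proof.
by move=> ne; rewrite /memo_next; case: (find_from T l) => //=; case: (l == l').
Qed.

Fixpoint memo_run (an : data) (T : seq (nat * bool)) (ls : seq nat) :
    data * seq (nat * bool) :=
  if ls is l :: ls' then memo_run (dtl an) (memo_next an T l).2 ls' else (an, T).

Lemma memo_compatible_rcons pi an T ls l :
  memo_compatible pi an T (rcons ls l) <-> memo_compatible pi an T ls /\
    (memo_next (memo_run an T ls).1 (memo_run an T ls).2 l).1 = pi l.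
Proof.
elim: ls an T => [|l' ls IH] an T /=; first by split=> [[]|[]].
by rewrite IH; split=> [[? []]|[[]]].
Qed.

Lemma memo_compatible_eq pi pi' an T ls : {in ls, pi =1 pi'} ->
  memo_compatible pi an T ls -> memo_compatible pi' an T ls.
Proof.
elim: ls an T => //= l ls IH an T eq_pi [eql comp]; split.
  by rewrite eql eq_pi ?mem_head.
by apply: IH comp => l' l'ls; rewrite eq_pi // inE l'ls orbT.
Qed.

Lemma memo_run_found an T ls l : l \in ls -> find_from (memo_run an T ls).2 l != [::].
Proof.
have mono an1 T1 ls1 : find_from T1 l != [::] -> find_from (memo_run an1 T1 ls1).2 l != [::].
  by elim: ls1 an1 T1 => //= l' ls1 IH an1 T1 ne; apply: IH; apply: find_from_next.
elim: ls an T => //= l' ls IH an T; rewrite inE => /predU1P[<-|/IH //].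
apply: mono; rewrite /memo_next; case eqf: (find_from T l) => [|e T'] /=.
  by rewrite eqxx.
by rewrite eqf.
Qed.

Lemma memo_run_sound pi an T ls l :
  (forall l, if find_from T l is e :: _ then e.2 = pi l else True) ->
  memo_compatible pi an T ls ->
  if find_from (memo_run an T ls).2 l is e :: _ then e.2 = pi l else True.
Proof.
elim: ls an T => [|l' ls IH] an T okT /=; first by move=> _; exact: okT.
move=> [next comp]; apply: IH comp => l1; move: next; rewrite /memo_next.
case: (find_from T l') => [/= nextE|e T' _] //=; last exact: okT.
by case: eqP => [<- //|_]; exact: okT.
Qed.

(* Whatever the tape of answers, some proof answers in this way: change the
   answer to the first query on which the proof differs from the memory; by
   [lexec_diverge] the run is the same up to this query. *)
Lemma memo_compatible_exists c m mu an N :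
  (forall pi : proof boolean, exists cs ls t m',
     [/\ lexec (bits_oracle pi) c m cs ls t m', prefix cs mu & size ls <= N]) ->
  exists (pi : proof boolean) cs ls t m',
    [/\ lexec (bits_oracle pi) c m cs ls t m', prefix cs mu &
      memo_compatible pi an [::] ls].
Proof.
(* Agreement on the first [j] queries is established for each [j] in turn; at [j = N] it covers the
   whole run, as no run makes more queries. *)
move=> run; suff /(_ N)[pi [cs [ls [t [m' [ex pre comp]]]]]] : forall j,
    exists (pi : proof boolean) cs ls t m',
    [/\ lexec (bits_oracle pi) c m cs ls t m', prefix cs mu &
      memo_compatible pi an [::] (take j ls)].
  have [cs' [ls' [t' [m1 [ex' pre' sz]]]]] := run pi.
  exists pi, cs, ls, t, m'; split=> //.
  case/prefixP: pre pre' => r -> /prefixP[r' eqr].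
  have [[_ eql _ _]|[p [l [s [s' [_ _ _]]]]] //] := lexec_diverge ex ex' eqr.
  by rewrite -eql in sz; rewrite take_oversize in comp.
elim=> [|j [pi [cs [ls [t [m' [ex pre comp]]]]]]].
  have [cs [ls [t [m' [ex pre _]]]]] := run (fun=> false).
  by exists (fun=> false), cs, ls, t, m'; rewrite take0.
have [le_j|lt_j] := leqP (size ls) j.
  exists pi, cs, ls, t, m'; split=> //.
  by rewrite take_oversize in comp => //; rewrite take_oversize ?leqW.
set p := take j ls in comp *; set l := nth 0 ls j.
have lsE : ls = p ++ l :: drop j.+1 ls by rewrite -drop_nth // cat_take_drop.
set b := (memo_next (memo_run an [::] p).1 (memo_run an [::] p).2 l).1.
have [eqb|neb] := eqVneq b (pi l).
  exists pi, cs, ls, t, m'; split=> //.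
  by rewrite (take_nth 0) // memo_compatible_rcons.
(* Had [l] been asked before, the memory would repeat the earlier answer, which is [pi l] by
   compatibility. So changing [pi] at [l] does not affect the earlier queries. *)
have l_p : l \notin p.
  apply/negP => /(memo_run_found an [::]) found; case/eqP: neb.
  have sound : forall l, if find_from [::] l is e :: _ then e.2 = pi l else True by [].
  have := @memo_run_sound pi an [::] p l sound comp; rewrite /b /memo_next.
  by case: (find_from _ _) found.
pose pi' : proof boolean := fun l' => if l' == l then b else pi l'.
have eq_p : {in p, pi =1 pi'}.
  by move=> l' l'p; rewrite /pi'; case: eqP l'p l_p => // -> ->.
have [cs' [ls' [t' [m1 [ex' pre' _]]]]] := run pi'.
exists pi', cs', ls', t', m1; split=> //.
have neq l' : bits_oracle pi l' <> bits_oracle pi' l' -> l' = l.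
  by rewrite /bits_oracle /pi' /=; case: eqP.
have neql : bits_oracle pi l <> bits_oracle pi' l.
  by rewrite /bits_oracle /pi' /= eqxx => -[eq_b]; rewrite eq_b eqxx in neb.
case/prefixP: pre pre' => r -> /prefixP[r' eqr].
have [[_ _ eqm _]|[p2 [l2 [s [s' [lsE2 lsE' eqm ne]]]]]] := lexec_diverge ex ex' eqr.
  have l_ls : l \in ls by rewrite lsE mem_cat mem_head orbT.
  by move/eq_in_map: eqm => /(_ l l_ls)/neql.
have l2E : l2 = l by apply: neq.
rewrite {l2}l2E in lsE2 lsE' ne.
have l_p2 : l \notin p2.
  by apply/negP => l_p2; move/eq_in_map: eqm => /(_ l l_p2)/neql.
(* Both [p] and [p2] end just before the first occurrence of [l] in [ls]. *)
have szp : size p2 = j.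
  have i1 : index l ls = size p by rewrite {1}lsE index_cat (negPf l_p) /= eqxx addn0.
  have i2 : index l ls = size p2 by rewrite lsE2 index_cat (negPf l_p2) /= eqxx addn0.
  by rewrite -i2 i1 size_takel // ltnW.
have pE : p2 = p by rewrite /p lsE2 -szp take_size_cat.
rewrite lsE' pE -cat_rcons take_size_cat; last by rewrite size_rcons -pE szp.
rewrite memo_compatible_rcons; split; first exact: memo_compatible_eq comp.
by rewrite /pi' eqxx.
Qed.

(** The coins of the simulated view are copied to the output, as A' tosses the coins of A; only the
    answers are replaced. *)
Definition simulator (Ms A' : cmd) : cmd :=
  Seq (Assign 0 (Econs v0 Enil)) (Seq (rec_call 1 Ms)
  (Seq (Assign 0 (Econs (Ehd (Etl (Etl v0))) (Econs (Econs (Ehd (Ehd v0)) (Etl (Ehd v0))) (Ehd (Ehd v0)))))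
  (Seq (memo_call 1 A')
  (Seq (Assign 0 (Econs (Etl (Ehd v0)) (Econs Enil (Etl v0))))
  (Seq rev_loop (Assign 0 (Econs (Etl (Etl v0)) (Ehd (Etl v0))))))))).

(* The replay of [A'] with the view [S] yields the answers [ans] to [A]. *)
Definition replays (A' : cmd) (p : nat -> nat) (x : seq bool) (S : data)
    (ans : seq (seq bool)) : Prop :=
  exists (pi : proof boolean) cs ls t m',
    [/\ lexec (bits_oracle pi) A' (upd (fun=> Nil) 0 (enc_bits x)) cs ls t m',
      t <= p (dsize (enc_bits x)), reads (dhd S) cs,
      memo_compatible pi (dtl S) [::] ls &
      dtl (m' 0) = enc_seq (map enc_bits (rev ans))].

(** The two replays may be witnessed by different proofs, but both describe the output of
    [memo_call], which is one program run without coins from one initial state. *)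
Lemma replays_det A' p x S ans ans' : poly_mono p ->
  replays A' p x S ans -> replays A' p x S ans' -> ans = ans'.
Proof.
move=> pm [pi [cs [ls [t [m [ex le rd comp eqa]]]]]].
move=> [pi' [cs' [ls' [t' [m' [ex' le' rd' comp' eqa']]]]]].
pose D (i : seq bool * data * data * data) :=
  exists (pi : proof boolean) cs ls t m',
    [/\ lexec (bits_oracle pi) A' (upd (fun=> Nil) 0 (enc_bits i.1.1.1)) cs ls t m',
       m' 0 = i.2, t <= p (dsize (enc_bits i.1.1.1)), reads i.1.1.2 cs &
       memo_compatible pi i.1.2 [::] ls].
have [pq _ st] := @memo_callP _ D 1 (fun=> no_oracle) A' (fun i => enc_bits i.1.1.1)
  (fun i => i.1.1.2) (fun i => i.1.2) (fun=> Nil) (fun i => i.2) p isT pm (fun i Di => Di).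
have D1 : D (x, dhd S, dtl S, m 0) by exists pi, cs, ls, t, m.
have D2 : D (x, dhd S, dtl S, m' 0) by exists pi', cs', ls', t', m'.
have [M1 [a1 [t1 [ex1 _ _ M10 _]]]] := st _ D1 (fun=> _) erefl.
have [M2 [a2 [t2 [ex2 _ _ M20 _]]]] := st _ D2 (fun=> _) erefl.
have [_ _ _ eqM] := exec_det (r := [::]) (r' := [::]) ex1 ex2 erefl.
have : dtl (m 0) = dtl (m' 0) by move: M10; rewrite eqM M20 /= => -[->].
by rewrite eqa eqa' => /enc_seq_inj/(inj_map enc_bits_inj)/(can_inj revK).
Qed.

Lemma simulator_ppt rs Sim Ms A' ps uc p H :
  runs_ppt enc_bits (@size bool) rs Sim Ms ps uc -> poly_mono p ->
  (forall x S, replays A' p x S (H x S)) ->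
  ppt enc_bits (@size bool) rs
    (fun x mu => Cons (dhd (Sim x mu)) (enc_seq (map enc_bits (H x (Sim x mu))))).
Proof.
move=> [psm run] pm rep; pose index := (seq bool * seq bool)%type.
pose S (i : index) := Sim i.1 i.2; pose ans (i : index) := H i.1 (S i).
have /choice[out outP] : forall i : index, exists o,
    dtl o = enc_seq (map enc_bits (rev (ans i))) /\
    exists (pi : proof boolean) cs ls t m',
    [/\ lexec (bits_oracle pi) A' (upd (fun=> Nil) 0 (enc_bits i.1)) cs ls t m',
       m' 0 = o, t <= p (dsize (enc_bits i.1)), reads (dhd (S i)) cs &
       memo_compatible pi (dtl (S i)) [::] ls].
  move=> i; have [pi [cs [ls [t [m [ex le rd comp eqa]]]]]] := rep i.1 (S i).
  by exists (m 0); split=> //; exists pi, cs, ls, t, m.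
have [pq pqm st] : computes (fun i : index => size i.2 = rs (size i.1)) 1 (fun=> no_oracle)
    (simulator Ms A') (fun i => enc_bits i.1) (fun i => uc i.1 i.2) (fun=> 0)
    (fun i => Cons (dhd (S i)) (enc_seq (map enc_bits (ans i)))).
  apply: (computes_seq0 (d1 := fun i => Cons (enc_bits i.1) Nil)).
    exact: computes_assign.
  apply: (computes_seql (d1 := fun i => Cons (S i)
    (Cons (enc_bits (rev (uc i.1 i.2))) (Cons (enc_bits i.1) Nil)))).
    apply: (rec_callP _ _ _ psm) => // i szt.
    have [_ [a [t [m' [ex m'0 le_t]]]]] := run _ _ szt.
    by exists a, t, m'.
  apply: (computes_seq0 (d1 := fun i => Cons (enc_bits i.1)
    (Cons (Cons (dhd (S i)) (dtl (S i))) (dhd (S i))))).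
    exact: computes_assign.
  apply: (computes_seq0 (d1 := fun i => Cons (out i) (dhd (S i)))).
    apply: (@memo_callP index _ 1 _ A' (fun i => enc_bits i.1) (fun i => dhd (S i))
      (fun i => dtl (S i)) (fun i => dhd (S i)) out p isT pm) => i _.
    exact: (outP i).2.
  apply: (computes_seq0 (d1 := fun i => Cons (enc_seq (map enc_bits (rev (ans i))))
     (Cons Nil (dhd (S i))))).
    by apply: computes_assign => // i _; rewrite -(outP i).1.
  apply: (computes_seq0 (d1 := fun i => Cons Nil
    (Cons (enc_seq (map enc_bits (ans i))) (dhd (S i))))).
    apply: (computes_reindex (rev_loopP 1) (g := fun i => (no_oracle,
      map enc_bits (rev (ans i)), [::], dhd (S i)))) => // i _.
    by rewrite /= catrevE cats0 -map_rev revK.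
  exact: computes_assign.
exists (simulator Ms A'), (fun n => pq (4 * n + 1)); split.
  suff: poly_mono (fun n => pq (4 * n + 1)) by case.
  by apply: poly_mono_comp => //; poly_mono_tac.
move=> x mu szmu.
have [m' [a [t [ex le_t _ m'0 _]]]] := st (x, mu) szmu (upd (fun=> Nil) 0 (enc_bits x)) erefl.
exists (uc x mu), a, t; split; last first.
  apply: leq_trans le_t _; apply: pqm.1.
  by case/andP: (dsize_enc_bits x).
by split; [exact: (run x mu szmu).1 | exists m'].
Qed.

(** * Finite probability *)

Import Order.TTheory GRing.Theory Num.Theory.
Local Open Scope ring_scope.

Section Probability.
Variable R : realType.

Lemma Pr_eq (T : Type) (D : fdist R T) (E E' : T -> Prop) :
  (forall o, fd_weight (f := D) o != 0 -> (E (fd_val o) <-> E' (fd_val o))) ->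
  Pr D E = Pr D E'.
Proof.
move=> eqE; rewrite /Pr big_mkcond [RHS]big_mkcond; apply: eq_bigr => o _ /=.
have [->|/eqE eqo] := eqVneq (fd_weight o) 0; first by rewrite !if_same.
by rewrite (asbool_equiv_eq eqo).
Qed.

Lemma Pr_le (T : Type) (D : fdist R T) (E E' : T -> Prop) :
  (forall o : fd_space D, E (fd_val o) -> E' (fd_val o)) -> Pr D E <= Pr D E'.
Proof.
move=> subE; rewrite /Pr big_mkcond [leRHS]big_mkcond; apply: ler_sum => o _ /=.
case: ifP => [/asboolP/subE/asboolT -> //|_]; case: ifP => // _; exact: fd_ge0.
Qed.

Lemma Pr_true (T : Type) (D : fdist R T) (E : T -> Prop) :
  (forall o : fd_space D, E (fd_val o)) -> Pr D E = 1.
Proof.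
move=> allE; rewrite -(fd_sum1 D); apply: eq_bigl => o.
by apply/asboolP; apply: allE.
Qed.

Lemma Pr_le1 (T : Type) (D : fdist R T) (E : T -> Prop) : Pr D E <= 1.
Proof. by rewrite -(@Pr_true _ D (fun=> True)) //; apply: Pr_le. Qed.

Lemma Pr_compl (T : Type) (D : fdist R T) (E : T -> Prop) :
  Pr D E + Pr D (fun t => ~ E t) = 1.
Proof.
rewrite -(fd_sum1 D) (bigID (fun o => `[< E (fd_val o) >])) /=; congr (_ + _).
by apply: eq_bigl => o; rewrite asbool_neg.
Qed.

Lemma Pr_eq1P (T : Type) (D : fdist R T) (E : T -> Prop) :
  Pr D E = 1 <-> forall o, fd_weight (f := D) o != 0 -> E (fd_val o).
Proof.
split=> [eq1 o|allE]; last first.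
  by rewrite -(@Pr_true _ D (fun=> True)) //; apply: Pr_eq => o /allE.
have := Pr_compl D E; rewrite eq1 => /(canRL (addKr _)); rewrite addNr.
move/psumr_eq0P => eq0 nz; apply: contrapT => nE; case/eqP: nz.
by apply: eq0 => [o' _|]; [exact: fd_ge0 | apply/asboolP].
Qed.

Lemma coins_neq0 r (o : fd_space (coins R r)) : fd_weight o != 0.
Proof. by rewrite /= invr_eq0 expf_neq0 // pnatr_eq0. Qed.

Lemma Pr_fprod (T U : Type) (D : fdist R T) (E : fdist R U) (P : T * U -> Prop) :
  Pr (fprod D E) P = \sum_(a : fd_space D) fd_weight a * Pr E (fun u => P (fd_val a, u)).
Proof.
rewrite /Pr big_mkcond /= -(pair_bigA _ (fun a b =>
  if `[< P (fd_val a, fd_val b) >] then fd_weight a * fd_weight b else 0)) /=.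
apply: eq_bigr => a _; rewrite big_distrr -big_mkcond /=.
by apply: eq_bigl => b.
Qed.

(* The coins that a run reads form a prefix-free code, so the tape may be
   replaced from there on by fresh coins. *)
Lemma Pr_coins_splice r r' (used : seq bool -> seq bool) (E : seq bool -> Prop) :
  (forall a, size a = r -> prefix (used a) a) ->
  (forall a a' mu, size a = r -> size a' = r ->
     prefix (used a) mu -> prefix (used a') mu -> used a = used a') ->
  Pr (coins R (r + r')) E =
  Pr (fprod (coins R r) (coins R r'))
     (fun ab => E (used ab.1 ++ ab.2 ++ drop (size (used ab.1)) ab.1)).
Proof.
move=> pre free.
have usedE a : size a = r -> used a ++ drop (size (used a)) a = a.
  by move=> /pre/prefixP[s eqa]; rewrite [X in drop _ X]eqa drop_size_cat // -eqa.
(* The fresh coins go directly behind those read, where the inner tape begins. Keeping the unread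
   rest at the end makes this map injective, hence bijective by counting. *)
pose splice (ab : r.-tuple bool * r'.-tuple bool) : seq bool :=
  used ab.1 ++ ab.2 ++ drop (size (used ab.1)) ab.1.
have szP ab : size (splice ab) == (r + r')%N.
  rewrite /splice !size_cat addnCA -size_cat usedE ?size_tuple //.
  by rewrite addnC.
pose f ab : (r + r').-tuple bool := Tuple (szP ab).
have f_inj : injective f.
  move=> [a b] [a' b'] /(congr1 val); rewrite /= /splice /= => eqs.
  have eq_used : used a = used a'.
    apply: (free _ _ (splice (a, b))); rewrite ?size_tuple ?prefix_prefix //.
    by rewrite /splice /= eqs prefix_prefix.
  move/eqP: eqs; rewrite eq_used eqseq_cat // eqxx /= eqseq_cat ?size_tuple //.
  move=> /andP[/eqP/val_inj -> /eqP eqd]; congr (_, _); apply: val_inj.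
  by rewrite /= -(usedE a) ?size_tuple // -(usedE a') ?size_tuple // eq_used eqd.
have f_bij : bijective f.
  by apply: inj_card_bij => //; rewrite card_prod !card_tuple expnD.
rewrite /Pr (reindex f) /=; last exact: onW_bij.
by apply: eq_bigr => ab _; rewrite exprD invfM.
Qed.

Lemma Pr_coins_take r r' (E : seq bool -> Prop) : (r <= r')%N ->
  Pr (coins R r') (fun mu => E (take r mu)) = Pr (coins R r) E.
Proof.
move=> le_r; rewrite -{1}(subnKC le_r) (@Pr_coins_splice _ _ id).
- rewrite Pr_fprod [RHS]/Pr [RHS]big_mkcond; apply: eq_bigr => a _.
  have -> : Pr (coins R (r' - r)) (fun u => E (take r ((fd_val a, u).1 ++ (fd_val a, u).2 ++
      drop (size (fd_val a, u).1) (fd_val a, u).1))) =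
      Pr (coins R (r' - r)) (fun=> E (fd_val a)).
    by apply: Pr_eq => u _ /=; rewrite take_size_cat ?size_tuple.
  case: asboolP => Ea; first by rewrite Pr_true // mulr1.
  by rewrite /Pr big_pred0 ?mulr0 // => u; apply/asboolP.
- by move=> a _; apply: prefix_refl.
- move=> a a' mu sza sza' /prefixP[s ->] /prefixP[s' /eqP].
  by rewrite eqseq_cat ?sza ?sza' // => /andP[/eqP].
Qed.

(** It suffices to compare the point probabilities at the finitely many values of [X2]: under [D1]
    they also add up to 1, so [X1] takes other values, such as ill-formed simulator outputs, with
    probability 0. *)
Lemma Pr_transfer (T1 T2 : Type) (D1 : fdist R T1) (D2 : fdist R T2)
    (X1 : T1 -> data) (X2 : T2 -> data) (E : data -> Prop) :
  (forall o : fd_space D2,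
     Pr D1 (fun t => X1 t = X2 (fd_val o)) = Pr D2 (fun t => X2 t = X2 (fd_val o))) ->
  Pr D1 (fun t => E (X1 t)) = Pr D2 (fun t => E (X2 t)).
Proof.
move=> eqX; pose L := undup [seq X2 (fd_val o) | o : fd_space D2].
have sum_seq (F : data -> Prop) x : \sum_(d <- L) `[< F d >]%:R * (x == d)%:R =
    `[< F x /\ x \in L >]%:R :> R.
  have [xL|nxL] := boolP (x \in L).
    rewrite (bigD1_seq x) ?undup_uniq //= eqxx mulr1 big1 => [|d /negPf ne].
      rewrite addr0 (asbool_equiv_eq (Q := F x /\ true)) //.
      by split=> [|[]].
    by rewrite eq_sym ne mulr0.
  rewrite big1_seq => [|d /= dL]; first by rewrite asboolF // => -[].
  have /negPf-> : x != d by apply: contraNneq nxL => ->.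
  by rewrite mulr0.
have PrE T (D : fdist R T) (F : T -> Prop) :
    Pr D F = \sum_(o : fd_space D) fd_weight o * `[< F (fd_val o) >]%:R.
  by rewrite /Pr big_mkcond; apply: eq_bigr => o _; case: asboolP; rewrite ?mulr1 ?mulr0.
have split T (D : fdist R T) X (F : data -> Prop) :
    Pr D (fun t => F (X t) /\ X t \in L) =
    \sum_(d <- L) `[< F d >]%:R * Pr D (fun t => X t = d).
  rewrite PrE; under [RHS]eq_bigr => d _ do rewrite PrE mulr_sumr.
  rewrite exchange_big /=; apply: eq_bigr => o _.
  rewrite -sum_seq mulr_sumr; apply: eq_bigr => d _.
  rewrite mulrCA; congr (_ * (_ * _)).
  by case: asboolP => [->|/eqP/negPf ->]; rewrite ?eqxx.
have L2 (o : fd_space D2) : X2 (fd_val o) \in L.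
  by rewrite mem_undup; apply/mapP; exists o; rewrite ?mem_enum.
have trans (F : data -> Prop) : Pr D1 (fun t => F (X1 t) /\ X1 t \in L) = Pr D2 (fun t => F (X2 t)).
  rewrite split (_ : Pr D2 _ = Pr D2 (fun t => F (X2 t) /\ X2 t \in L)).
    rewrite split; apply: eq_big_seq => d; rewrite mem_undup => /mapP[o _ ->].
    by rewrite eqX.
  by apply: Pr_eq => o _; split=> [|[]].
rewrite -trans; apply: Pr_eq => o nz; split=> [Eo|[]//]; split=> //.
(* For the trivial event, [trans] says that [X1] lies in [L] with probability 1, hence at every
   point of nonzero weight. *)
have := trans (fun=> True); rewrite [RHS]Pr_true // => /Pr_eq1P.
by case/(_ o nz).
Qed.

End Probability.

(** * The composed proof system *)

Section Composition.
Variables (R : realType) (Rel : seq bool -> seq bool -> Prop).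
Variables (r_out r_in d_out d_in q_out q_in qstar : nat -> nat).
Variables (eps_out eps_in rho_out delta_in : nat -> R).
Variables (Po : prover R boolean) (Vo : verifier (seq bool)).
Variables (Pi : pp_prover R circuit_value) (Vi : verifier circuit).
Variable f : circuit -> seq bool -> seq bool.
Variables (Mo Mi Mf : cmd) (po pi pf : nat -> nat).
Variable uco : seq bool -> seq bool -> seq bool.
Variable uci : circuit -> seq bool -> seq bool.
Variable ucf : circuit * seq bool -> seq bool -> seq bool.
Hypothesis Mo_ok : runs_ppt enc_bits (@size bool) r_out (enc_verifier_output Vo) Mo po uco.
Hypothesis Mi_ok : runs_ppt enc_circuit csize r_in (enc_verifier_output Vi) Mi pi uci.
Hypothesis Mf_ok : runs_ppt (fun Cy => Cons (enc_circuit Cy.1) (enc_bits Cy.2))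
  (fun Cy => (csize Cy.1 + size Cy.2)%N) (fun=> 0%N) (fun Cy _ => enc_bits (f Cy.1 Cy.2))
  Mf pf ucf.
Hypothesis Vo_size : forall x mu, size mu = r_out (size x) ->
  [/\ (size (nv_query Vo x mu) <= q_out (size x))%N,
      c_inputs (nv_circuit Vo x mu) = size (nv_query Vo x mu)
    & csize (nv_circuit Vo x mu) = d_out (size x)].
Hypothesis Vi_size : forall C mu, size mu = r_in (csize C) ->
  [/\ (size (nv_query Vi C mu) <= q_in (csize C))%N,
      c_inputs (nv_circuit Vi C mu) = size (nv_query Vi C mu)
    & csize (nv_circuit Vi C mu) = d_in (csize C)].
Hypothesis Pi_det : forall C y, Pi C y = fdirac R (string_proof (f C y)).

Let V := composed_verifier Vo Vi r_out r_in uco.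
Let r n := (r_out n + r_in (d_out n))%N.

Lemma size_used x a : size a = r_out (size x) -> (size (uco x a) <= r_out (size x))%N.
Proof. by move=> sza; have /size_prefix := (Mo_ok.2 x a sza).1; rewrite sza. Qed.

Lemma outer_det x a b : size a = r_out (size x) -> size b = r_out (size x) ->
  prefix (uco x a) b ->
  [/\ uco x b = uco x a, nv_query Vo x b = nv_query Vo x a
    & nv_circuit Vo x b = nv_circuit Vo x a].
Proof.
move=> sza szb pre; have [-> eqo] := runs_ppt_det Mo_ok sza szb pre.
by have [-> ->] := enc_verifier_output_inj eqo.
Qed.

Lemma inner_tape_size x mu : size mu = r (size x) ->
  (r_out (size x) <= size mu)%N /\
  size (inner_tape Vo r_out r_in uco x mu) =
    r_in (csize (nv_circuit Vo x (take (r_out (size x)) mu))).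
Proof.
move=> szmu; have le_o : (r_out (size x) <= size mu)%N by rewrite szmu leq_addr.
have szo := size_takel le_o; split=> //; rewrite /inner_tape size_takel //.
have [_ _ ->] := Vo_size szo; rewrite size_drop szmu leq_subRL.
  by rewrite leq_add2r size_used.
by apply: leq_trans (leq_addr _ _); apply: size_used.
Qed.

Lemma accepts_composed x mu (p o : proof boolean) :
  (forall n, p (locate (nv_query Vo x (take (r_out (size x)) mu))
                  (uco x (take (r_out (size x)) mu)) n) = o n) ->
  accepts V x mu p = accepts Vi (nv_circuit Vo x (take (r_out (size x)) mu))
    (inner_tape Vo r_out r_in uco x mu) o.
Proof.
move=> eqp; rewrite /accepts /decides /answers /=; congr ceval; congr flatten.
by congr map; rewrite -map_comp; apply: eq_map.
Qed.

Lemma composed_complexity :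
  verifier_complexity boolean enc_bits (@size bool) V r
    (fun n => q_in (d_out n)) (fun n => d_in (d_out n)).
Proof.
split; first exact: composed_verifier_ppt Mo_ok Mi_ok _ inner_tape_size.
move=> x mu szmu; have [le_o szi] := inner_tape_size szmu.
have [le_q eq_c eq_d] := Vi_size szi.
have [_ _ szC] := Vo_size (size_takel le_o); rewrite -szC.
by split; rewrite /= ?size_map // muln1.
Qed.

(** The image of [Po x w]: since the inner prover is deterministic, no randomness is added. *)
Let P : prover R boolean := fun x w =>
  FDist (fun o => composed Vo f r_out x (fd_val o)) (@fd_ge0 _ _ (Po x w))
    (fd_sum1 (Po x w)).

Lemma flatten_boolean (a : seq bool) : flatten (map (@symbol_bits boolean) a) = a.
Proof. by elim: a => //= b a ->. Qed.

Lemma composed_complete :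
  pcp_complete Rel Po Vo r_out -> pcpp_complete Pi Vi r_in -> pcp_complete Rel P V r.
Proof.
move=> out_complete in_complete x w Rxw.
have /Pr_eq1P out1 := out_complete x w Rxw.
apply/Pr_eq1P => -[o mu] nz /=; have nzo : fd_weight (f := Po x w) o != 0.
  by apply: contraNneq nz => eq0; rewrite /= eq0 mul0r.
set ppi : proof boolean := fd_val (f := Po x w) o.
have szmu : size (val mu) = r (size x) by rewrite size_tuple.
have [le_o szi] := inner_tape_size szmu.
set mo := take (r_out (size x)) mu in szi; have szo : size mo = r_out (size x) by exact: size_takel.
set C := nv_circuit Vo x mo in szi; set Q := nv_query Vo x mo.
pose y : seq bool := map ppi Q.
have szmo : size mo == r_out (size x) by rewrite szo.
have acc : accepts Vo x mo ppi.
  have /= := out1 (o, Tuple szmo); apply; rewrite mulf_neq0 //.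
  exact: (coins_neq0 (Tuple szmo : fd_space (coins R _))).
have Cy : circuit_value_section C y.
  split; first by rewrite size_map; have [_ -> _] := Vo_size szo.
  by move: acc; rewrite /accepts /decides /answers flatten_boolean.
have /Pr_eq1P in1 := in_complete C y Cy.
rewrite (accepts_composed (o := pair_oracle y (string_proof (f C y)))); last first.
  move=> n; rewrite /locate -/mo -/Q; case: ltnP => [lt_n|ge_n].
    rewrite composed_outer /pair_oracle size_map lt_n (nth_map 0%N) //.
  (* The inner string was computed from the padded address instead of [mo]; both tapes begin with
     the coins read, so queries and circuit are the same. *)
  have [eqs eqQ eqC] : [/\ uco x (pad (r_out (size x)) (uco x mo)) = uco x mo,
      nv_query Vo x (pad (r_out (size x)) (uco x mo)) = Q &
      nv_circuit Vo x (pad (r_out (size x)) (uco x mo)) = C].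
    by apply: outer_det; rewrite ?size_pad // prefix_pad // size_used.
  rewrite composed_inner /inner_string eqQ eqC -/y nth_cat /pair_oracle.
  by case: ltnP.
have szi' : size (inner_tape Vo r_out r_in uco x mu) == r_in (csize C) by rewrite szi.
move: in1; rewrite Pi_det => /(_ (tt, Tuple szi')); apply.
rewrite /= mul1r; exact: (coins_neq0 (Tuple szi' : fd_space (coins R _))).
Qed.

(** After splicing, the inner coins are independent of the outer tape, so inner soundness applies
    for each outer tape separately. *)
Lemma composed_sound :
  (forall n, 0 <= eps_in n <= 1) -> (forall n, delta_in (d_out n) <= rho_out n) ->
  pcp_robustly_sound boolean Rel Vo r_out (fun n => 1 - eps_out n) rho_out ->
  pcpp_sound (L := circuit_value) Vi r_in delta_in (fun n => 1 - eps_in n) ->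
  pcp_sound boolean Rel V r (fun n => 1 - eps_out n * eps_in (d_out n)).
Proof.
move=> eps01 prox out_sound in_sound x nL p; set n := size x.
pose p_out : proof boolean := fun j => p (outer_loc j).
pose bad mu := (dist_to R (answers Vo x mu p_out) (Acc Vo x mu) <= (rho_out n)%:E)%E.
have le_bad : Pr (coins R (r_out n)) bad <= 1 - eps_out n := out_sound x nL p_out.
have /andP[ei0 ei1] := eps01 (d_out n).
rewrite /r (@Pr_coins_splice _ _ _ (uco x)).
- rewrite Pr_fprod; set ei := eps_in (d_out n).
  (* For fixed outer coins acceptance has probability at most 1 in the bad case and [1 - ei]
     otherwise; the indicator expresses both bounds at once. *)
  apply: (@le_trans _ _ (\sum_(a : fd_space (coins R (r_out n)))
      fd_weight a * ((1 - ei) + ei * `[< bad (fd_val a) >]%:R))).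
    apply: ler_sum => a _; apply: ler_wpM2l; first exact: fd_ge0.
    case: asboolP => [_|good]; first by rewrite mulr1 subrK; apply: Pr_le1.
    rewrite mulr0 addr0 /=; set ta := tval a.
    have sza : size ta = r_out n by apply: size_tuple.
    have [szQ szC dC] := Vo_size sza; set C := nv_circuit Vo x ta in szC dC.
    pose y : seq bool := map p_out (nv_query Vo x ta).
    (* The shift by [size y] skips the locations of the inner oracle that belong to [y], which are
       read from the outer part. *)
    pose p_in : proof boolean := fun i => p (inner_loc (uco x ta) (i + size y)).
    have sound : Pr (coins R (r_in (csize C)))
        (fun mu => accepts Vi C mu (pair_oracle y p_in)) <= 1 - eps_in (csize C).
      apply: (in_sound C y); first by rewrite /= size_map szC.
      (* Outside the bad case the distance exceeds [rho_out n], hence [delta_in (d_out n)]; and the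
         accepted answers are exactly the satisfying assignments of the decision circuit. *)
      rewrite /= dC; apply: (@Order.POrderTheory.le_trans _ _ (rho_out n)%:E).
        by rewrite lee_fin prox.
      have -> : circuit_value_section C = Acc (S := boolean) Vo x ta.
        apply/seteqP; split=> z [szz acc]; split; rewrite ?szz ?szC //.
          by rewrite /decides flatten_boolean.
        by move: acc; rewrite /decides flatten_boolean.
      by apply/ltW; rewrite ltNge; apply/negP.
    rewrite dC in sound; apply: le_trans sound; apply: Pr_le => b /=.
    have szb : size (tval b) = r_in (csize C) by rewrite size_tuple dC.
    set mu := uco x ta ++ _.
    have mo_take : take (r_out n) mu = uco x ta ++
        take (r_out n - size (uco x ta)) (tval b ++ drop (size (uco x ta)) ta).
      by rewrite /mu take_cat ltnNge size_used.
    have le_used := size_used sza.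
    have szmu : size mu = r n.
      by rewrite /mu !size_cat size_drop size_tuple sza /r; move: le_used; rewrite -/n; lia.
    have [le_o szi] := inner_tape_size szmu.
    have szo : size (take (r_out n) mu) = r_out n by apply: size_takel.
    have [eqs eqQ eqC] : [/\ uco x (take (r_out n) mu) = uco x ta,
        nv_query Vo x (take (r_out n) mu) = nv_query Vo x ta &
        nv_circuit Vo x (take (r_out n) mu) = C].
      by apply: outer_det => //; rewrite mo_take prefix_prefix.
    rewrite (accepts_composed (o := pair_oracle y p_in)) -/n ?eqC; last first.
      move=> j; rewrite eqs eqQ /locate /pair_oracle /y size_map; case: ltnP => lt_j.
        by rewrite (nth_map 0%N).
      by rewrite /p_in /y size_map subnK.
    have -> : inner_tape Vo r_out r_in uco x mu = tval b; last by [].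
    by rewrite /inner_tape -/n eqC eqs /mu drop_size_cat // take_size_cat.
  have -> : \sum_(a : fd_space (coins R (r_out n)))
      fd_weight a * ((1 - ei) + ei * `[< bad (fd_val a) >]%:R) =
      (1 - ei) + ei * Pr (coins R (r_out n)) bad.
    under eq_bigr => a _ do rewrite mulrDr.
    rewrite big_split /= -mulr_suml (fd_sum1 (coins R (r_out n))) mul1r; congr (_ + _).
    rewrite /Pr mulr_sumr [RHS]big_mkcond; apply: eq_bigr => a _.
    by rewrite mulrCA; case: asboolP => _; rewrite ?mulr1 // !mulr0.
  apply: (@le_trans _ _ ((1 - ei) + ei * (1 - eps_out n))).
    by rewrite lerD2l ler_wpM2l.
  by rewrite mulrBr mulr1 addrA subrK mulrC.
- by move=> a sza; apply: (Mo_ok.2 x a sza).1.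
- move=> a a' mu sza sza' pre pre'.
  case/prefixP: pre pre' => s -> /prefixP[s' eqs].
  have [_ [ans [t [m' [ex _ _]]]]] := Mo_ok.2 x a sza.
  have [_ [ans' [t' [m1 [ex' _ _]]]]] := Mo_ok.2 x a' sza'.
  by have [] := exec_det ex ex' eqs.
Qed.

Lemma composed_zk :
  perfect_zk Rel Po qstar -> perfect_zk Rel P (fun n => qstar n %/ q_out n)%N.
Proof.
move=> out_zk A T [pT malA].
have query_bound x mu : size mu = r_out (size x) ->
    (size (nv_query Vo x mu) <= q_out (size x))%N by case/Vo_size.
have [pS pSm simA] := simulateP Mo_ok Mf_ok query_bound A.
have [T1 T1m leT] := polynomially_bounded_mono pT.
(* [T'] is both the tape length and the time bound of A': the first summand makes room for the tape
   of [A], the second pays for the simulation, [4 * n + 1] bounding the encoded input. As [T] need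
   not be monotone, [p] is a monotone majorant of [T']. *)
pose A' := simulate Mo Mf A; pose T' n := (T n + pS (T n + (4 * n + 1)))%N.
pose p n := (T1 n + pS (T1 n + (4 * n + 1)))%N.
have pm : poly_mono p.
  apply: poly_mono_add => //; apply: poly_mono_comp => //.
  by apply: poly_mono_add => //; poly_mono_tac.
have le_T' n : (T' n <= p n)%N.
  by apply: leq_add; [exact: leT | apply: pSm.1; rewrite leq_add2r; exact: leT].
pose init x := upd (fun=> Nil) 0 (enc_bits x).
pose info x (q : proof boolean) mu (u : seq bool * seq (seq bool) * seq (seq bool)) :=
  exists t t' m M', [/\ exec (bits_oracle (composed Vo f r_out x q)) A (init x) u.1.1 u.1.2 t m,
    exec (bits_oracle q) A' (init x) u.1.1 u.2 t' M',
    prefix u.1.1 (take (T (size x)) mu) /\ (t' <= T' (size x))%N,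
    (size u.2 <= qstar (size x))%N & dtl (M' 0%N) = enc_seq (map enc_bits (rev u.1.2))].
have run x q mu : size mu = T' (size x) -> exists u, info x q mu u.
  move=> szmu; have szT : size (take (T (size x)) mu) = T (size x).
    by rewrite size_takel // szmu leq_addr.
  have [cs [ans [out [t [[pre [m [ex _]]] le_t le_a]]]]] :=
    malA x (composed Vo f r_out x q) _ szT.
  have [a' [t' [M' [ex' le_t' le_a' eqM]]]] := simA _ _ _ _ _ _ ex.
  exists (cs, ans, a'), t, t', m, M'; split=> //.
    split=> //; apply: leq_trans le_t' (leq_trans (pSm.1 _ _ _) (leq_addl _ _)).
    by apply: leq_add => //; have /andP[] := dsize_enc_bits x.
  (* If [q_out] vanishes, the quotient is 0 by convention: then [A] makes no queries, and neither
     does A'. Otherwise the [maxn 1] is void and the rounding of the quotient is in the right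
     direction. *)
  apply: leq_trans le_a' _; case: (posnP (q_out (size x))) le_a => [->|gt0] le_a.
    by move: le_a; rewrite divn0 leqn0 => /nilP->.
  rewrite (maxn_idPr gt0); apply: leq_trans (leq_trunc_div _ (q_out (size x))).
  by rewrite leq_mul2r le_a orbT.
have preT x mu (cs : seq bool) : prefix cs (take (T (size x)) mu) -> prefix cs mu.
  case/prefixP=> s eqs; apply/prefixP; exists (s ++ drop (T (size x)) mu).
  by rewrite catA -eqs cat_take_drop.
have mal' : malicious boolean A' T' qstar.
  split.
    have [_ [c [k ple]]] := pm; exists c, k => n; exact: leq_trans (le_T' n) (ple n).
  move=> x q mu szmu; have [[[cs ans] a'] [t [t' [m [M' [_ ex' [pre le_t] le_a _]]]]]] := run x q mu szmu.
  exists cs, a', (M' 0%N), t'; split=> //; split; first exact: preT pre.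
  by exists M'.
have [rs [Sim [ppt_sim sim_eq]]] := out_zk A' T' mal'.
have [Ms [ps [uc Ms_ok]]] := ppt_runs leq_size_enc_bits ppt_sim.
have le_size x : (T' (size x) <= p (dsize (enc_bits x)))%N.
  by apply: leq_trans (le_T' _) _; apply: pm.1; apply: leq_size_enc_bits.
(* Every [S] can be replayed: its first half, cut or padded to length [T'], is a legal tape for A',
   and some proof answers as the memory does on its second half. *)
have /choice[H HP] : forall xS : seq bool * data, exists ans, replays A' p xS.1 xS.2 ans.
  move=> [x S] /=; pose mu := pad (T' (size x)) (bits_of_data (dhd S)).
  have szmu : size mu = T' (size x) by apply: size_pad.
  have [|q [cs [ls [t [m' [lex pre comp]]]]]] :=
    @memo_compatible_exists A' (init x) mu (dtl S) (T' (size x)).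
    move=> q; have [[[cs ans] a'] [t [t' [m [M' [_ ex' [pre le_t] _ _]]]]]] := run x q mu szmu.
    have [ls a'E lex] := exec_lexec ex'; exists cs, ls, t', M'; split=> //.
      exact: preT pre.
    by rewrite -(size_map (bits_oracle q)) -a'E (leq_trans (exec_size_answers ex')).
  have [[[cs' ans] a'] [t1 [t' [m [M' [_ ex' [pre' le_t] _ eqM]]]]]] := run x q mu szmu.
  exists ans, q, cs, ls, t, m'.
  have /prefixP[s mu_eq] := pre; have /preT/prefixP[s' mu_eq'] := pre'.
  have [eq_cs _ eq_t eq_m] := exec_det (lexec_exec lex) ex' (etrans (esym mu_eq) mu_eq').
  split=> //; first by rewrite eq_t (leq_trans le_t).
    exact: reads_prefix pre (reads_padded _ _).
  by rewrite eq_m.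
exists rs, (fun x mu => Cons (dhd (Sim x mu)) (enc_seq (map enc_bits (H (x, Sim x mu))))).
split; first exact: (simulator_ppt (H := fun x S => H (x, S)) Ms_ok pm (fun x S => HP (x, S))).
move=> x w Rxw v.
have /choice[g gP] : forall qm : proof boolean * seq bool, exists u,
    size qm.2 = T' (size x) -> info x qm.1 qm.2 u.
  move=> [q mu]; have [szmu|/eqP ne] := eqVneq (size mu) (T' (size x)).
    by have [u uP] := run x q mu szmu; exists u.
  by exists ([::], [::], [::]) => /ne.
pose X qm := enc_view ((g qm).1.1, (g qm).2).
have view_eq (o : fd_space (fprod (Po x w) (coins R (T' (size x))))) v' :
    X (fd_val o) = enc_view v' <-> has_view A' x (fd_val o).1 (fd_val o).2 v'.
  have szo : size (fd_val o).2 = T' (size x) by apply: size_tuple.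
  have [t [t' [m [M' [_ ex' [/preT pre le_t] _ _]]]]] := gP _ szo.
  split=> [/enc_view_inj <-|[out [t1 runs1]]].
    by exists (M' 0%N), t'; split=> //; exists M'.
  have runs0 : runs (bits_oracle (fd_val o).1) A' (enc_bits x) (fd_val o).2
      (g (fd_val o)).1.1 (g (fd_val o)).2 (M' 0%N) t' by split=> //; exists M'.
  by have [eq1 eq2 _ _] := runs_det runs0 runs1 pre; rewrite /X eq1 eq2; case: (v').
pose E S := Cons (dhd S) (enc_seq (map enc_bits (H (x, S)))) = enc_view v.
(* Both the output of the final simulator and the view of [A] are obtained by the same map from a
   view of A', simulated or real, so the event can be moved from [Sim] to the true views [X]. *)
rewrite (Pr_transfer (D2 := fprod (Po x w) (coins R (T' (size x)))) (X1 := Sim x) (X2 := X) E).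
  rewrite (Pr_eq (E' := fun qm => has_view A x (composed Vo f r_out x qm.1)
      (take (T (size x)) qm.2) v)).
    rewrite !Pr_fprod; apply: eq_bigr => o _; congr (_ * _).
    exact: (@Pr_coins_take R _ _
      (fun mu => has_view A x (composed Vo f r_out x (fd_val o)) mu v) (leq_addr _ _)).
  move=> o _; have szo : size (fd_val o).2 = T' (size x) by apply: size_tuple.
  have [t [t' [m [M' [ex ex' [pre le_t] _ eqM]]]]] := gP _ szo.
  (* The real run of A' is itself a replay of its view, and by [replays_det] the choice [H] cannot
     differ from it. *)
  have ansE : H (x, X (fd_val o)) = (g (fd_val o)).1.2.
    apply: (replays_det pm (HP (x, X (fd_val o)))).
    have [ls a'E lex] := exec_lexec ex'.
    exists (fd_val o).1, (g (fd_val o)).1.1, ls, t', M'; split=> //.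
    + exact: leq_trans le_t (le_size x).
    + exact: reads_enc.
    + by rewrite /X /= a'E; apply: memo_compatible_genuine.
  rewrite /E ansE -[Cons _ _]/(enc_view ((g (fd_val o)).1.1, (g (fd_val o)).1.2)).
  split=> [/enc_view_inj <-|[out [t1 runs1]]].
    by exists (m 0%N), t; split=> //; exists m.
  have runs0 : runs (bits_oracle (composed Vo f r_out x (fd_val o).1)) A (enc_bits x)
      (take (T (size x)) (fd_val o).2) (g (fd_val o)).1.1 (g (fd_val o)).1.2 (m 0%N) t.
    by split=> //; exists m.
  by have [-> -> _ _] := runs_det runs0 runs1 pre; case: (v).
move=> o; rewrite (sim_eq x w Rxw); apply: Pr_eq => o' _; symmetry; exact: view_eq.
Qed.

End Composition.

Theorem theorem3p7 (R : realType) (Rel : seq bool -> seq bool -> Prop)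
    (r_out r_in d_out d_in q_out q_in qstar : nat -> nat)
    (eps_out eps_in rho_out delta_in : nat -> R)
    (eps_out01 : forall n, 0 <= eps_out n <= 1)
    (eps_in01 : forall n, 0 <= eps_in n <= 1)
    (rho_out01 : forall n, 0 <= rho_out n <= 1)
    (delta_in01 : forall n, 0 <= delta_in n <= 1)
    (outer : has_robust_zk_pcp boolean Rel r_out q_out d_out
               (fun n => 1 - eps_out n) rho_out qstar)
    (inner : has_boolean_pcpp_det_prover circuit_value r_in q_in d_in
               delta_in (fun n => 1 - eps_in n))
    (proximity : forall n, delta_in (d_out n) <= rho_out n) :
  exists S : alphabet,
    has_zk_pcp S Rel
      (fun n => r_out n + r_in (d_out n))%N
      (fun n => q_in (d_out n))
      (fun n => d_in (d_out n))
      (fun n => 1 - eps_out n * eps_in (d_out n))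
      (fun n => qstar n %/ q_out n)%N.
Proof.
have [Po [Vo [[Vo_ppt Vo_size] out_complete out_sound out_zk]]] := outer.
have [Pi [Vi [[f [Pi_det Pi_poly]] [Vi_ppt Vi_size] in_complete in_sound]]] := inner.
have [Mo [po [uco Mo_ok]]] := ppt_runs leq_size_enc_bits Vo_ppt.
have [Mi [pi [uci Mi_ok]]] := ppt_runs leq_csize_enc Vi_ppt.
have le_Cy (Cy : circuit * seq bool) :
    (csize Cy.1 + size Cy.2 <= dsize (Cons (enc_circuit Cy.1) (enc_bits Cy.2)))%N.
  by rewrite /= leqW // leq_add ?leq_csize_enc ?leq_size_enc_bits.
have [Mf [pf [ucf Mf_ok]]] := ppt_runs le_Cy Pi_poly.
have Vo_size' x mu : size mu = r_out (size x) ->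
    [/\ (size (nv_query Vo x mu) <= q_out (size x))%N,
      c_inputs (nv_circuit Vo x mu) = size (nv_query Vo x mu)
    & csize (nv_circuit Vo x mu) = d_out (size x)].
  by case/Vo_size; rewrite muln1.
have Vi_size' C mu : size mu = r_in (csize C) ->
    [/\ (size (nv_query Vi C mu) <= q_in (csize C))%N,
      c_inputs (nv_circuit Vi C mu) = size (nv_query Vi C mu)
    & csize (nv_circuit Vi C mu) = d_in (csize C)].
  by case/Vi_size; rewrite muln1.
exists boolean; do 2 eexists; split.
- exact: composed_complexity Mo_ok Mi_ok Vo_size' Vi_size'.
- exact: composed_complete Mo_ok Vo_size' Pi_det out_complete in_complete.
- exact: composed_sound Mo_ok Vo_size' eps_in01 proximity out_sound in_sound.
- exact: composed_zk Mo_ok Mf_ok Vo_size' out_zk.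
Qed.
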